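(* Let $d\ge1$, $0<\theta<1$, and let $\phi\colon\mathbb{D}^d\to\mathbb{D}^d$ be the multi-lens map with parameter $\theta$, i.e. $\phi(z_1,\ldots,z_d)=(\lambda_\theta(z_1),\ldots,\lambda_\theta(z_d))$. Then the composition operator $C_\phi\colon H^2(\mathbb{D}^d)\to H^2(\mathbb{D}^d)$, $C_\phi f=f\circ\phi$, satisfies, for positive constants $a,b,a',b'$ depending only on $\theta$ and $d$, $$a'\,e^{-b' n^{1/(2d)}}\le a_n(C_\phi)\le a\,e^{-b\,n^{1/(2d+1)}}\qquad(n\ge1).$$ In particular $\gamma_d^{-}(C_\phi)=0$, although $C_\phi$ belongs to every Schatten class $S_p$, $p>0$.
   Context: $\mathbb{D}$ is the open unit disk and $\mathbb{D}^d$ the unit polydisk. For $0<\theta<1$ the lens map is $\lambda_\theta(z)=\frac{(1+z)^\theta-(1-z)^\theta}{(1+z)^\theta+(1-z)^\theta}$, $z\in\mathbb{D}$ (principal branches of the powers). $H^2(\mathbb{D}^d)$ is the Hilbert space of holomorphic $f$ on $\mathbb{D}^d$ with $\|f\|^2=\sup_{0<r<1}\int_{\mathbb{T}^d}|f(r\xi)|^2\,dm(\xi)<\infty$, $m$ the normalized Haar measure on the torus $\mathbb{T}^d$. The approximation numbers of a bounded operator $T$ on a Hilbert space are $a_n(T)=\inf\{\|T-R\|:\operatorname{rank}R<n\}$; $\gamma_d^{-}(T)=\liminf_{n\to\infty}\frac{\log(1/a_n(T))}{n^{1/d}}$; $T$ is in the Schatten class $S_p$ if $\sum_n a_n(T)^p<\infty$.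 *)

(* Defs.v *)
From Stdlib Require Import Reals Lra List.
From Coquelicot Require Import Coquelicot.
Open Scope R_scope.

Definition Cexp (z : C) : C :=
  (exp (Re z) * cos (Im z), exp (Re z) * sin (Im z)).

(* principal argument, with values in (-PI, PI] *)
Definition Carg (w : C) : R :=
  let x := Re w in let y := Im w in
  match Rlt_dec 0 x with
  | left _ => atan (y / x)
  | right _ =>
    match Rlt_dec x 0 with
    | left _ => match Rle_dec 0 y with
                | left _ => atan (y / x) + PI
                | right _ => atan (y / x) - PI
                end
    | right _ =>
      match Rlt_dec 0 y with
      | left _ => PI / 2
      | right _ => match Rlt_dec y 0 with
                   | left _ => - (PI / 2)
                   | right _ => 0
                   end
      end
    end
  end.

Definition Clog (w : C) : C := (ln (Cmod w), Carg w).

Definition Cpow_real (w : C) (a : R) : C :=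
  if Ceq_dec w 0%C then 0%C else Cexp (Cmult (RtoC a) (Clog w)).

Definition lens (theta : R) (z : C) : C :=
  Cdiv (Cminus (Cpow_real (Cplus 1 z) theta) (Cpow_real (Cminus 1 z) theta))
       (Cplus  (Cpow_real (Cplus 1 z) theta) (Cpow_real (Cminus 1 z) theta)).

(* A point of C^d is encoded as z : nat -> C whose coordinates of index >= d
   vanish; the polydisk D^d is the set of such z with |z i| < 1 for i < d. *)

Definition in_polydisk (d : nat) (z : nat -> C) : Prop :=
  (forall i, (i < d)%nat -> Cmod (z i) < 1) /\ (forall i, (d <= i)%nat -> z i = 0%C).

Definition upd (z : nat -> C) (i : nat) (v : C) : nat -> C :=
  fun j => if Nat.eqb j i then v else z j.

Definition multi_lens (d : nat) (theta : R) (z : nat -> C) : nat -> C :=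
  fun i => if Nat.ltb i d then lens theta (z i) else 0%C.

(* holomorphic = continuous on D^d and complex differentiable in each
   variable separately (Osgood's definition, cf. Rudin, Function theory in
   polydiscs). Only values on D^d are relevant. *)
Definition holomorphic_polydisk (d : nat) (f : (nat -> C) -> C) : Prop :=
  forall z, in_polydisk d z ->
    (forall eps, 0 < eps -> exists del, 0 < del /\
       forall w, in_polydisk d w ->
         (forall i, (i < d)%nat -> Cmod (Cminus (w i) (z i)) < del) ->
         Cmod (Cminus (f w) (f z)) < eps) /\
    (forall i, (i < d)%nat -> exists l : C,
       forall eps, 0 < eps -> exists del, 0 < del /\
         forall h : C, h <> 0%C -> Cmod h < del ->
           Cmod (Cminus (Cdiv (Cminus (f (upd z i (Cplus (z i) h))) (f z)) h) l) < eps).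

Fixpoint cube_int (k : nat) (F : (nat -> R) -> R) (t : nat -> R) : R :=
  match k with
  | O => F t
  | S k' => RInt (fun s => cube_int k' F (fun j => if Nat.eqb j k' then s else t j)) 0 1
  end.

Definition torus_pt (d : nat) (r : R) (t : nat -> R) : nat -> C :=
  fun i => if Nat.ltb i d then Cmult (RtoC r) (Cexp (0, 2 * PI * t i)) else 0%C.

(* integral of |f(r xi)|^2 against the normalized Haar measure of T^d *)
Definition torus_mean2 (d : nat) (f : (nat -> C) -> C) (r : R) : R :=
  cube_int d (fun t => (Cmod (f (torus_pt d r t))) ^ 2) (fun _ => 0).

Definition H2_norm2 (d : nat) (f : (nat -> C) -> C) : Rbar :=
  Lub_Rbar (fun x => exists r, 0 < r < 1 /\ x = torus_mean2 d f r).

Definition H2 (d : nat) (f : (nat -> C) -> C) : Prop :=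
  holomorphic_polydisk d f /\ is_finite (H2_norm2 d f).

Definition H2_norm (d : nat) (f : (nat -> C) -> C) : R := sqrt (real (H2_norm2 d f)).

Definition op := ((nat -> C) -> C) -> ((nat -> C) -> C).

(* T is a (well defined) linear operator H^2(D^d) -> H^2(D^d);
   elements of H^2 are identified when equal on D^d *)
Definition H2_linear_op (d : nat) (T : op) : Prop :=
  (forall f, H2 d f -> H2 d (T f)) /\
  (forall f g, H2 d f -> H2 d g -> (forall z, in_polydisk d z -> f z = g z) ->
     forall z, in_polydisk d z -> T f z = T g z) /\
  (forall f g (a b : C), H2 d f -> H2 d g ->
     forall z, in_polydisk d z ->
       T (fun w => Cplus (Cmult a (f w)) (Cmult b (g w))) z
       = Cplus (Cmult a (T f z)) (Cmult b (T g z))).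

Definition op_norm (d : nat) (T : op) : Rbar :=
  Lub_Rbar (fun x => exists f, H2 d f /\ H2_norm d f <= 1 /\ x = H2_norm d (T f)).

Fixpoint lin_comb (cs : list C) (gs : list ((nat -> C) -> C)) (z : nat -> C) : C :=
  match cs, gs with
  | c :: cs', g :: gs' => Cplus (Cmult c (g z)) (lin_comb cs' gs' z)
  | _, _ => 0%C
  end.

Definition rank_lt (d : nat) (T : op) (n : nat) : Prop :=
  exists gs : list ((nat -> C) -> C), (length gs < n)%nat /\
    (forall g, In g gs -> H2 d g) /\
    forall f, H2 d f -> exists cs : list C,
      forall z, in_polydisk d z -> T f z = lin_comb cs gs z.

Definition op_sub (T S : op) : op := fun f z => Cminus (T f z) (S f z).

Definition approx_num (d : nat) (T : op) (n : nat) : Rbar :=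
  Glb_Rbar (fun x => exists S : op, H2_linear_op d S /\ is_finite (op_norm d S) /\
                      rank_lt d S n /\ op_norm d (op_sub T S) = Finite x).

Definition gamma_minus (d : nat) (T : op) : Rbar :=
  LimInf_seq (fun n => ln (1 / real (approx_num d T (S n)))
                       / Rpower (INR (S n)) (1 / INR d)).

Definition schatten (d : nat) (T : op) (p : R) : Prop :=
  ex_series (fun n => Rpower (real (approx_num d T (S n))) p).

Definition comp_op (phi : (nat -> C) -> (nat -> C)) : op := fun f z => f (phi z).

(* Main.v *)
Require Import Defs.
From Stdlib Require Import Reals Lra Lia List FunctionalExtensionality ClassicalEpsilon.
From Coquelicot Require Import Coquelicot.
Open Scope R_scope.

(** By Cauchy's formula a combination [g |-> sum_j c_j g(p_j)] of point evaluations is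
    integration over the circle against [k = sum_j c_j / (1 - p_j s)], so its squared norm on
    H^2 of the disk is at most the mean of [|k|^2]; tensor products of such functionals are
    bounded by the products of these constants.

    Upper bound.  Interpolation at real nodes [v_j] replaces the reproducing kernel
    [1 / (1 - w s)] by a combination of the [1 / (1 - v_j s)] with error
    [B(w) B(s) / (1 - w s)], [B] the Blaschke product of the nodes.  With [l = log ((1 - z) / (1 + z))]
    one has [lens theta z = (1 - e^(theta l)) / (1 + e^(theta l))], where [|Im l| < pi / 2];
    hence the image lies in a Stolz domain, and [4 m^2] nodes equidistant for the hyperbolic metric
    make [|B(w)|^2 / (1 - |w|^2)] at most [A q^m K(z)] with [K] positive and harmonic, in particular
    of constant mean over circles.  Interpolating in all [d] variables has rank [(4 m^2)^d] and
    error [O(q^(m/2))], that is, [a_n <= a exp (- b n^(1/(2d)))].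

    Lower bound.  On a grid of [p^(2d)] points [u_J] of hyperbolic mesh [1/p], the images
    [lens theta u_J] are an interpolating set with constant [e^(O(p))]; an operator of rank less
    than [p^(2d)] kills some normalized combination of the dual functions, and evaluation at the
    point [u_J] carrying the largest coefficient bounds the norm from below. *)

(** * Complex differentiability *)

(** Upper and lower bound rest on one balance. In the coordinate [Re l] the lens map is
    multiplication by [theta]. Points of density [m] over a length of order [m] are needed, hence
    order [m^2] points per variable: the density gains a factor exponential in [m], and so does the
    truncation. The points beyond the last node are handled by a harmonic majorant of exponent
    [theta'] with [theta < theta' < 1]: [theta' < 1] keeps it positive, [theta' > theta] leaves the
    spare factor [e^(-(theta' - theta) |Re l|)]. The lower bound meets the same count, so
    [log (1 / a_n)] has exact order [n^(1/(2d))], which settles both [gamma_minus] and the Schatten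
    classes. The norm of H^2 is a supremum of iterated integrals. Operators are therefore estimated
    pointwise, one variable at a time, against products of functions of single variables, whose
    torus means are explicit. Holomorphy means continuity and separate differentiability, so
    Cauchy's formula has to start from Goursat's theorem, without continuity of the derivative. *)

Notation ccont f x := (continuous (U := C_UniformSpace) f x).

Lemma Cmod_sym (x y : C) : Cmod (x - y) = Cmod (y - x).
Proof. rewrite <- Cmod_opp. f_equal. ring. Qed.

Lemma Cmod_triangle_inv (x y : C) : Cmod x - Cmod y <= Cmod (x - y).
Proof.
  assert (H := Cmod_triangle (x - y) y).
  replace (x - y + y)%C with x in H by ring. lra.
Qed.

(** Balls of [C_UniformSpace] are squares; passing from them to discs costs the factor [sqrt 2]. *)
Lemma locally_Cmod (z : C) (P : C -> Prop) :
  locally (T := C_UniformSpace) z P <-> exists del, 0 < del /\ forall w, Cmod (w - z) < del -> P w.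
Proof.
  split.
  - intros [e H]. exists e. split; [apply cond_pos|]. intros w Hw. apply H.
    apply C_NormedModule_mixin_compat1. exact Hw.
  - intros [del [Hd H]].
    assert (Hs : 0 < del / sqrt 2) by (apply Rdiv_lt_0_compat; [lra|apply sqrt_lt_R0; lra]).
    exists (mkposreal _ Hs). intros w Hw. apply H.
    apply C_NormedModule_mixin_compat2 in Hw. simpl in Hw.
    replace (sqrt 2 * (del / sqrt 2)) with del in Hw by (field; apply Rgt_not_eq, sqrt_lt_R0; lra).
    exact Hw.
Qed.

Lemma ccont_eps {U : UniformSpace} (f : U -> C) x :
  ccont f x <-> forall eps, 0 < eps -> locally x (fun y => Cmod (f y - f x) < eps).
Proof.
  split.
  - intros H eps He. apply (H (fun w => Cmod (w - f x) < eps)).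
    apply locally_Cmod. exists eps. split; auto.
  - intros H P HP. apply locally_Cmod in HP. destruct HP as [del [Hd HP]].
    unfold filtermap. generalize (H del Hd). apply filter_imp. intros y; apply HP.
Qed.

Lemma ccont_const {U : UniformSpace} (c : C) (x : U) : ccont (fun _ => c) x.
Proof. apply continuous_const. Qed.

Lemma ccont_id (z : C) : ccont (fun w : C_UniformSpace => w) z.
Proof. apply continuous_id. Qed.

Lemma ccont_plus {U : UniformSpace} (f g : U -> C) x :
  ccont f x -> ccont g x -> ccont (fun y => f y + g y)%C x.
Proof. intros. apply (continuous_plus (V := C_NormedModule)); assumption. Qed.

Lemma ccont_opp {U : UniformSpace} (f : U -> C) x :
  ccont f x -> ccont (fun y => - f y)%C x.
Proof. intros. apply (continuous_opp (V := C_NormedModule)); assumption. Qed.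

Lemma ccont_minus {U : UniformSpace} (f g : U -> C) x :
  ccont f x -> ccont g x -> ccont (fun y => f y - g y)%C x.
Proof. intros. apply ccont_plus; [|apply ccont_opp]; assumption. Qed.

Lemma ccont_mult {U : UniformSpace} (f g : U -> C) x :
  ccont f x -> ccont g x -> ccont (fun y => f y * g y)%C x.
Proof.
  intros Hf Hg. rewrite ccont_eps in *. intros eps He.
  set (M := Cmod (f x) + Cmod (g x) + 1).
  assert (H1 := Cmod_ge_0 (f x)). assert (H2 := Cmod_ge_0 (g x)).
  assert (HM : 0 < M) by (unfold M; lra).
  set (e := Rmin 1 (eps / (2 * M))).
  assert (He1 : 0 < e).
  { apply Rmin_pos; [lra|apply Rdiv_lt_0_compat; lra]. }
  generalize (filter_and _ _ (Hf e He1) (Hg e He1)). apply filter_imp.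
  intros y [Hy1 Hy2].
  replace (f y * g y - f x * g x)%C with ((f y - f x) * (g y - g x) + (f y - f x) * g x + f x * (g y - g x))%C by ring.
  eapply Rle_lt_trans; [apply Cmod_triangle|].
  assert (Ht := Cmod_triangle ((f y - f x) * (g y - g x)) ((f y - f x) * g x)).
  rewrite !Cmod_mult in *.
  assert (e <= 1) by apply Rmin_l.
  assert (e * (2 * M) <= eps).
  { apply Rle_trans with (eps / (2 * M) * (2 * M)).
    - apply Rmult_le_compat_r; [lra|apply Rmin_r].
    - right; field; lra. }
  assert (Ha := Cmod_ge_0 (f y - f x)). assert (Hb := Cmod_ge_0 (g y - g x)).
  assert (Cmod (f y - f x) * Cmod (g y - g x) <= e * 1) by (apply Rmult_le_compat; lra).
  assert (Cmod (f y - f x) * Cmod (g x) <= e * Cmod (g x)) by (apply Rmult_le_compat_r; lra).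
  assert (Cmod (f x) * Cmod (g y - g x) <= Cmod (f x) * e) by (apply Rmult_le_compat_l; lra).
  unfold M in *. nra.
Qed.

Lemma ccont_inv_C (z : C) : z <> 0%C -> ccont (fun w : C_UniformSpace => / w)%C z.
Proof.
  intros Hz. apply ccont_eps. intros eps He. apply locally_Cmod.
  apply Cmod_gt_0 in Hz. set (m := Cmod z) in *.
  exists (Rmin (m / 2) (eps * m * m / 2)).
  assert (0 < eps * m * m / 2) by (assert (0 < eps * m) by nra; nra).
  split; [apply Rmin_pos; lra|]. intros w Hw.
  assert (H1 : Cmod (w - z) < m / 2) by (eapply Rlt_le_trans; [exact Hw|apply Rmin_l]).
  assert (H2 : Cmod (w - z) < eps * m * m / 2) by (eapply Rlt_le_trans; [exact Hw|apply Rmin_r]).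
  assert (Hm : m / 2 < Cmod w).
  { assert (H3 := Cmod_triangle_inv z w). rewrite Cmod_sym in H3. fold m in H3. lra. }
  assert (Hw0 : w <> 0%C) by (apply Cmod_gt_0; lra).
  assert (Hz0 : z <> 0%C) by (apply Cmod_gt_0; fold m; lra).
  replace (/ w - / z)%C with (- (w - z) / (w * z))%C by (field; auto).
  assert (Hwz : (w * z)%C <> 0%C) by (apply Cmult_neq_0; auto).
  rewrite Cmod_div by auto. rewrite Cmod_opp, Cmod_mult. fold m.
  apply Rmult_lt_reg_r with (Cmod w * m); [nra|].
  unfold Rdiv. rewrite Rmult_assoc, Rinv_l by nra. rewrite Rmult_1_r.
  assert (eps * (m * (m / 2)) < eps * (m * Cmod w)) by (apply Rmult_lt_compat_l; [lra|nra]).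
  nra.
Qed.

Lemma ccont_inv {U : UniformSpace} (f : U -> C) x :
  ccont f x -> f x <> 0%C -> ccont (fun y => / f y)%C x.
Proof. intros. apply (continuous_comp (V := C_UniformSpace)); [assumption|now apply ccont_inv_C]. Qed.

Lemma ccont_div {U : UniformSpace} (f g : U -> C) x :
  ccont f x -> ccont g x -> g x <> 0%C -> ccont (fun y => f y / g y)%C x.
Proof. intros. apply ccont_mult; [|apply ccont_inv]; assumption. Qed.

Lemma ccont_pair {U : UniformSpace} (f g : U -> R) x :
  continuous f x -> continuous g x -> ccont (fun y => (f y, g y)) x.
Proof.
  intros Hf Hg. apply filterlim_locally. intros eps.
  assert (H1 := proj1 (filterlim_locally _ _) Hf eps).
  assert (H2 := proj1 (filterlim_locally _ _) Hg eps).
  generalize (filter_and _ _ H1 H2). apply filter_imp. intros y [? ?]. split; assumption.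
Qed.

Lemma ccont_fst {U : UniformSpace} (f : U -> C) x :
  ccont f x -> continuous (fun y => fst (f y)) x.
Proof.
  intros H. apply filterlim_locally. intros eps.
  generalize (proj1 (filterlim_locally _ _) H eps). apply filter_imp. intros y [? ?]. assumption.
Qed.

Lemma ccont_snd {U : UniformSpace} (f : U -> C) x :
  ccont f x -> continuous (fun y => snd (f y)) x.
Proof.
  intros H. apply filterlim_locally. intros eps.
  generalize (proj1 (filterlim_locally _ _) H eps). apply filter_imp. intros y [? ?]. assumption.
Qed.

Lemma continuous_Cmod {U : UniformSpace} (f : U -> C) x :
  ccont f x -> continuous (fun y => Cmod (f y)) x.
Proof.
  intros H. apply (continuous_comp (V := C_UniformSpace) f Cmod); [exact H|].
  apply filterlim_locally. intros eps. apply locally_Cmod. exists eps.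
  split; [apply cond_pos|]. intros w Hw.
  change (Rabs (Cmod w - Cmod (f x)) < eps).
  assert (H1 := Cmod_triangle_inv w (f x)). assert (H2 := Cmod_triangle_inv (f x) w).
  rewrite Cmod_sym in H2. apply Rabs_def1; lra.
Qed.

(* Caratheodory's form of complex differentiability: [q z] is the derivative. *)
Definition Cdiff (g : C -> C) (z : C) : Prop :=
  exists q : C -> C, ccont q z /\ forall w, (g w = g z + q w * (w - z))%C.

Lemma Cdiff_cont g z : Cdiff g z -> ccont g z.
Proof.
  intros [q [Hq H]]. apply (continuous_ext (fun w => g z + q w * (w - z))%C).
  - intros w. symmetry; apply H.
  - apply ccont_plus; [apply ccont_const|]. apply ccont_mult; [exact Hq|].
    apply ccont_minus; [apply ccont_id|apply ccont_const].
Qed.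

(** Converts the difference quotients of [holomorphic_polydisk] into a slope function: the quotient
    itself away from [z], the limit [l] at [z]. *)
Lemma Cdiff_limit (g : C -> C) (z l : C) :
  (forall eps, 0 < eps -> exists del, 0 < del /\
     forall h : C, h <> 0%C -> Cmod h < del ->
       Cmod (Cminus (Cdiv (Cminus (g (Cplus z h)) (g z)) h) l) < eps) -> Cdiff g z.
Proof.
  intros H.
  exists (fun w => if Ceq_dec w z then l else (g w - g z) / (w - z))%C. split.
  - apply ccont_eps. intros eps He. apply locally_Cmod.
    destruct (H eps He) as [del [Hd Hh]]. exists del. split; [exact Hd|]. intros w Hw.
    destruct (Ceq_dec z z) as [_|n]; [|contradiction].
    destruct (Ceq_dec w z) as [E|n].
    + subst w. unfold Cminus. rewrite Cplus_opp_r, Cmod_0. exact He.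
    + specialize (Hh (w - z)%C). replace (z + (w - z))%C with w in Hh by ring.
      apply Hh; [|exact Hw]. now apply Cminus_eq_contra.
  - intros w. destruct (Ceq_dec w z) as [E|n]; [subst; ring|].
    field. now apply Cminus_eq_contra.
Qed.

Lemma Cdiff_limit_inv (g : C -> C) (z : C) : Cdiff g z -> exists l,
  (forall eps, 0 < eps -> exists del, 0 < del /\
     forall h : C, h <> 0%C -> Cmod h < del ->
       Cmod (Cminus (Cdiv (Cminus (g (Cplus z h)) (g z)) h) l) < eps).
Proof.
  intros [q [Hq H]]. exists (q z). intros eps He.
  rewrite ccont_eps in Hq. specialize (Hq eps He). apply locally_Cmod in Hq.
  destruct Hq as [del [Hd Hw]]. exists del. split; [exact Hd|]. intros h Hh Hl.
  rewrite (H (z + h)%C).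
  replace ((g z + q (z + h) * (z + h - z) - g z) / h - q z)%C with (q (z + h) - q z)%C by (field; exact Hh).
  apply Hw. now replace (z + h - z)%C with h by ring.
Qed.

Lemma Cdiff_loc (f g : C -> C) z :
  locally (T := C_UniformSpace) z (fun w => f w = g w) -> Cdiff f z -> Cdiff g z.
Proof.
  intros Hl Hf. apply Cdiff_limit_inv in Hf. destruct Hf as [l Hf].
  apply Cdiff_limit with l. intros eps He.
  destruct (Hf eps He) as [d1 [Hd1 H1]].
  apply locally_Cmod in Hl. destruct Hl as [d2 [Hd2 H2]].
  exists (Rmin d1 d2). split; [now apply Rmin_pos|]. intros h Hh Hl.
  rewrite <- !H2.
  - apply H1; [exact Hh|]. eapply Rlt_le_trans; [exact Hl|apply Rmin_l].
  - replace (z - z)%C with (RtoC 0) by ring. now rewrite Cmod_0.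
  - replace (z + h - z)%C with h by ring. eapply Rlt_le_trans; [exact Hl|apply Rmin_r].
Qed.

Lemma Cdiff_const c z : Cdiff (fun _ => c) z.
Proof. exists (fun _ => 0%C). split; [apply ccont_const|intros; ring]. Qed.

Lemma Cdiff_id z : Cdiff (fun w => w) z.
Proof. exists (fun _ => 1%C). split; [apply ccont_const|intros; ring]. Qed.

Lemma Cdiff_plus f g z : Cdiff f z -> Cdiff g z -> Cdiff (fun w => f w + g w)%C z.
Proof.
  intros [p [Hp Hf]] [q [Hq Hg]]. exists (fun w => p w + q w)%C. split.
  - now apply ccont_plus.
  - intros w. rewrite (Hf w), (Hg w). ring.
Qed.

Lemma Cdiff_mult f g z : Cdiff f z -> Cdiff g z -> Cdiff (fun w => f w * g w)%C z.
Proof.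
  intros Hf0 Hg0. assert (Hc := Cdiff_cont _ _ Hf0).
  destruct Hf0 as [p [Hp Hf]]. destruct Hg0 as [q [Hq Hg]].
  exists (fun w => p w * g z + f w * q w)%C. split.
  - apply ccont_plus; apply ccont_mult; auto; apply ccont_const.
  - intros w. rewrite (Hg w). generalize (Hf w). intros E. replace (f w * (g z + q w * (w - z)))%C with (f w * g z + f w * (q w * (w - z)))%C by ring. rewrite E at 1. ring.
Qed.

Lemma Cdiff_opp f z : Cdiff f z -> Cdiff (fun w => - f w)%C z.
Proof.
  intros [p [Hp Hf]]. exists (fun w => - p w)%C. split.
  - now apply ccont_opp.
  - intros w. rewrite (Hf w). ring.
Qed.

Lemma Cdiff_minus f g z : Cdiff f z -> Cdiff g z -> Cdiff (fun w => f w - g w)%C z.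
Proof. intros. apply Cdiff_plus; [|apply Cdiff_opp]; assumption. Qed.

(** Slopes multiply along a composition, with no case distinction on [g w = g z]; this is the
    advantage of Caratheodory's form. *)
Lemma Cdiff_comp f g z : Cdiff g z -> Cdiff f (g z) -> Cdiff (fun w => f (g w)) z.
Proof.
  intros Hg0. assert (Hc := Cdiff_cont _ _ Hg0).
  destruct Hg0 as [q [Hq Hg]]. intros [p [Hp Hf]].
  exists (fun w => p (g w) * q w)%C. split.
  - apply ccont_mult; [|exact Hq]. now apply (continuous_comp (V := C_UniformSpace)).
  - intros w. rewrite (Hf (g w)). rewrite (Hg w) at 2. ring.
Qed.

Lemma Cdiff_inv f z : Cdiff f z -> f z <> 0%C -> Cdiff (fun w => / f w)%C z.
Proof.
  intros Hf Hz. apply (Cdiff_comp (fun w => / w)%C f z Hf).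
  set (a := f z) in *.
  (* The identity in [Cdiff] is required at every [w], also at [w = 0]. Prescribing the value 0
     there makes the slope [1 / a^2], and nothing changes near [a]. *)
  apply (Cdiff_loc (fun w => if Ceq_dec w 0 then 0 else / w)%C).
  - apply locally_Cmod. exists (Cmod a). split; [now apply Cmod_gt_0|].
    intros w Hw. destruct (Ceq_dec w 0) as [E|n]; [|reflexivity].
    subst w. rewrite Cmod_sym in Hw. replace (a - 0)%C with a in Hw by ring. lra.
  - exists (fun w => if Ceq_dec w 0 then / (a * a) else - / (w * a))%C. split.
    + apply (continuous_ext_loc _ (fun w => - / (w * a))%C).
      * apply locally_Cmod. exists (Cmod a). split; [now apply Cmod_gt_0|].
        intros w Hw. destruct (Ceq_dec w 0) as [E|n]; [|reflexivity].
        subst w. rewrite Cmod_sym in Hw. replace (a - 0)%C with a in Hw by ring. lra.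
      * apply ccont_opp, ccont_inv; [|now apply Cmult_neq_0].
        apply ccont_mult; [apply ccont_id|apply ccont_const].
    + intros w. destruct (Ceq_dec a 0) as [E|_]; [contradiction|].
      destruct (Ceq_dec w 0) as [E|n]; [subst|]; field; auto.
Qed.

Lemma Cdiff_div f g z : Cdiff f z -> Cdiff g z -> g z <> 0%C -> Cdiff (fun w => f w / g w)%C z.
Proof. intros. apply Cdiff_mult; [|apply Cdiff_inv]; assumption. Qed.

(** * Complex integrals and Goursat's theorem *)

(* Restates an equality in the carrier of a canonical structure on [R] as one in [R]. *)
Ltac Req := match goal with |- ?x = ?y => change (@eq R x y) end.

Definition Cint (f : R -> C) (a b : R) : C :=
  (RInt (fun t => fst (f t)) a b, RInt (fun t => snd (f t)) a b).

Definition Ccont_on (f : R -> C) (a b : R) : Prop := forall t, a <= t <= b -> ccont f t.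

Lemma Ccont_on_fst f a b : a <= b -> Ccont_on f a b -> ex_RInt (fun t => fst (f t)) a b.
Proof.
  intros Hab H. apply (ex_RInt_continuous (V := R_CompleteNormedModule)). intros t.
  rewrite Rmin_left, Rmax_right by assumption. intros Ht. now apply ccont_fst, H.
Qed.

Lemma Ccont_on_snd f a b : a <= b -> Ccont_on f a b -> ex_RInt (fun t => snd (f t)) a b.
Proof.
  intros Hab H. apply (ex_RInt_continuous (V := R_CompleteNormedModule)). intros t.
  rewrite Rmin_left, Rmax_right by assumption. intros Ht. now apply ccont_snd, H.
Qed.

Lemma Cint_ext f g a b : a <= b -> (forall t, a <= t <= b -> f t = g t) -> Cint f a b = Cint g a b.
Proof.
  intros Hab H. unfold Cint. f_equal; apply RInt_ext; intros t;
  rewrite Rmin_left, Rmax_right by assumption; intros Ht; rewrite H; lra.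
Qed.

Lemma Cint_plus f g a b : a <= b -> Ccont_on f a b -> Ccont_on g a b ->
  Cint (fun t => f t + g t)%C a b = (Cint f a b + Cint g a b)%C.
Proof.
  intros Hab Hf Hg. unfold Cint, Cplus; cbn [fst snd]. f_equal.
  - apply (RInt_plus (V := R_CompleteNormedModule)); now apply Ccont_on_fst.
  - apply (RInt_plus (V := R_CompleteNormedModule)); now apply Ccont_on_snd.
Qed.

Lemma RInt_lin2 (f g : R -> R) (x y a b : R) : ex_RInt f a b -> ex_RInt g a b ->
  RInt (fun t => x * f t + y * g t) a b = x * RInt f a b + y * RInt g a b.
Proof.
  intros Hf Hg.
  rewrite (RInt_plus (V := R_CompleteNormedModule) (fun t => x * f t) (fun t => y * g t));
  [|now apply (ex_RInt_scal (V := R_CompleteNormedModule))..].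
  rewrite (RInt_scal (V := R_CompleteNormedModule) f), (RInt_scal (V := R_CompleteNormedModule) g) by assumption.
  reflexivity.
Qed.

Lemma Cint_scal c f a b : a <= b -> Ccont_on f a b ->
  Cint (fun t => c * f t)%C a b = (c * Cint f a b)%C.
Proof.
  intros Hab Hf. unfold Cint, Cmult; cbn [fst snd].
  assert (H1 := Ccont_on_fst f a b Hab Hf). assert (H2 := Ccont_on_snd f a b Hab Hf).
  f_equal.
  - rewrite (RInt_ext _ (fun t => fst c * fst (f t) + (- snd c) * snd (f t))) by (intros; simpl; ring).
    rewrite RInt_lin2 by assumption. Req; ring.
  - change (RInt (fun t => fst c * snd (f t) + snd c * fst (f t)) a b = fst c * RInt (fun t => snd (f t)) a b + snd c * RInt (fun t => fst (f t)) a b).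
    rewrite RInt_lin2 by assumption. Req; ring.
Qed.

Lemma Cint_minus f g a b : a <= b -> Ccont_on f a b -> Ccont_on g a b ->
  Cint (fun t => f t - g t)%C a b = (Cint f a b - Cint g a b)%C.
Proof.
  intros Hab Hf Hg.
  rewrite (Cint_ext _ (fun t => f t + (-1) * g t)%C) by (auto; intros; ring).
  rewrite Cint_plus, Cint_scal; auto; [ring|].
  intros t Ht. apply ccont_mult; [apply ccont_const|now apply Hg].
Qed.

Lemma Cint_chasles f a m b : a <= m <= b -> Ccont_on f a b ->
  (Cint f a b = Cint f a m + Cint f m b)%C.
Proof.
  intros Hab Hf. unfold Cint, Cplus; cbn [fst snd].
  assert (H1 : Ccont_on f a m) by (intros t Ht; apply Hf; lra).
  assert (H2 : Ccont_on f m b) by (intros t Ht; apply Hf; lra).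
  f_equal; symmetry; apply (RInt_Chasles (V := R_CompleteNormedModule)).
  - apply Ccont_on_fst; [lra|assumption].
  - apply Ccont_on_fst; [lra|assumption].
  - apply Ccont_on_snd; [lra|assumption].
  - apply Ccont_on_snd; [lra|assumption].
Qed.

Lemma RInt_abs_bound (f : R -> R) a b M : a <= b -> ex_RInt f a b ->
  (forall t, a <= t <= b -> Rabs (f t) <= M) -> Rabs (RInt f a b) <= M * (b - a).
Proof.
  intros Hab Hf HM.
  assert (Hc : forall c, RInt (fun _ => c) a b = c * (b - a)).
  { intros c. rewrite (RInt_const (V := R_CompleteNormedModule)). unfold scal; simpl; unfold mult; simpl. ring. }
  assert (H1 : RInt f a b <= RInt (fun _ => M) a b).
  { apply RInt_le; auto; [apply ex_RInt_const|]. intros t Ht.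
    specialize (HM t). apply Rabs_le_between in HM; lra. }
  assert (H2 : RInt (fun _ => - M) a b <= RInt f a b).
  { apply RInt_le; auto; [apply ex_RInt_const|]. intros t Ht.
    specialize (HM t). apply Rabs_le_between in HM; lra. }
  rewrite Hc in H1, H2. apply Rabs_le_between. lra.
Qed.

Lemma Cmod_le_sum (z : C) : Cmod z <= Rabs (fst z) + Rabs (snd z).
Proof.
  destruct z as [x y].
  replace (x, y) with (RtoC x + Ci * RtoC y)%C.
  - eapply Rle_trans; [apply Cmod_triangle|]. rewrite Cmod_mult, Cmod_Ci, !Cmod_R. simpl.
    replace (x + (0 * y - 1 * 0)) with x by ring.
    replace (0 + (0 * 0 + 1 * y)) with y by ring. lra.
  - apply injective_projections; simpl; ring.
Qed.

Lemma Cmod_fst (z : C) : Rabs (fst z) <= Cmod z.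
Proof. eapply Rle_trans; [apply Rmax_l|apply Rmax_Cmod]. Qed.

Lemma Cmod_snd (z : C) : Rabs (snd z) <= Cmod z.
Proof. eapply Rle_trans; [apply Rmax_r|apply Rmax_Cmod]. Qed.

(** The factor 2 comes from bounding the two components separately. It is harmless, as the lemma
    only serves errors that tend to 0. *)
Lemma Cint_bound f a b M : a <= b -> Ccont_on f a b ->
  (forall t, a <= t <= b -> Cmod (f t) <= M) -> Cmod (Cint f a b) <= 2 * M * (b - a).
Proof.
  intros Hab Hf HM. eapply Rle_trans; [apply Cmod_le_sum|]. unfold Cint; cbn [fst snd].
  assert (H1 := RInt_abs_bound _ a b M Hab (Ccont_on_fst f a b Hab Hf)).
  assert (H2 := RInt_abs_bound _ a b M Hab (Ccont_on_snd f a b Hab Hf)).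
  assert (H3 : forall t, a <= t <= b -> Rabs (fst (f t)) <= M).
  { intros t Ht. eapply Rle_trans; [apply Cmod_fst|now apply HM]. }
  assert (H4 : forall t, a <= t <= b -> Rabs (snd (f t)) <= M).
  { intros t Ht. eapply Rle_trans; [apply Cmod_snd|now apply HM]. }
  specialize (H1 H3). specialize (H2 H4). lra.
Qed.

Definition Cderiv (F : R -> C) (t : R) (l : C) : Prop :=
  is_derive (fun u => fst (F u)) t (fst l) /\ is_derive (fun u => snd (F u)) t (snd l).

Lemma Cderiv_cont F t l : Cderiv F t l -> ccont F t.
Proof.
  intros [H1 H2]. apply (continuous_ext (fun u => (fst (F u), snd (F u)))).
  - intros u. now destruct (F u).
  - apply ccont_pair; apply (ex_derive_continuous (V := R_NormedModule)); eexists; eassumption.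
Qed.

Lemma Cderiv_const c t : Cderiv (fun _ => c) t 0%C.
Proof. split; apply (is_derive_const (V := R_NormedModule)). Qed.

Lemma Cderiv_plus F G t l m : Cderiv F t l -> Cderiv G t m ->
  Cderiv (fun u => F u + G u)%C t (l + m)%C.
Proof. intros [H1 H2] [H3 H4]. split; now apply (is_derive_plus (V := R_NormedModule)). Qed.

Lemma Cderiv_mult F G t l m : Cderiv F t l -> Cderiv G t m ->
  Cderiv (fun u => F u * G u)%C t (l * G t + F t * m)%C.
Proof.
  intros [H1 H2] [H3 H4].
  assert (HM : forall (f g : R -> R) (a b : R), is_derive f t a -> is_derive g t b ->
    is_derive (fun u => f u * g u) t (a * g t + f t * b)).
  { intros f g a b Ha Hb. apply (is_derive_mult f g); auto. intros; apply Rmult_comm. }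
  split; simpl.
  - replace (fst l * fst (G t) - snd l * snd (G t) + (fst (F t) * fst m - snd (F t) * snd m))
      with ((fst l * fst (G t) + fst (F t) * fst m) - (snd l * snd (G t) + snd (F t) * snd m)) by ring.
    apply (is_derive_minus (V := R_NormedModule)); now apply HM.
  - replace (fst l * snd (G t) + snd l * fst (G t) + (fst (F t) * snd m + snd (F t) * fst m))
      with ((fst l * snd (G t) + fst (F t) * snd m) + (snd l * fst (G t) + snd (F t) * fst m)) by ring.
    apply (is_derive_plus (V := R_NormedModule)); now apply HM.
Qed.

Lemma Cint_FTC F f a b : a <= b -> (forall t, a <= t <= b -> Cderiv F t (f t)) ->
  Ccont_on f a b -> (Cint f a b = F b - F a)%C.
Proof.
  intros Hab HF Hf. unfold Cint.
  apply injective_projections; cbn [fst snd]; apply is_RInt_unique.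
  - apply (is_RInt_derive (V := R_CompleteNormedModule) (fun t => fst (F t)));
    intros t; rewrite Rmin_left, Rmax_right by assumption; intros Ht.
    + now apply HF.
    + now apply ccont_fst, Hf.
  - apply (is_RInt_derive (V := R_CompleteNormedModule) (fun t => snd (F t)));
    intros t; rewrite Rmin_left, Rmax_right by assumption; intros Ht.
    + now apply HF.
    + now apply ccont_snd, Hf.
Qed.

(** An affine function has the primitive [A z + B z^2 / 2], so its integral along a curve depends on
    the endpoints only; what remains is the error [eta] times the speed [L]. *)
Lemma Cint_affine_approx (h : C -> C) (F F' : R -> C) (a b : R) (A B : C) (eta L : R) :
  a <= b -> (forall t, a <= t <= b -> Cderiv F t (F' t)) -> Ccont_on F' a b ->
  (forall t, a <= t <= b -> ccont h (F t)) ->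
  (forall t, a <= t <= b -> Cmod (F' t) <= L) ->
  (forall t, a <= t <= b -> Cmod (h (F t) - (A + B * F t)) <= eta) ->
  Cmod (Cint (fun t => h (F t) * F' t)%C a b
        - ((A * F b + B / 2 * (F b * F b)) - (A * F a + B / 2 * (F a * F a)))) <= 2 * (eta * L) * (b - a).
Proof.
  intros Hab HF HF' Hh HL He.
  assert (cF : Ccont_on F a b) by (intros t Ht; eapply Cderiv_cont, HF, Ht).
  assert (c1 : Ccont_on (fun t => h (F t) * F' t)%C a b).
  { intros t Ht. apply ccont_mult; [|now apply HF'].
    apply (continuous_comp (V := C_UniformSpace)); [now apply cF|now apply Hh]. }
  assert (c2 : Ccont_on (fun t => (A + B * F t) * F' t)%C a b).
  { intros t Ht. apply ccont_mult; [|now apply HF'].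
    apply ccont_plus; [apply ccont_const|apply ccont_mult; [apply ccont_const|now apply cF]]. }
  rewrite <- (Cint_FTC (fun t => A * F t + B / 2 * (F t * F t))%C (fun t => (A + B * F t) * F' t)%C); auto.
  - rewrite <- Cint_minus by assumption.
    apply Cint_bound; [assumption| |].
    + intros t Ht. apply ccont_minus; [now apply c1|now apply c2].
    + intros t Ht. replace (h (F t) * F' t - (A + B * F t) * F' t)%C with ((h (F t) - (A + B * F t)) * F' t)%C by ring.
      rewrite Cmod_mult. apply Rmult_le_compat; auto using Cmod_ge_0.
  - intros t Ht. specialize (HF t Ht).
    replace ((A + B * F t) * F' t)%C with
      ((0 * F t + A * F' t) + (0 * (F t * F t) + B / 2 * (F' t * F t + F t * F' t)))%C by field.
    apply Cderiv_plus; apply (Cderiv_mult (fun _ => _)); try apply Cderiv_const; auto.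
    now apply Cderiv_mult.
Qed.

(** Goursat's argument without its geometry: repeated quartering keeps a square of side [l] that
    carries at least [|J 0 1 0 1| l^2], whereas only [eps l^2] is available near the common point of
    these squares. *)
Lemma bisection (J : R -> R -> R -> R -> C) :
  (forall a m b c e, 0 <= a <= m -> m <= b <= 1 -> 0 <= c <= e -> e <= 1 ->
     J a b c e = (J a m c e + J m b c e)%C) ->
  (forall a b c m e, 0 <= a <= b -> b <= 1 -> 0 <= c <= m -> m <= e <= 1 ->
     J a b c e = (J a b c m + J a b m e)%C) ->
  (forall s0 t0 eps, 0 <= s0 <= 1 -> 0 <= t0 <= 1 -> 0 < eps -> exists del, 0 < del /\
     forall a c l, 0 <= a <= s0 -> s0 <= a + l <= 1 -> 0 <= c <= t0 -> t0 <= c + l <= 1 -> l < del ->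
       Cmod (J a (a + l) c (c + l)) <= eps * (l * l)) ->
  J 0 1 0 1 = 0%C.
Proof.
  intros Hs Ht Hsm.
  set (l := fun n : nat => (/ 2) ^ n).
  assert (lS : forall n, l n = l (S n) + l (S n)) by (intros n; unfold l; simpl; lra).
  assert (lpos : forall n, 0 < l n) by (intros n; apply pow_lt; lra).
  set (N := fun (p : R * R) (m : R) => Cmod (J (fst p) (fst p + m) (snd p) (snd p + m))).
  (* The fourth quarter needs no test: if the other three fail, it succeeds by the triangle
     inequality. *)
  set (step := fun (p : R * R) (m : R) =>
     if Rle_dec (N p (2 * m) / 4) (N p m) then p else
     if Rle_dec (N p (2 * m) / 4) (N (fst p + m, snd p) m) then (fst p + m, snd p) else
     if Rle_dec (N p (2 * m) / 4) (N (fst p, snd p + m) m) then (fst p, snd p + m) else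
     (fst p + m, snd p + m)).
  set (sq := fix sq n := match n with O => (0, 0) | S n => step (sq n) (l (S n)) end).
  assert (Hfs : forall n, fst (sq n) <= fst (sq (S n)) <= fst (sq n) + l (S n)).
  { intros n. assert (H := lpos (S n)). change (sq (S n)) with (step (sq n) (l (S n))). unfold step.
    repeat destruct Rle_dec; simpl fst; simpl; lra. }
  assert (Hsn : forall n, snd (sq n) <= snd (sq (S n)) <= snd (sq n) + l (S n)).
  { intros n. assert (H := lpos (S n)). change (sq (S n)) with (step (sq n) (l (S n))). unfold step.
    repeat destruct Rle_dec; simpl fst; simpl; lra. }
  assert (Hbd : forall n, 0 <= fst (sq n) /\ fst (sq n) + l n <= 1 /\ 0 <= snd (sq n) /\ snd (sq n) + l n <= 1).
  { induction n.
    - unfold l; simpl. lra.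
    - specialize (Hfs n). specialize (Hsn n). rewrite lS in IHn. lra. }
  assert (HN : forall n, N (sq n) (l n) / 4 <= N (sq (S n)) (l (S n))).
  { intros n. specialize (Hbd n). assert (Hl := lpos (S n)).
    change (sq (S n)) with (step (sq n) (l (S n))). rewrite (lS n) in *.
    set (m := l (S n)) in *. destruct (sq n) as [a c]. cbn [fst snd] in Hbd.
    assert (H4 : N (a, c) (2 * m) <= N (a, c) m + N (a + m, c) m + N (a, c + m) m + N (a + m, c + m) m).
    { unfold N; simpl.
      rewrite (Hs a (a + m) (a + 2 * m)) by lra.
      rewrite (Ht a (a + m) c (c + m)) by lra.
      rewrite (Ht (a + m) (a + 2 * m) c (c + m)) by lra.
      replace (c + 2 * m) with (c + m + m) by ring.
      replace (a + 2 * m) with (a + m + m) by ring.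
      eapply Rle_trans; [apply Cmod_triangle|].
      assert (E1 := Cmod_triangle (J a (a + m) c (c + m)) (J a (a + m) (c + m) (c + m + m))).
      assert (E2 := Cmod_triangle (J (a + m) (a + m + m) c (c + m)) (J (a + m) (a + m + m) (c + m) (c + m + m))).
      lra. }
    unfold step. replace (m + m) with (2 * m) by ring. cbn [fst snd].
    destruct Rle_dec; [assumption|]. destruct Rle_dec; [assumption|].
    destruct Rle_dec; [assumption|]. lra. }
  assert (HN2 : forall n, Cmod (J 0 1 0 1) * (l n * l n) <= N (sq n) (l n)).
  { induction n.
    - unfold N, l; simpl. rewrite !Rplus_0_l. lra.
    - specialize (HN n). rewrite lS in IHn at 1 2. unfold N in *. nra. }
  assert (Hmono : forall n k, fst (sq n) <= fst (sq (k + n)%nat) <= fst (sq n) + l n - l (k + n)%nat /\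
                              snd (sq n) <= snd (sq (k + n)%nat) <= snd (sq n) + l n - l (k + n)%nat).
  { intros n k. induction k.
    - simpl. lra.
    - replace (S k + n)%nat with (S (k + n)) by lia.
      assert (A1 := Hfs (k + n)%nat). assert (A2 := Hsn (k + n)%nat). assert (A3 := lS (k + n)%nat). lra. }
  assert (Hlim : forall u : nat -> R, (forall n k, u n <= u (k + n)%nat <= u n + l n) ->
    exists x, forall n, u n <= x <= u n + l n).
  { intros u Hu.
    destruct (completeness (fun x => exists n, x = u n)) as [x [Hx1 Hx2]].
    - exists (u O + l O). intros x [n Hn]. subst x. specialize (Hu O n). rewrite Nat.add_0_r in Hu. lra.
    - exists (u O). now exists O.
    - exists x. intros n. split.
      + apply Hx1. now exists n.
      + apply Hx2. intros y [k Hk]. subst y.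
        assert (A1 := Hu n k). assert (A2 := Hu k n). rewrite Nat.add_comm in A2. lra. }
  destruct (Hlim (fun n => fst (sq n))) as [s0 Hs0].
  { intros n k. assert (A := Hmono n k). assert (B := lpos (k + n)%nat). lra. }
  destruct (Hlim (fun n => snd (sq n))) as [t0 Ht0].
  { intros n k. assert (A := Hmono n k). assert (B := lpos (k + n)%nat). lra. }
  apply Cmod_eq_0. destruct (Rle_lt_or_eq_dec 0 (Cmod (J 0 1 0 1)) (Cmod_ge_0 _)) as [Hp|Hp]; [|auto].
  exfalso. set (M := Cmod (J 0 1 0 1)) in *.
  destruct (Hsm s0 t0 (M / 2)) as [del [Hd Hdel]].
  { specialize (Hs0 O). unfold l in Hs0; simpl in Hs0. lra. }
  { specialize (Ht0 O). unfold l in Ht0; simpl in Ht0. lra. }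
  { lra. }
  destruct (pow_lt_1_zero (/ 2)) with (y := del) as [n Hn]; [rewrite Rabs_pos_eq; lra|exact Hd|].
  specialize (Hn n (le_n n)). fold (l n) in Hn. rewrite Rabs_pos_eq in Hn by (left; apply lpos).
  specialize (Hs0 n). specialize (Ht0 n). specialize (Hbd n). specialize (HN2 n).
  specialize (Hdel (fst (sq n)) (snd (sq n)) (l n)). unfold N in HN2.
  assert (Hll : 0 < l n * l n) by (apply Rmult_lt_0_compat; apply lpos).
  assert (Hf : M * (l n * l n) <= M / 2 * (l n * l n)) by (eapply Rle_trans; [exact HN2|apply Hdel; lra]).
  nra.
Qed.

(** The integral of [h] along the boundary of the [Phi]-image of a parameter rectangle is additive
    under cuts. Quartering the parameters instead of a rectangle in the plane directly yields the
    deformation of one closed curve into another. *)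
Lemma goursat_square (h : C -> C) (Phi Ps Pt : R -> R -> C) (L : R) :
  (forall s t, 0 <= s <= 1 -> 0 <= t <= 1 ->
     Cderiv (fun u => Phi u t) s (Ps s t) /\ Cderiv (fun u => Phi s u) t (Pt s t) /\
     ccont (fun u => Ps u t) s /\ ccont (fun u => Pt s u) t /\
     Cmod (Ps s t) <= L /\ Cmod (Pt s t) <= L /\ Cdiff h (Phi s t)) ->
  (forall s t s' t', 0 <= s <= 1 -> 0 <= t <= 1 -> 0 <= s' <= 1 -> 0 <= t' <= 1 ->
     Cmod (Phi s t - Phi s' t') <= L * (Rabs (s - s') + Rabs (t - t'))) ->
  (Cint (fun t => h (Phi 1 t) * Pt 1 t) 0 1 - Cint (fun t => h (Phi 0 t) * Pt 0 t) 0 1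
   - Cint (fun s => h (Phi s 1) * Ps s 1) 0 1 + Cint (fun s => h (Phi s 0) * Ps s 0) 0 1 = 0)%C.
Proof.
  intros H HL.
  assert (HL0 : 0 <= L) by (eapply Rle_trans; [apply Cmod_ge_0|apply (H 0 0); lra]).
  set (X := fun s a b => Cint (fun t => h (Phi s t) * Pt s t)%C a b).
  set (Y := fun t a b => Cint (fun s => h (Phi s t) * Ps s t)%C a b).
  assert (cX : forall s a b, 0 <= s <= 1 -> 0 <= a -> b <= 1 -> Ccont_on (fun t => h (Phi s t) * Pt s t)%C a b).
  { intros s a b Hs Ha Hb t Ht. destruct (H s t) as (H1 & H2 & H3 & H4 & H5 & H6 & H7); try lra.
    apply ccont_mult; [|assumption]. apply (continuous_comp (V := C_UniformSpace)).
    - eapply Cderiv_cont, H2.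
    - now apply Cdiff_cont. }
  assert (cY : forall t a b, 0 <= t <= 1 -> 0 <= a -> b <= 1 -> Ccont_on (fun s => h (Phi s t) * Ps s t)%C a b).
  { intros t a b Hs Ha Hb s Ht. destruct (H s t) as (H1 & H2 & H3 & H4 & H5 & H6 & H7); try lra.
    apply ccont_mult; [|assumption]. apply (continuous_comp (V := C_UniformSpace) (fun u => Phi u t)).
    - eapply Cderiv_cont, H1.
    - now apply Cdiff_cont. }
  set (J := fun a b c e => (X b c e - X a c e - Y e a b + Y c a b)%C).
  change (J 0 1 0 1 = 0%C). apply bisection.
  - intros a m b c e Ha Hb Hc He. unfold J, Y.
    rewrite (Cint_chasles _ a m b) by (try lra; apply cY; lra).
    rewrite (Cint_chasles (fun s => h (Phi s c) * Ps s c)%C a m b) by (try lra; apply cY; lra). ring.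
  - intros a b c m e Ha Hb Hc He. unfold J, X.
    rewrite (Cint_chasles _ c m e) by (try lra; apply cX; lra).
    rewrite (Cint_chasles (fun t => h (Phi a t) * Pt a t)%C c m e) by (try lra; apply cX; lra). ring.
  - intros s0 t0 eps Hs0 Ht0 Heps.
    destruct (H s0 t0 Hs0 Ht0) as (_ & _ & _ & _ & _ & _ & [q [Hq Hqe]]).
    set (z0 := Phi s0 t0) in *.
    (* Each of the four sides contributes an error [4 L^2 l^2 eps / K]; the [+ 1] keeps [K] positive
       when [L = 0]. *)
    set (K := 16 * L * L + 1).
    assert (HK : 0 < K) by (unfold K; nra).
    rewrite ccont_eps in Hq. specialize (Hq (eps / K) (Rdiv_lt_0_compat _ _ Heps HK)).
    apply locally_Cmod in Hq. destruct Hq as [d1 [Hd1 Hq]].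
    assert (Hd : 0 < d1 / (2 * L + 1)) by (apply Rdiv_lt_0_compat; lra).
    exists (d1 / (2 * L + 1)). split; [exact Hd|].
    intros a c l Ha Hal Hc Hcl Hl.
    assert (Hl2 : l * (2 * L + 1) < d1).
    { apply Rmult_lt_compat_r with (r := 2 * L + 1) in Hl; [|lra].
      unfold Rdiv in Hl. rewrite Rmult_assoc, Rinv_l in Hl by lra. lra. }
    set (A := (h z0 - q z0 * z0)%C). set (B := q z0).
    assert (Hrem : forall s t, a <= s <= a + l -> c <= t <= c + l ->
       Cmod (h (Phi s t) - (A + B * Phi s t)) <= eps / K * (2 * L * l)).
    { intros s t Hs Ht.
      assert (Hz : Cmod (Phi s t - z0) <= 2 * L * l).
      { eapply Rle_trans; [apply HL; lra|].
        assert (Rabs (s - s0) <= l) by (apply Rabs_le_between; lra).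
        assert (Rabs (t - t0) <= l) by (apply Rabs_le_between; lra). nra. }
      rewrite (Hqe (Phi s t)). unfold A, B.
      replace (h z0 + q (Phi s t) * (Phi s t - z0) - (h z0 - q z0 * z0 + q z0 * Phi s t))%C
        with ((q (Phi s t) - q z0) * (Phi s t - z0))%C by ring.
      rewrite Cmod_mult. apply Rmult_le_compat; auto using Cmod_ge_0.
      left. apply Hq. nra. }
    assert (Hside : forall s, a <= s <= a + l -> Cmod (X s c (c + l) -
       ((A * Phi s (c + l) + B / 2 * (Phi s (c + l) * Phi s (c + l))) - (A * Phi s c + B / 2 * (Phi s c * Phi s c))))
       <= 2 * (eps / K * (2 * L * l) * L) * l).
    { intros s Hs. replace (2 * (eps / K * (2 * L * l) * L) * l) with (2 * (eps / K * (2 * L * l) * L) * (c + l - c)) by ring.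
      apply (Cint_affine_approx h (Phi s) (Pt s)); [lra|intros t Ht..|intros t Ht; apply Hrem; lra];
      destruct (H s t) as (H1 & H2 & H3 & H4 & H5 & H6 & H7); try lra; try assumption.
      now apply Cdiff_cont. }
    assert (Hside2 : forall t, c <= t <= c + l -> Cmod (Y t a (a + l) -
       ((A * Phi (a + l) t + B / 2 * (Phi (a + l) t * Phi (a + l) t)) - (A * Phi a t + B / 2 * (Phi a t * Phi a t))))
       <= 2 * (eps / K * (2 * L * l) * L) * l).
    { intros t Ht. replace (2 * (eps / K * (2 * L * l) * L) * l) with (2 * (eps / K * (2 * L * l) * L) * (a + l - a)) by ring.
      apply (Cint_affine_approx h (fun s => Phi s t) (fun s => Ps s t)); [lra|intros s Hs..|intros s Hs; apply Hrem; lra];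
      destruct (H s t) as (H1 & H2 & H3 & H4 & H5 & H6 & H7); try lra; try assumption.
      now apply Cdiff_cont. }
    assert (A1 := Hside (a + l)). assert (A2 := Hside a).
    assert (A3 := Hside2 (c + l)). assert (A4 := Hside2 c).
    clear Hside Hside2 Hrem.
    set (Q := fun z => (A * z + B / 2 * (z * z))%C).
    fold (Q (Phi (a + l) (c + l))) in *. fold (Q (Phi (a + l) c)) in *. fold (Q (Phi a (c + l))) in *. fold (Q (Phi a c)) in *.
    unfold J.
    set (x1 := (X (a + l)%R c (c + l)%R - (Q (Phi (a + l)%R (c + l)%R) - Q (Phi (a + l)%R c)))%C) in *.
    set (x2 := (X a c (c + l)%R - (Q (Phi a (c + l)%R) - Q (Phi a c)))%C) in *.
    set (y1 := (Y (c + l)%R a (a + l)%R - (Q (Phi (a + l)%R (c + l)%R) - Q (Phi a (c + l)%R)))%C) in *.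
    set (y2 := (Y c a (a + l)%R - (Q (Phi (a + l)%R c) - Q (Phi a c)))%C) in *.
    replace (X (a + l)%R c (c + l)%R - X a c (c + l)%R - Y (c + l)%R a (a + l)%R + Y c a (a + l)%R)%C
      with (x1 - x2 - y1 + y2)%C by (unfold x1, x2, y1, y2; ring).
    assert (T1 := Cmod_triangle (x1 - x2 - y1) y2).
    assert (T2 := Cmod_triangle (x1 - x2) (- y1)). assert (T3 := Cmod_triangle x1 (- x2)).
    rewrite Cmod_opp in T2, T3. fold (x1 - x2)%C in T3. fold (x1 - x2 - y1)%C in T2.
    assert (E : 4 * (2 * (eps / K * (2 * L * l) * L) * l) <= eps * (l * l)).
    { replace (4 * (2 * (eps / K * (2 * L * l) * L) * l)) with (eps * (l * l) * ((16 * L * L) / K)) by (field; lra).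
      rewrite <- (Rmult_1_r (eps * (l * l))) at 2. apply Rmult_le_compat_l.
      - apply Rmult_le_pos; [lra|nra].
      - apply Rmult_le_reg_r with K; [lra|]. unfold Rdiv. rewrite Rmult_assoc, Rinv_l by lra. unfold K; lra. }
    lra.
Qed.

(** * Cauchy's formula on the circle *)

Definition E (t : R) : C := Cexp (0, 2 * PI * t).

Lemma E_eq t : E t = (cos (2 * PI * t), sin (2 * PI * t)).
Proof. unfold E, Cexp; simpl. now rewrite exp_0, !Rmult_1_l. Qed.

Lemma Cmod_E t : Cmod (E t) = 1.
Proof.
  rewrite E_eq. unfold Cmod; cbn [fst snd].
  rewrite <- sqrt_1. f_equal. assert (H := sin2_cos2 (2 * PI * t)). unfold Rsqr in H. lra.
Qed.

Lemma E_neq_0 t : E t <> 0%C.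
Proof. apply Cmod_gt_0. rewrite Cmod_E. lra. Qed.

Lemma E_0 : E 0 = 1%C.
Proof. rewrite E_eq, Rmult_0_r, cos_0, sin_0. reflexivity. Qed.

Lemma E_1 : E 1 = 1%C.
Proof. rewrite E_eq, Rmult_1_r, cos_2PI, sin_2PI. reflexivity. Qed.

Lemma E_opp t : E (- t) = Cconj (E t).
Proof. rewrite !E_eq. replace (2 * PI * - t) with (- (2 * PI * t)) by ring. now rewrite cos_neg, sin_neg. Qed.

Lemma E_opp_mul t : (E t * E (- t) = 1)%C.
Proof.
  rewrite E_opp, <- Cmod2_conj, Cmod_E. apply injective_projections; simpl; ring.
Qed.

Lemma Cderiv_E t : Cderiv E t (2 * PI * Ci * E t)%C.
Proof.
  split.
  - apply (is_derive_ext (fun t => cos (2 * PI * t))); [intros; now rewrite E_eq|].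
    rewrite E_eq. simpl. auto_derive; [trivial|]. ring.
  - apply (is_derive_ext (fun t => sin (2 * PI * t))); [intros; now rewrite E_eq|].
    rewrite E_eq. simpl. auto_derive; [trivial|]. ring.
Qed.

Lemma ccont_E t : ccont E t.
Proof. eapply Cderiv_cont, Cderiv_E. Qed.

Lemma ccont_E_opp t : ccont (fun t => E (- t)) t.
Proof.
  apply (continuous_comp (V := R_UniformSpace) (fun t => - t) E); [|apply ccont_E].
  apply (continuous_opp (V := R_NormedModule)), continuous_id.
Qed.

Lemma Rlipschitz (f df : R -> R) M : (forall x, is_derive f x (df x)) -> (forall x, Rabs (df x) <= M) ->
  forall a b, Rabs (f a - f b) <= M * Rabs (a - b).
Proof.
  intros Hf HM a b. destruct (MVT_gen f b a df) as [c [_ Hc]].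
  - intros; apply Hf.
  - intros x _. apply continuity_pt_filterlim. apply (ex_derive_continuous (V := R_NormedModule)). eexists; apply Hf.
  - rewrite Hc, Rabs_mult. apply Rmult_le_compat_r; [apply Rabs_pos|apply HM].
Qed.

Lemma E_lipschitz a b : Cmod (E a - E b) <= 4 * PI * Rabs (a - b).
Proof.
  eapply Rle_trans; [apply Cmod_le_sum|]. rewrite !E_eq. simpl.
  assert (Hpi := PI_RGT_0).
  assert (H1 := Rlipschitz (fun t => cos (2 * PI * t)) (fun t => - (2 * PI * sin (2 * PI * t))) (2 * PI)).
  assert (H2 := Rlipschitz (fun t => sin (2 * PI * t)) (fun t => 2 * PI * cos (2 * PI * t)) (2 * PI)).
  assert (B : forall x u : R, Rabs u <= 1 -> Rabs (2 * PI * u) <= 2 * PI).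
  { intros _ u Hu. rewrite Rabs_mult, (Rabs_pos_eq (2 * PI)) by lra. nra. }
  assert (D1 := H1 ltac:(intros; auto_derive; [trivial|ring])
    ltac:(intros x; cbv beta; rewrite Rabs_Ropp; apply (B 0); apply Rabs_le_between; apply SIN_bound) a b).
  assert (D2 := H2 ltac:(intros; auto_derive; [trivial|ring])
    ltac:(intros x; apply (B 0); apply Rabs_le_between; apply COS_bound) a b).
  simpl in *. unfold Rminus in *. lra.
Qed.

Lemma kernel_denom_neq_0 w s : Cmod w < 1 -> Cmod s <= 1 -> (1 - w * s)%C <> 0%C.
Proof.
  intros Hw Hs H.
  assert (H1 : Cmod (w * s) = 1).
  { replace (w * s)%C with (1 - (1 - w * s))%C by ring. rewrite H.
    replace (1 - 0)%C with (RtoC 1) by ring. apply Cmod_1. }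
  rewrite Cmod_mult in H1. assert (A := Cmod_ge_0 w). assert (B := Cmod_ge_0 s). nra.
Qed.

Lemma Cmod_eq0_lt (z : C) : (forall eps, 0 < eps -> Cmod z <= eps) -> z = 0%C.
Proof.
  intros H. apply Cmod_eq_0. destruct (Rle_lt_or_eq_dec 0 (Cmod z) (Cmod_ge_0 _)) as [Hp|]; [|auto].
  specialize (H (Cmod z / 2)). lra.
Qed.

(** The circles with centre [(1 - s) w] and radius [(1 - s) eps + s] deform the [eps]-circle about
    [w] into the unit circle without meeting [w]; the sides [t = 0] and [t = 1] cancel by
    periodicity. *)
Lemma Cint_eq_at_small_circle (g : C -> C) (w : C) (eps : R) :
  (forall z, Cmod z <= 1 -> Cdiff g z) -> Cmod w < 1 -> 0 < eps < 1 - Cmod w ->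
  Cint (fun t => g (E t) / (E t - w) * (2 * PI * Ci * E t))%C 0 1
  = Cint (fun t => 2 * PI * Ci * g (w + eps * E t))%C 0 1.
Proof.
  intros Hg Hw Heps. assert (Hpi := PI_RGT_0). assert (Hw0 := Cmod_ge_0 w).
  set (Phi := fun s t : R => (RtoC (1 - s) * w + RtoC ((1 - s) * eps + s) * E t)%C).
  set (Ps := fun s t : R => (- w + RtoC (1 - eps) * E t)%C).
  set (Pt := fun s t : R => (RtoC ((1 - s) * eps + s) * (2 * PI * Ci * E t))%C).
  set (h := fun z => (g z / (z - w))%C).
  assert (Hrho : forall s, 0 <= s <= 1 -> 0 <= (1 - s) * eps + s <= 1) by (intros; nra).
  assert (Hph1 : forall s t, 0 <= s <= 1 -> Cmod (Phi s t) <= 1).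
  { intros s t Hs. unfold Phi. eapply Rle_trans; [apply Cmod_triangle|].
    rewrite !Cmod_mult, !Cmod_R, Cmod_E. rewrite !Rabs_pos_eq by (try apply Hrho; lra). nra. }
  assert (Hph2 : forall s t, 0 <= s <= 1 -> (Phi s t - w)%C <> 0%C).
  { intros s t Hs. apply Cmod_gt_0.
    replace (Phi s t - w)%C with (RtoC ((1 - s) * eps + s) * E t - s * w)%C.
    - eapply Rlt_le_trans; [|apply Cmod_triangle_inv]. rewrite !Cmod_mult, Cmod_E, !Cmod_R.
      rewrite !Rabs_pos_eq by (try apply Hrho; lra). nra.
    - unfold Phi. rewrite RtoC_minus. ring. }
  assert (HPs : forall s t, Cmod (Ps s t) <= 2).
  { intros s t. unfold Ps. eapply Rle_trans; [apply Cmod_triangle|].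
    rewrite Cmod_mult, Cmod_opp, Cmod_E, Cmod_R, Rabs_pos_eq by lra. lra. }
  assert (G := goursat_square h Phi Ps Pt (4 * PI + 2)).
  assert (HE : forall s, Phi s 1 = Phi s 0) by (intros; unfold Phi; now rewrite E_0, E_1).
  assert (HE2 : forall s, Ps s 1 = Ps s 0) by (intros; unfold Ps; now rewrite E_0, E_1).
  rewrite (Cint_ext (fun s => h (Phi s 1) * Ps s 1)%C (fun s => h (Phi s 0) * Ps s 0)%C) in G
    by (try lra; intros; now rewrite HE, HE2).
  rewrite (Cint_ext _ (fun t => h (Phi 1 t) * Pt 1 t)%C); [|lra|].
  2:{ intros t _. unfold h, Pt, Phi. replace (1 - 1) with 0 by ring.
      replace (0 * eps + 1) with 1 by ring. rewrite !Cmult_0_l, Cplus_0_l, !Cmult_1_l. reflexivity. }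
  rewrite (Cint_ext (fun t => 2 * PI * Ci * g (w + eps * E t))%C (fun t => h (Phi 0 t) * Pt 0 t)%C); [|lra|].
  2:{ intros t _. unfold h, Pt, Phi. replace (1 - 0) with 1 by ring.
      replace (1 * eps + 0) with eps by ring. rewrite !Cmult_1_l.
      assert (A1 := E_neq_0 t). assert (A2 : RtoC eps <> 0%C) by (intros X; apply RtoC_inj in X; lra).
      field. replace (w + eps * E t - w)%C with (eps * E t)%C by ring.
      now apply Cmult_neq_0. }
  set (a := Cint (fun t => h (Phi 1 t) * Pt 1 t)%C 0 1) in *.
  set (b := Cint (fun t => h (Phi 0 t) * Pt 0 t)%C 0 1) in *.
  set (c := Cint (fun s => h (Phi s 0) * Ps s 0)%C 0 1) in *.
  replace a with (b + (a - b - c + c))%C by ring. rewrite G; [ring| |].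
  - intros s t Hs Ht.
    split; [|split; [|split; [|split; [|split; [|split]]]]].
    + split.
      * apply (is_derive_ext (fun u => (1 - u) * fst w + ((1 - u) * eps + u) * fst (E t))).
        { intros u. unfold Phi; simpl. Req; ring. }
        unfold Ps; simpl. auto_derive; [trivial|ring].
      * apply (is_derive_ext (fun u => (1 - u) * snd w + ((1 - u) * eps + u) * snd (E t))).
        { intros u. unfold Phi; simpl. Req; ring. }
        unfold Ps; simpl. auto_derive; [trivial|ring].
    + replace (Pt s t) with (0 + (0 * E t + RtoC ((1 - s) * eps + s) * (2 * PI * Ci * E t)))%C by (unfold Pt; ring).
      apply (Cderiv_plus (fun _ => RtoC (1 - s) * w)%C (fun u => RtoC ((1 - s) * eps + s) * E u)%C);
      [apply Cderiv_const|apply (Cderiv_mult (fun _ => RtoC ((1 - s) * eps + s))); [apply Cderiv_const|apply Cderiv_E]].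
    + apply ccont_const.
    + unfold Pt. apply ccont_mult; [apply ccont_const|]. apply ccont_mult; [apply ccont_const|apply ccont_E].
    + specialize (HPs s t). lra.
    + unfold Pt. rewrite !Cmod_mult, Cmod_E, !Cmod_R, Cmod_Ci.
      rewrite (Rabs_pos_eq ((1 - s) * eps + s)) by now apply Hrho.
      rewrite (Rabs_pos_eq PI), (Rabs_pos_eq 2) by lra. specialize (Hrho s Hs). nra.
    + unfold h. apply Cdiff_div.
      * apply Hg, Hph1, Hs.
      * apply Cdiff_minus; [apply Cdiff_id|apply Cdiff_const].
      * now apply Hph2.
  - intros s t s' t' Hs Ht Hs' Ht'.
    replace (Phi s t - Phi s' t')%C with (RtoC (s - s') * Ps 0 t + RtoC ((1 - s') * eps + s') * (E t - E t'))%C.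
    + eapply Rle_trans; [apply Cmod_triangle|]. rewrite !Cmod_mult, !Cmod_R.
      rewrite (Rabs_pos_eq ((1 - s') * eps + s')) by now apply Hrho.
      specialize (HPs 0 t). assert (L := E_lipschitz t t'). specialize (Hrho s' Hs').
      assert (A1 := Rabs_pos (s - s')). assert (A2 := Rabs_pos (t - t')).
      assert (A3 := Cmod_ge_0 (E t - E t')).
      assert (Rabs (s - s') * Cmod (Ps 0 t) <= Rabs (s - s') * 2) by (apply Rmult_le_compat_l; lra).
      assert (((1 - s') * eps + s') * Cmod (E t - E t') <= 1 * (4 * PI * Rabs (t - t'))) by (apply Rmult_le_compat; lra).
      nra.
    + unfold Phi, Ps. apply injective_projections; simpl; ring.
Qed.

(** On the circle [E (- t) = 1 / E t], so [dz / (z - w)] equals [2 pi i dt / (1 - w E (- t))]. In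
    this form the Cauchy kernel is a reproducing kernel, and combinations of evaluations become
    integrals against [ker]. The proof shrinks the small circle to its centre. *)
Theorem cauchy_disk (g : C -> C) (w : C) :
  (forall z, Cmod z <= 1 -> Cdiff g z) -> Cmod w < 1 ->
  Cint (fun t => g (E t) / (1 - w * E (- t)))%C 0 1 = g w.
Proof.
  intros Hg Hw. assert (Hpi := PI_RGT_0). assert (Hw0 := Cmod_ge_0 w).
  assert (H2pi : (2 * PI * Ci)%C <> 0%C).
  { apply Cmod_gt_0. rewrite !Cmod_mult, !Cmod_R, Cmod_Ci, !Rabs_pos_eq by lra. lra. }
  assert (Hc1 : Ccont_on (fun t => g (E t) / (1 - w * E (- t)))%C 0 1).
  { intros t _. apply ccont_div.
    - apply (continuous_comp (V := C_UniformSpace) E g); [apply ccont_E|apply Cdiff_cont, Hg]. rewrite Cmod_E; lra.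
    - apply ccont_minus; [apply ccont_const|apply ccont_mult; [apply ccont_const|apply ccont_E_opp]].
    - apply kernel_denom_neq_0; [exact Hw|rewrite Cmod_E; lra]. }
  match goal with |- ?a = ?b => enough (H0 : (a - b = 0)%C) by (replace a with (b + (a - b))%C by ring; rewrite H0; ring) end.
  apply Cmod_eq0_lt. intros eta Heta.
  assert (Hcw := Cdiff_cont g w (Hg w (Rlt_le _ _ Hw))).
  rewrite ccont_eps in Hcw. specialize (Hcw (eta / 2) ltac:(lra)).
  apply locally_Cmod in Hcw. destruct Hcw as [del [Hd Hcw]].
  set (eps := Rmin del (1 - Cmod w) / 2).
  assert (Hm : 0 < Rmin del (1 - Cmod w)) by (apply Rmin_pos; lra).
  assert (Hm1 := Rmin_l del (1 - Cmod w)). assert (Hm2 := Rmin_r del (1 - Cmod w)).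
  assert (Heps : 0 < eps < 1 - Cmod w) by (unfold eps; lra).
  assert (G := Cint_eq_at_small_circle g w eps Hg Hw Heps).
  assert (Hin : forall t, Cmod (w + eps * E t) <= 1).
  { intros t. eapply Rle_trans; [apply Cmod_triangle|]. rewrite Cmod_mult, Cmod_E, Cmod_R, Rabs_pos_eq by lra. lra. }
  assert (Hc2 : Ccont_on (fun t => g (w + eps * E t))%C 0 1).
  { intros t _. apply (continuous_comp (V := C_UniformSpace) (fun t => w + eps * E t)%C g).
    - apply ccont_plus; [apply ccont_const|apply ccont_mult; [apply ccont_const|apply ccont_E]].
    - apply Cdiff_cont, Hg, Hin. }
  rewrite (Cint_ext _ (fun t => 2 * PI * Ci * (g (E t) / (1 - w * E (- t))))%C) in G; [|lra|].
  2:{ intros t _. assert (A := E_opp_mul t). assert (A1 := E_neq_0 t).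
      assert (A2 := kernel_denom_neq_0 w (E (- t)) Hw ltac:(rewrite Cmod_E; lra)).
      replace (E t - w)%C with (E t * (1 - w * E (- t)))%C.
      - field. auto.
      - replace (E t * (1 - w * E (- t)))%C with (E t - w * (E t * E (- t)))%C by ring. rewrite A. ring. }
  rewrite !Cint_scal in G by (auto; lra).
  assert (G' : Cint (fun t => g (E t) / (1 - w * E (- t)))%C 0 1 = Cint (fun t => g (w + eps * E t)%C) 0 1).
  { set (k := (2 * PI * Ci)%C) in *. apply (f_equal (fun z => / k * z)%C) in G.
    cbv beta in G. rewrite !(Cmult_assoc (/ k)%C), !Cinv_l, !Cmult_1_l in G by exact H2pi. exact G. }
  rewrite G'.
  assert (Hcst : Cint (fun _ => g w) 0 1 = g w).
  { rewrite (Cint_FTC (fun t => g w * RtoC t)%C); try lra.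
    - apply injective_projections; simpl; ring.
    - intros t _. split.
      + apply (is_derive_ext (fun t => fst (g w) * t)); [intros; simpl; ring|]. auto_derive; [trivial|ring].
      + apply (is_derive_ext (fun t => snd (g w) * t)); [intros; simpl; ring|]. auto_derive; [trivial|ring].
    - intros t _. apply ccont_const. }
  rewrite <- Hcst at 1. rewrite <- Cint_minus; [|lra|exact Hc2|intros t _; apply ccont_const].
  replace eta with (2 * (eta / 2) * (1 - 0)) by field.
  apply Cint_bound; [lra| |].
  - intros t Ht. apply ccont_minus; [now apply Hc2|apply ccont_const].
  - intros t _. left. apply Hcw. replace (w + eps * E t - w)%C with (eps * E t)%C by ring.
    rewrite Cmod_mult, Cmod_E, Cmod_R, Rabs_pos_eq by lra. unfold eps; lra.
Qed.

Lemma mean_value (g : C -> C) : (forall z, Cmod z <= 1 -> Cdiff g z) -> Cint (fun t => g (E t)) 0 1 = g 0%C.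
Proof.
  intros Hg. rewrite <- (cauchy_disk g 0%C Hg).
  - apply Cint_ext; [lra|]. intros t _. rewrite Cmult_0_l. apply injective_projections; simpl; field.
  - rewrite Cmod_0. lra.
Qed.

(** With [i = |I|], [i^2] is the integral of [Re (conj I f k)], and pointwise
    [2 i a b <= kappa a^2 + i^2 b^2 / kappa]; after integration the last term gives back at most
    [i^2 / 2]. *)
Lemma Cint_cauchy_schwarz (f k : R -> C) (kappa : R) :
  Ccont_on f 0 1 -> Ccont_on k 0 1 -> 0 < kappa -> RInt (fun t => Cmod (k t) ^ 2) 0 1 <= kappa ->
  Cmod (Cint (fun t => f t * k t)%C 0 1) ^ 2 <= kappa * RInt (fun t => Cmod (f t) ^ 2) 0 1.
Proof.
  intros Hf Hk Hka HI.
  assert (Hex : forall f, Ccont_on f 0 1 -> ex_RInt (fun t => Cmod (f t) ^ 2) 0 1).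
  { intros u Hu. apply (ex_RInt_continuous (V := R_CompleteNormedModule)). intros t.
    rewrite Rmin_left, Rmax_right by lra. intros Ht.
    apply (continuous_ext (fun t => mult (Cmod (u t)) (Cmod (u t)))).
    - intros x. unfold mult; simpl. ring.
    - apply (continuous_mult (K := R_AbsRing)); now apply continuous_Cmod, Hu. }
  assert (Hfk : Ccont_on (fun t => f t * k t)%C 0 1) by (intros t Ht; apply ccont_mult; auto).
  set (I := Cint (fun t => f t * k t)%C 0 1).
  assert (HIc : Cmod I ^ 2 = RInt (fun t => fst (Cconj I * (f t * k t))%C) 0 1).
  { change (Cmod I ^ 2 = fst (Cint (fun t => Cconj I * (f t * k t))%C 0 1)).
    rewrite Cint_scal by (auto; lra). fold I. rewrite Cmod2_alt. unfold Re, Im; simpl. ring. }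
  assert (Hle : Cmod I ^ 2 <= / 2 * kappa * RInt (fun t => Cmod (f t) ^ 2) 0 1
                 + / 2 * (Cmod I ^ 2 / kappa) * RInt (fun t => Cmod (k t) ^ 2) 0 1).
  { rewrite HIc at 1. rewrite <- RInt_lin2 by auto.
    apply RInt_le; [lra| | |].
    - apply (Ccont_on_fst (fun t => Cconj I * (f t * k t))%C); [lra|].
      intros t Ht. apply ccont_mult; [apply ccont_const|now apply Hfk].
    - apply (ex_RInt_plus (V := R_NormedModule)); apply (ex_RInt_scal (V := R_NormedModule)); auto.
    - intros t Ht. eapply Rle_trans; [apply Rle_abs|]. eapply Rle_trans; [apply Cmod_fst|].
      rewrite !Cmod_mult, Cmod_conj.
      set (i := Cmod I). set (a := Cmod (f t)). set (b := Cmod (k t)).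
      apply Rmult_le_reg_r with (2 * kappa); [lra|].
      replace ((/ 2 * kappa * a ^ 2 + / 2 * (i ^ 2 / kappa) * b ^ 2) * (2 * kappa))
        with ((kappa * a) ^ 2 + (i * b) ^ 2) by (field; lra).
      assert (H := pow2_ge_0 (kappa * a - i * b)). nra. }
  assert (H2 : / 2 * (Cmod I ^ 2 / kappa) * RInt (fun t => Cmod (k t) ^ 2) 0 1 <= / 2 * (Cmod I ^ 2 / kappa) * kappa).
  { apply Rmult_le_compat_l; [|exact HI]. apply Rmult_le_pos; [lra|]. apply Rdiv_le_0_compat; [apply pow2_ge_0|lra]. }
  replace (/ 2 * (Cmod I ^ 2 / kappa) * kappa) with (/ 2 * Cmod I ^ 2) in H2 by (field; lra). lra.
Qed.

(** Cauchy's formula for [1 / (1 - conj w z)], which on the circle is the conjugate of the kernel,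
    so that the integrand becomes a squared modulus. *)
Lemma poisson_int (w : C) : Cmod w < 1 ->
  RInt (fun t => Cmod (/ (1 - w * E (- t)))%C ^ 2) 0 1 = / (1 - Cmod w ^ 2).
Proof.
  intros Hw. assert (Hw0 := Cmod_ge_0 w).
  assert (Hd : forall z, Cmod z <= 1 -> (1 - Cconj w * z)%C <> 0%C).
  { intros z Hz. apply kernel_denom_neq_0; [now rewrite Cmod_conj|exact Hz]. }
  assert (H := cauchy_disk (fun z => / (1 - Cconj w * z))%C w).
  cbv beta in H. apply (f_equal fst) in H.
  - replace (fst (/ (1 - Cconj w * w))%C) with (/ (1 - Cmod w ^ 2)) in H.
    + rewrite <- H. unfold Cint; cbn [fst]. apply RInt_ext. intros t _.
      assert (A1 := Hd (E t) ltac:(rewrite Cmod_E; lra)).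
      assert (A2 := kernel_denom_neq_0 w (E (- t)) Hw ltac:(rewrite Cmod_E; lra)).
      replace (1 - Cconj w * E t)%C with (Cconj (1 - w * E (- t)))%C.
      * assert (A3 : Cmod (1 - w * E (- t)) <> 0) by (intros X; now apply Cmod_eq_0 in X).
        rewrite Cmod_inv by exact A2. unfold Cdiv.
        set (u := (1 - w * E (- t))%C) in *.
        assert (A4 : Cconj u <> 0%C).
        { apply Cmod_gt_0. rewrite Cmod_conj. now apply Cmod_gt_0. }
        replace (/ Cconj u * / u)%C with (/ (u * Cconj u))%C by (field; auto).
        rewrite <- Cmod2_conj, <- RtoC_inv by (apply pow_nonzero; exact A3).
        simpl. field. exact A3.
      * rewrite E_opp. apply injective_projections; simpl; ring.
    + rewrite Cmult_comm, <- Cmod2_conj, <- RtoC_minus, <- RtoC_inv; [reflexivity|]. nra.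
  - intros z Hz. apply Cdiff_inv; [|now apply Hd].
    apply Cdiff_minus; [apply Cdiff_const|]. apply Cdiff_mult; [apply Cdiff_const|apply Cdiff_id].
  - exact Hw.
Qed.

(** * Finite combinations of point evaluations on the polydisk *)

(* The functional [g |-> sum_j c_j g(p_j)] is encoded by the list of the pairs [(c_j, p_j)]. *)
Definition fapp (L : list (C * C)) (g : C -> C) : C :=
  fold_right (fun cp acc => fst cp * g (snd cp) + acc)%C 0%C L.

(** The function that represents [fapp L] under Cauchy's formula, [s] standing for the conjugate
    circle point [E (- t)]. Its mean square over the circle is the squared norm of the functional on
    H^2 of the disk. *)
Definition ker (L : list (C * C)) (s : C) : C := fapp L (fun p => / (1 - p * s))%C.

Definition ker_bounded (L : list (C * C)) (kappa : R) : Prop :=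
  (forall cp, In cp L -> Cmod (snd cp) < 1) /\ 0 < kappa /\
  RInt (fun t => Cmod (ker L (E (- t))) ^ 2) 0 1 <= kappa.

Lemma fapp_ext L g h : (forall cp, In cp L -> g (snd cp) = h (snd cp)) -> fapp L g = fapp L h.
Proof.
  intros H. induction L as [|cp L IH]; [reflexivity|]. simpl.
  rewrite IH by (intros; apply H; now right). rewrite H by now left. reflexivity.
Qed.

Lemma fapp_cont {U : UniformSpace} L (g : U -> C -> C) (x : U) :
  (forall cp, In cp L -> ccont (fun y => g y (snd cp)) x) -> ccont (fun y => fapp L (g y)) x.
Proof.
  induction L as [|cp L IH]; intros H; [apply ccont_const|]. simpl.
  apply ccont_plus.
  - apply ccont_mult; [apply ccont_const|]. apply H. now left.
  - apply IH. intros; apply H; now right.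
Qed.

Lemma fapp_diff L (g : C -> C -> C) (z : C) :
  (forall cp, In cp L -> Cdiff (fun y => g y (snd cp)) z) -> Cdiff (fun y => fapp L (g y)) z.
Proof.
  induction L as [|cp L IH]; intros H; [apply (Cdiff_const 0%C)|]. simpl.
  apply Cdiff_plus.
  - apply Cdiff_mult; [apply Cdiff_const|]. apply H. now left.
  - apply IH. intros; apply H; now right.
Qed.

Lemma ker_cont L t : (forall cp, In cp L -> Cmod (snd cp) < 1) -> ccont (fun t => ker L (E (- t))) t.
Proof.
  intros HL. apply (fapp_cont L (fun t p => / (1 - p * E (- t)))%C). intros cp Hcp.
  apply ccont_inv.
  - apply ccont_minus; [apply ccont_const|]. apply ccont_mult; [apply ccont_const|apply ccont_E_opp].
  - apply kernel_denom_neq_0; [now apply HL|rewrite Cmod_E; lra].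
Qed.

Lemma circle_cont (g : C -> C) t : (forall z, Cmod z <= 1 -> Cdiff g z) -> ccont (fun t => g (E t)) t.
Proof.
  intros Hg. apply (continuous_comp (V := C_UniformSpace) E g); [apply ccont_E|].
  apply Cdiff_cont, Hg. rewrite Cmod_E; lra.
Qed.

Lemma fapp_repr L (g : C -> C) : (forall z, Cmod z <= 1 -> Cdiff g z) ->
  (forall cp, In cp L -> Cmod (snd cp) < 1) ->
  fapp L g = Cint (fun t => g (E t) * ker L (E (- t)))%C 0 1.
Proof.
  intros Hg. induction L as [|cp L IH]; intros HL.
  - simpl. rewrite (Cint_ext _ (fun t => 0 * g (E t))%C) by (try lra; intros; unfold ker; simpl; ring).
    rewrite Cint_scal; [ring|lra|]. intros t _. now apply circle_cont.
  - simpl. rewrite IH by (intros; apply HL; now right).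
    assert (Hcp : Cmod (snd cp) < 1) by (apply HL; now left).
    rewrite <- (cauchy_disk g (snd cp) Hg Hcp).
    assert (c1 : Ccont_on (fun t => g (E t) / (1 - snd cp * E (- t)))%C 0 1).
    { intros t _. apply ccont_div; [now apply circle_cont| |].
      - apply ccont_minus; [apply ccont_const|]. apply ccont_mult; [apply ccont_const|apply ccont_E_opp].
      - apply kernel_denom_neq_0; [exact Hcp|rewrite Cmod_E; lra]. }
    rewrite <- Cint_scal; [|lra|exact c1]. rewrite <- Cint_plus; [|lra| |].
    + apply Cint_ext; [lra|]. intros t _. unfold ker; simpl. field.
      apply kernel_denom_neq_0; [exact Hcp|rewrite Cmod_E; lra].
    + intros t Ht. apply ccont_mult; [apply ccont_const|now apply c1].
    + intros t _. apply ccont_mult; [now apply circle_cont|]. apply ker_cont. intros; apply HL; now right.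
Qed.

Lemma fapp_bound L kappa (g : C -> C) : (forall z, Cmod z <= 1 -> Cdiff g z) -> ker_bounded L kappa ->
  Cmod (fapp L g) ^ 2 <= kappa * RInt (fun t => Cmod (g (E t)) ^ 2) 0 1.
Proof.
  intros Hg (HL & Hk & HI). rewrite (fapp_repr L g Hg HL).
  apply Cint_cauchy_schwarz; auto; intros t _; [now apply circle_cont|now apply ker_cont].
Qed.

Lemma continuous_sqr {U : UniformSpace} (f : U -> R) x : continuous f x -> continuous (fun y => f y ^ 2) x.
Proof.
  intros H. apply (continuous_ext (fun y => mult (f y) (f y))).
  - intros y. unfold mult; simpl. ring.
  - now apply (continuous_mult (K := R_AbsRing)).
Qed.

Lemma ex_RInt_cont01 (f : R -> R) : (forall t, 0 <= t <= 1 -> continuous f t) -> ex_RInt f 0 1.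
Proof.
  intros H. apply (ex_RInt_continuous (V := R_CompleteNormedModule)). intros t.
  rewrite Rmin_left, Rmax_right by lra. apply H.
Qed.

(** The tensor product of [Ls 0], ..., [Ls (k - 1)] acting on the first [k] coordinates, the others
    being taken from [z]. The outermost variable is [k - 1], as in [cube_int], so that both unfold
    together in an induction on [k]. *)
Fixpoint tapp (k : nat) (Ls : nat -> list (C * C)) (f : (nat -> C) -> C) (z : nat -> C) : C :=
  match k with
  | O => f z
  | S k => fapp (Ls k) (fun v => tapp k Ls f (upd z k v))
  end.

Fixpoint rprod (a : nat -> R) (k : nat) : R :=
  match k with O => 1 | S k => a k * rprod a k end.

Definition updR (t : nat -> R) (k : nat) (s : R) : nat -> R := fun j => if Nat.eqb j k then s else t j.

Lemma upd_same z i v : upd z i v i = v.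
Proof. unfold upd. now rewrite Nat.eqb_refl. Qed.

Lemma upd_other z i j v : j <> i -> upd z i v j = z j.
Proof. intros H. unfold upd. apply Nat.eqb_neq in H. now rewrite H. Qed.

Lemma upd_id z i : upd z i (z i) = z.
Proof.
  apply functional_extensionality. intros j. unfold upd. destruct (Nat.eqb_spec j i); now subst.
Qed.

Lemma upd_upd z i v w : upd (upd z i v) i w = upd z i w.
Proof. apply functional_extensionality. intros j. unfold upd. now destruct (Nat.eqb_spec j i). Qed.

Lemma upd_comm z i j v w : i <> j -> upd (upd z i v) j w = upd (upd z j w) i v.
Proof.
  intros H. apply functional_extensionality. intros k. unfold upd.
  destruct (Nat.eqb_spec k j), (Nat.eqb_spec k i); congruence.
Qed.

Lemma tapp_indep k Ls f : forall z z', (forall i, (k <= i)%nat -> z i = z' i) -> tapp k Ls f z = tapp k Ls f z'.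
Proof.
  induction k; intros z z' H; simpl.
  - f_equal. apply functional_extensionality. intros i. apply H. lia.
  - apply fapp_ext. intros cp _. apply IHk. intros i Hi. unfold upd.
    destruct (Nat.eqb_spec i k); [reflexivity|]. apply H. lia.
Qed.

(** * Joint continuity and iterated integrals over the torus *)

Definition jcont (F : (nat -> R) -> R) : Prop := forall t eps, 0 < eps -> exists del, 0 < del /\
  forall t', (forall i, Rabs (t' i - t i) < del) -> Rabs (F t' - F t) < eps.

Lemma jcont_slice F k t s : jcont F -> continuous (fun s => F (updR t k s)) s.
Proof.
  intros HF. apply filterlim_locally. intros eps.
  destruct (HF (updR t k s) eps (cond_pos eps)) as [del [Hd H]].
  exists (mkposreal del Hd). intros y Hy. apply H. intros i. unfold updR.
  destruct (Nat.eqb i k); [exact Hy|]. rewrite Rminus_diag. now rewrite Rabs_R0.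
Qed.

(** The modulus of continuity is uniform in the integration variable because [[0, 1]] is compact. *)
Lemma jcont_RInt F k : jcont F -> jcont (fun t => RInt (fun s => F (updR t k s)) 0 1).
Proof.
  intros HF t eps He.
  assert (Hch : forall s, exists del : posreal, forall t', (forall i, Rabs (t' i - updR t k s i) < del) ->
    Rabs (F t' - F (updR t k s)) < eps / 4).
  { intros s. destruct (HF (updR t k s) (eps / 4)) as [del [Hd H]]; [lra|].
    exists (mkposreal del Hd). exact H. }
  set (delta := fun s => proj1_sig (constructive_indefinite_description _ (Hch s))).
  assert (Hdel : forall s t', (forall i, Rabs (t' i - updR t k s i) < delta s) ->
    Rabs (F t' - F (updR t k s)) < eps / 4).
  { intros s. unfold delta. destruct constructive_indefinite_description as [d Hd]; simpl. exact Hd. }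
  destruct (compactness_value_1d 0 1 delta) as [d Hd].
  exists d. split; [apply cond_pos|]. intros t' Ht'.
  assert (c : forall t, ex_RInt (fun s => F (updR t k s)) 0 1).
  { intros u. apply ex_RInt_cont01. intros s _. now apply jcont_slice. }
  assert (E := RInt_minus (V := R_CompleteNormedModule) _ _ 0 1 (c t') (c t)).
  change (RInt (fun s => F (updR t' k s) - F (updR t k s)) 0 1 =
          RInt (fun s => F (updR t' k s)) 0 1 - RInt (fun s => F (updR t k s)) 0 1) in E.
  rewrite <- E.
  apply Rle_lt_trans with (eps / 2 * (1 - 0)); [|lra].
  apply RInt_abs_bound; [lra| |].
  - apply (ex_RInt_minus (V := R_CompleteNormedModule)); apply c.
  (* [compactness_value_1d] provides the nearby centre [s] only under a double negation, hence the
     detour through a contradiction. *)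
  - intros x Hx. destruct (Rle_dec (Rabs (F (updR t' k x) - F (updR t k x))) (eps / 2)) as [|n]; [assumption|].
    exfalso. apply (Hd x Hx). intros [s [Hs [H1 H2]]]. apply n.
    assert (A1 : Rabs (F (updR t' k x) - F (updR t k s)) < eps / 4).
    { apply Hdel. intros i. unfold updR. destruct (Nat.eqb i k); [exact H1|].
      eapply Rlt_le_trans; [apply Ht'|exact H2]. }
    assert (A2 : Rabs (F (updR t k x) - F (updR t k s)) < eps / 4).
    { apply Hdel. intros i. unfold updR. destruct (Nat.eqb i k); [exact H1|].
      rewrite Rminus_diag, Rabs_R0. apply cond_pos. }
    apply Rabs_def2 in A1. apply Rabs_def2 in A2. apply Rabs_le_between. lra.
Qed.

Lemma jcont_cube k F : jcont F -> jcont (cube_int k F).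
Proof. intros HF. induction k; simpl; [exact HF|]. now apply (jcont_RInt (cube_int k F) k). Qed.

Lemma cube_int_le k F G t : jcont F -> jcont G -> (forall t, F t <= G t) -> cube_int k F t <= cube_int k G t.
Proof.
  intros HF HG H. revert t. induction k; intros t; simpl; [apply H|].
  apply RInt_le; [lra| | |].
  - apply ex_RInt_cont01. intros s _. apply (jcont_slice (cube_int k F) k). now apply jcont_cube.
  - apply ex_RInt_cont01. intros s _. apply (jcont_slice (cube_int k G) k). now apply jcont_cube.
  - intros s _. apply IHk.
Qed.

Definition tor (d : nat) (t : nat -> R) : nat -> C := fun i => if Nat.ltb i d then E (t i) else 0%C.

Definition closed_polydisk (d : nat) (z : nat -> C) : Prop :=
  (forall i, (i < d)%nat -> Cmod (z i) <= 1) /\ (forall i, (d <= i)%nat -> z i = 0%C).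

Lemma tor_closed d t : closed_polydisk d (tor d t).
Proof.
  split; intros i Hi; unfold tor; destruct (Nat.ltb_spec i d); try lia; try reflexivity.
  rewrite Cmod_E; lra.
Qed.

Lemma closed_polydisk_upd d z i v : closed_polydisk d z -> (i < d)%nat -> Cmod v <= 1 -> closed_polydisk d (upd z i v).
Proof.
  intros [H1 H2] Hi Hv. split; intros j Hj; unfold upd; destruct (Nat.eqb_spec j i); auto. lia.
Qed.

Lemma tor_upd d t k s : (k < d)%nat -> upd (tor d t) k (E s) = tor d (updR t k s).
Proof.
  intros Hk. apply functional_extensionality. intros j. unfold upd, tor, updR.
  destruct (Nat.eqb_spec j k); [|reflexivity]. subst. apply Nat.ltb_lt in Hk. now rewrite Hk.
Qed.

Definition sep_diff (d : nat) (G : (nat -> C) -> C) : Prop :=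
  forall z i, closed_polydisk d z -> (i < d)%nat -> Cdiff (fun v => G (upd z i v)) (z i).

Lemma tapp_diff d Ls G k : sep_diff d G -> (forall i, (i < d)%nat -> forall cp, In cp (Ls i) -> Cmod (snd cp) < 1) ->
  forall z i, closed_polydisk d z -> (k <= i < d)%nat -> Cdiff (fun v => tapp k Ls G (upd z i v)) (z i).
Proof.
  intros HG HL. induction k; intros z i Hz Hi; simpl; [apply HG; auto; lia|].
  apply fapp_diff. intros cp Hcp.
  assert (Hk : (k < d)%nat) by lia.
  assert (D := IHk (upd z k (snd cp)) i).
  rewrite upd_other in D by lia.
  replace (fun y => tapp k Ls G (upd (upd z i y) k (snd cp))) with (fun v => tapp k Ls G (upd (upd z k (snd cp)) i v)).
  - apply D; [|lia]. apply closed_polydisk_upd; auto. left. now apply (HL k).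
  - apply functional_extensionality. intros v. now rewrite upd_comm by lia.
Qed.

Lemma rprod_pos a k : (forall i, (i < k)%nat -> 0 < a i) -> 0 < rprod a k.
Proof.
  induction k; intros H; simpl; [lra|]. apply Rmult_lt_0_compat; [apply H; lia|apply IHk; intros; apply H; lia].
Qed.

(** The one-variable bound is applied in coordinate [k] to the tensor of the first [k] functionals,
    and the induction hypothesis is then integrated over that coordinate. *)
Lemma tapp_torus_bound d Ls kappa G : sep_diff d G -> jcont (fun t => Cmod (G (tor d t)) ^ 2) ->
  (forall i, (i < d)%nat -> ker_bounded (Ls i) (kappa i)) ->
  forall k t, (k <= d)%nat ->
  Cmod (tapp k Ls G (tor d t)) ^ 2 <= rprod kappa k * cube_int k (fun t => Cmod (G (tor d t)) ^ 2) t.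
Proof.
  intros HG HJ HL. induction k; intros t Hk; [simpl; lra|].
  assert (HLk := HL k ltac:(lia)).
  assert (Hd : forall z, Cmod z <= 1 -> Cdiff (fun v => tapp k Ls G (upd (tor d t) k v)) z).
  { intros z Hz.
    assert (D := tapp_diff d Ls G k HG (fun i Hi => proj1 (HL i Hi)) (upd (tor d t) k z) k).
    rewrite upd_same in D.
    replace (fun v => tapp k Ls G (upd (tor d t) k v)) with (fun v => tapp k Ls G (upd (upd (tor d t) k z) k v)).
    - apply D; [|lia]. apply closed_polydisk_upd; auto. apply tor_closed.
    - apply functional_extensionality. intros v. now rewrite upd_upd. }
  cbn [tapp rprod cube_int].
  eapply Rle_trans; [exact (fapp_bound _ _ _ Hd HLk)|].
  rewrite Rmult_assoc. apply Rmult_le_compat_l; [destruct HLk as (_ & ? & _); lra|].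
  assert (cc : forall s, continuous (fun s => cube_int k (fun t => Cmod (G (tor d t)) ^ 2) (updR t k s)) s).
  { intros s. apply jcont_slice. now apply jcont_cube. }
  assert (Es : rprod kappa k * RInt (fun s => cube_int k (fun t => Cmod (G (tor d t)) ^ 2) (updR t k s)) 0 1
    = RInt (fun s => rprod kappa k * cube_int k (fun t => Cmod (G (tor d t)) ^ 2) (updR t k s)) 0 1).
  { symmetry. apply (RInt_scal (V := R_CompleteNormedModule)). apply ex_RInt_cont01. intros; apply cc. }
  change (RInt (fun s => Cmod (tapp k Ls G (upd (tor d t) k (E s))) ^ 2) 0 1 <=
    rprod kappa k * RInt (fun s => cube_int k (fun t => Cmod (G (tor d t)) ^ 2) (updR t k s)) 0 1).
  rewrite Es. apply RInt_le; [lra| | |].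
  - apply ex_RInt_cont01. intros s _. apply continuous_sqr, continuous_Cmod.
    exact (circle_cont _ s Hd).
  - apply (ex_RInt_scal (V := R_CompleteNormedModule)). apply ex_RInt_cont01. intros; apply cc.
  - intros s _. rewrite tor_upd by lia. apply IHk. lia.
Qed.

(** * Dilations and tensor functionals on H^2 *)

Lemma polydisk_upd d z i v : in_polydisk d z -> (i < d)%nat -> Cmod v < 1 -> in_polydisk d (upd z i v).
Proof.
  intros [H1 H2] Hi Hv. split; intros j Hj; unfold upd; destruct (Nat.eqb_spec j i); auto. lia.
Qed.

Lemma holo_sep d f z i : holomorphic_polydisk d f -> in_polydisk d z -> (i < d)%nat -> Cdiff (fun v => f (upd z i v)) (z i).
Proof.
  intros Hf Hz Hi. destruct (Hf z Hz) as [_ H]. destruct (H i Hi) as [l Hl].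
  apply Cdiff_limit with l. intros eps He. destruct (Hl eps He) as [del [Hd Hh]]. exists del. split; [exact Hd|].
  rewrite upd_id. exact Hh.
Qed.

(** A function in H^2 is given on the open polydisk only. Its dilation [f (r z)] with [r < 1] is
    differentiable up to the closed polydisk, where Cauchy's formula applies, and has mean square
    [torus_mean2 d f r]. *)
Definition dil (r : R) (z : nat -> C) : nat -> C := fun i => (r * z i)%C.

Lemma dil_polydisk d r z : 0 < r < 1 -> closed_polydisk d z -> in_polydisk d (dil r z).
Proof.
  intros Hr [H1 H2]. split; intros i Hi; unfold dil.
  - rewrite Cmod_mult, Cmod_R, Rabs_pos_eq by lra. specialize (H1 i Hi). assert (A := Cmod_ge_0 (z i)). nra.
  - rewrite H2 by assumption. ring.
Qed.

Lemma dil_tor d r t : dil r (tor d t) = torus_pt d r t.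
Proof.
  apply functional_extensionality. intros i. unfold dil, tor, torus_pt.
  destruct (Nat.ltb i d); [reflexivity|]. ring.
Qed.

Lemma torus_pt_polydisk d r t : 0 < r < 1 -> in_polydisk d (torus_pt d r t).
Proof. intros Hr. rewrite <- dil_tor. apply dil_polydisk; [exact Hr|apply tor_closed]. Qed.

Lemma dil_sep_diff d r f : 0 < r < 1 -> holomorphic_polydisk d f -> sep_diff d (fun z => f (dil r z)).
Proof.
  intros Hr Hf z i Hz Hi.
  assert (D := holo_sep d f (dil r z) i Hf (dil_polydisk d r z Hr Hz) Hi).
  replace (fun v => f (dil r (upd z i v))) with (fun v => (fun u => f (upd (dil r z) i u)) (r * v)%C).
  - apply (Cdiff_comp (fun u => f (upd (dil r z) i u)) (fun v => r * v)%C); [|exact D].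
    apply Cdiff_mult; [apply Cdiff_const|apply Cdiff_id].
  - apply functional_extensionality. intros v. f_equal. apply functional_extensionality. intros j.
    unfold upd, dil. now destruct (Nat.eqb j i).
Qed.

Lemma jcont_sqr F : jcont F -> jcont (fun t => F t ^ 2).
Proof.
  intros HF t eps He. set (M := 2 * Rabs (F t) + 1). assert (HM : 0 < M) by (unfold M; assert (A := Rabs_pos (F t)); lra).
  assert (He2 : 0 < eps / M) by (apply Rdiv_lt_0_compat; lra).
  destruct (HF t (Rmin 1 (eps / M))) as [del [Hd H]]; [apply Rmin_pos; lra|].
  exists del. split; [exact Hd|]. intros t' Ht'. specialize (H t' Ht').
  assert (A1 := Rmin_l 1 (eps / M)). assert (A2 := Rmin_r 1 (eps / M)).
  replace (F t' ^ 2 - F t ^ 2) with ((F t' - F t) * (F t' - F t + 2 * F t)) by ring.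
  rewrite Rabs_mult. set (a := Rabs (F t' - F t)) in *.
  assert (A3 : Rabs (F t' - F t + 2 * F t) <= M).
  { eapply Rle_trans; [apply Rabs_triang|]. rewrite (Rabs_mult 2), (Rabs_pos_eq 2) by lra. fold a. unfold M. lra. }
  apply Rle_lt_trans with (a * M).
  - apply Rmult_le_compat_l; [apply Rabs_pos|exact A3].
  - apply Rmult_lt_reg_r with (/ M); [now apply Rinv_0_lt_compat|].
    rewrite Rmult_assoc, Rinv_r by lra. unfold Rdiv in *. lra.
Qed.

Lemma holo_torus_jcont d r f : 0 < r < 1 -> holomorphic_polydisk d f -> jcont (fun t => Cmod (f (torus_pt d r t)) ^ 2).
Proof.
  intros Hr Hf. apply jcont_sqr. intros t eps He.
  destruct (Hf _ (torus_pt_polydisk d r t Hr)) as [Hc _]. destruct (Hc eps He) as [del [Hd H]].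
  assert (Hpi := PI_RGT_0).
  exists (del / (4 * PI)). split; [apply Rdiv_lt_0_compat; lra|]. intros t' Ht'.
  assert (A : Cmod (f (torus_pt d r t') - f (torus_pt d r t)) < eps).
  { apply H; [now apply torus_pt_polydisk|]. intros i Hi. unfold torus_pt.
    apply Nat.ltb_lt in Hi. rewrite Hi. fold (E (t' i)). fold (E (t i)).
    replace (r * E (t' i) - r * E (t i))%C with (r * (E (t' i) - E (t i)))%C by ring.
    rewrite Cmod_mult, Cmod_R, Rabs_pos_eq by lra.
    assert (L := E_lipschitz (t' i) (t i)). specialize (Ht' i).
    assert (B := Cmod_ge_0 (E (t' i) - E (t i))).
    apply Rle_lt_trans with (4 * PI * Rabs (t' i - t i)); [nra|].
    apply Rmult_lt_compat_l with (r := 4 * PI) in Ht'; [|lra].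
    replace (4 * PI * (del / (4 * PI))) with del in Ht' by (field; lra). exact Ht'. }
  assert (H1 := Cmod_triangle_inv (f (torus_pt d r t')) (f (torus_pt d r t))).
  assert (H2 := Cmod_triangle_inv (f (torus_pt d r t)) (f (torus_pt d r t'))).
  rewrite Cmod_sym in H2. apply Rabs_def1; lra.
Qed.

Lemma tapp_ray_cont d Ls f : (forall i, (i < d)%nat -> forall cp, In cp (Ls i) -> Cmod (snd cp) < 1) ->
  holomorphic_polydisk d f -> forall k z, (k <= d)%nat -> in_polydisk d z ->
  ccont (fun r : R => tapp k Ls (fun z => f (dil r z)) z) 1.
Proof.
  intros HL Hf. induction k; intros z Hk Hz.
  - cbn [tapp]. apply ccont_eps. intros eps He.
    destruct (Hf z Hz) as [Hc _]. destruct (Hc eps He) as [del [Hd H]].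
    assert (Hz' := Hz). destruct Hz' as [Hz1 Hz2].
    assert (Hone : dil 1 z = z) by (apply functional_extensionality; intros i; unfold dil; ring).
    (* A neighbourhood of [r = 1] also contains values above 1; the margin [m] keeps the dilated
       point inside the polydisk. *)
    assert (Hm : exists m, 0 < m /\ forall i, (i < d)%nat -> Cmod (z i) * (1 + m) < 1).
    { clear - Hz1. induction d.
      - exists 1. split; [lra|]. intros; lia.
      - destruct IHd as [m [Hm H]]; [intros; apply Hz1; lia|].
        assert (A := Hz1 d ltac:(lia)). assert (B := Cmod_ge_0 (z d)).
        exists (Rmin m ((1 - Cmod (z d)) / 2)). split; [apply Rmin_pos; lra|]. intros i Hi.
        assert (C1 := Rmin_l m ((1 - Cmod (z d)) / 2)). assert (C2 := Rmin_r m ((1 - Cmod (z d)) / 2)).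
        destruct (Nat.eq_dec i d) as [->|n].
        + nra.
        + specialize (H i ltac:(lia)). assert (B' := Cmod_ge_0 (z i)). nra. }
    destruct Hm as [m [Hm Hm2]].
    assert (Hmin : 0 < Rmin 1 (Rmin m del)) by (repeat apply Rmin_pos; lra).
    exists (mkposreal _ Hmin). intros r Hr.
    change (Rabs (r - 1) < Rmin 1 (Rmin m del)) in Hr. rewrite Hone.
    assert (C1 := Rmin_l 1 (Rmin m del)). assert (C2 := Rmin_r 1 (Rmin m del)).
    assert (C3 := Rmin_l m del). assert (C4 := Rmin_r m del).
    assert (Hr1 := Hr). apply Rabs_def2 in Hr1.
    apply H.
    + split; intros i Hi; unfold dil.
      * rewrite Cmod_mult, Cmod_R, Rabs_pos_eq by lra. specialize (Hm2 i Hi). assert (B := Cmod_ge_0 (z i)). nra.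
      * rewrite Hz2 by assumption. ring.
    + intros i Hi. unfold dil. replace (r * z i - z i)%C with (RtoC (r - 1) * z i)%C by (rewrite RtoC_minus; ring).
      rewrite Cmod_mult, Cmod_R. specialize (Hz1 i Hi). assert (B := Cmod_ge_0 (z i)). assert (B2 := Rabs_pos (r - 1)). nra.
  - cbn [tapp]. apply (fapp_cont (Ls k) (fun r v => tapp k Ls (fun z0 => f (dil r z0)) (upd z k v))).
    intros cp Hcp. apply IHk; [lia|]. apply polydisk_upd; [exact Hz|lia|]. now apply (HL k).
Qed.

Lemma mean_le_norm2 d f r : H2 d f -> 0 < r < 1 -> torus_mean2 d f r <= real (H2_norm2 d f).
Proof.
  intros [_ Hfin] Hr. unfold H2_norm2 in *.
  assert (L := Lub_Rbar_correct (fun x => exists r, 0 < r < 1 /\ x = torus_mean2 d f r)).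
  destruct L as [L _]. rewrite <- Hfin in L. apply (L (torus_mean2 d f r)). now exists r.
Qed.

(** The bound for dilations passes to the limit [r = 1] by continuity. All operator estimates rest
    on this one: the value of an operator at [z] is a tensor functional whose lists depend on
    [z]. *)
Theorem tapp_H2_bound d Ls kappa f : H2 d f -> (forall i, (i < d)%nat -> ker_bounded (Ls i) (kappa i)) ->
  Cmod (tapp d Ls f (fun _ => 0%C)) ^ 2 <= rprod kappa d * real (H2_norm2 d f).
Proof.
  intros Hf HL. set (M := rprod kappa d * real (H2_norm2 d f)).
  assert (HL' : forall i, (i < d)%nat -> forall cp, In cp (Ls i) -> Cmod (snd cp) < 1) by (intros i Hi; apply HL, Hi).
  assert (Hb : forall r, 0 < r < 1 -> Cmod (tapp d Ls (fun z => f (dil r z)) (fun _ => 0%C)) ^ 2 <= M).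
  { intros r Hr.
    replace (tapp d Ls (fun z => f (dil r z)) (fun _ => 0%C)) with (tapp d Ls (fun z => f (dil r z)) (tor d (fun _ => 0))).
    2:{ apply tapp_indep. intros i Hi. unfold tor. apply Nat.ltb_ge in Hi. now rewrite Hi. }
    assert (HF : (fun t => Cmod (f (dil r (tor d t))) ^ 2) = (fun t => Cmod (f (torus_pt d r t)) ^ 2)).
    { apply functional_extensionality. intros t. now rewrite dil_tor. }
    eapply Rle_trans; [apply (tapp_torus_bound d Ls kappa (fun z => f (dil r z))); auto|].
    - apply dil_sep_diff; [exact Hr|apply Hf].
    - rewrite HF. apply holo_torus_jcont; [exact Hr|apply Hf].
    - rewrite HF. unfold M. apply Rmult_le_compat_l.
      + left. apply rprod_pos. intros i Hi. now destruct (HL i Hi) as (_ & ? & _).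
      + now apply mean_le_norm2. }
  assert (Hc := tapp_ray_cont d Ls f HL' (proj1 Hf) d (fun _ => 0%C) (le_n d)).
  assert (H0 : in_polydisk d (fun _ => 0%C)) by (split; intros; [rewrite Cmod_0; lra|reflexivity]).
  specialize (Hc H0).
  replace f with (fun z => f (dil 1 z)) at 1.
  2:{ apply functional_extensionality. intros z. f_equal. apply functional_extensionality. intros i. unfold dil. ring. }
  apply continuous_Cmod, continuous_sqr in Hc.
  destruct (Rle_dec (Cmod (tapp d Ls (fun z => f (dil 1 z)) (fun _ => 0%C)) ^ 2) M) as [|n]; [assumption|].
  exfalso. apply Rnot_le_lt in n.
  set (T := fun r => Cmod (tapp d Ls (fun z => f (dil r z)) (fun _ => 0%C)) ^ 2) in *.
  assert (He : 0 < T 1 - M) by (unfold T; lra).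
  destruct (proj1 (filterlim_locally _ _) Hc (mkposreal _ He)) as [del Hd].
  set (r := 1 - Rmin (1 / 2) (del / 2)).
  assert (A1 := Rmin_l (1 / 2) (del / 2)). assert (A2 := Rmin_r (1 / 2) (del / 2)).
  assert (A3 : 0 < Rmin (1 / 2) (del / 2)) by (assert (A4 := cond_pos del); apply Rmin_pos; lra).
  specialize (Hd r). assert (Hr : 0 < r < 1) by (unfold r; lra). specialize (Hb r Hr).
  assert (Hball : ball 1 del r).
  { change (Rabs (r - 1) < del). apply Rabs_def1; unfold r; lra. }
  specialize (Hd Hball). change (Rabs (T r - T 1) < T 1 - M) in Hd. apply Rabs_def2 in Hd. unfold T in *. lra.
Qed.

(** * Torus means of functions with a product majorant *)

Lemma rprod_ext a b k : (forall i, (i < k)%nat -> a i = b i) -> rprod a k = rprod b k.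
Proof. induction k; intros H; simpl; [reflexivity|]. rewrite H, IHk; auto with arith. Qed.

Lemma rprod_single (a : nat -> R) d k x : (k < d)%nat ->
  rprod (fun i => if Nat.eqb i k then x else a i) d = x * rprod (fun i => if Nat.eqb i k then 1 else a i) d.
Proof.
  induction d; intros Hk; [lia|]. simpl. destruct (Nat.eqb_spec d k) as [->|n].
  - rewrite (rprod_ext (fun i => if Nat.eqb i k then x else a i) (fun i => if Nat.eqb i k then 1 else a i) k); [ring|].
    intros i Hi. destruct (Nat.eqb_spec i k); [lia|reflexivity].
  - rewrite IHd by lia. ring.
Qed.

(** Invariant of the iterated integration: the coordinates below [k] have already been replaced by
    their mean [c]. *)
Lemma cube_int_prod (M c : R) (kk : R -> R) d : (forall s, continuous kk s) -> RInt kk 0 1 = c ->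
  forall k t, (k <= d)%nat -> cube_int k (fun t => M * rprod (fun i => kk (t i)) d) t
    = M * rprod (fun i => if Nat.ltb i k then c else kk (t i)) d.
Proof.
  intros Hc Hk. induction k; intros t Hkd; [reflexivity|]. cbn [cube_int].
  set (P := rprod (fun i => if Nat.eqb i k then 1 else if Nat.ltb i k then c else kk (t i)) d).
  rewrite (RInt_ext _ (fun s => (M * P) * kk s)).
  - rewrite (RInt_scal (V := R_CompleteNormedModule)) by (apply ex_RInt_cont01; auto). rewrite Hk.
    change (M * P * c = M * rprod (fun i => if (i <? S k)%nat then c else kk (t i)) d).
    rewrite (rprod_ext (fun i => if (i <? S k)%nat then c else kk (t i))
      (fun i => if Nat.eqb i k then c else if Nat.ltb i k then c else kk (t i))).
    + rewrite (rprod_single (fun i => if (i <? k)%nat then c else kk (t i))) by lia. unfold P. ring.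
    + intros i Hi. destruct (Nat.ltb_spec i (S k)), (Nat.eqb_spec i k), (Nat.ltb_spec i k); try reflexivity; lia.
  - intros s _. rewrite IHk by lia.
    rewrite (rprod_ext _ (fun i => if Nat.eqb i k then kk s else if Nat.ltb i k then c else kk (t i))).
    + rewrite (rprod_single (fun i => if (i <? k)%nat then c else kk (t i))) by lia. unfold P. Req; ring.
    + intros i Hi. destruct (Nat.eqb_spec i k), (Nat.ltb_spec i k); try reflexivity; lia.
Qed.

Lemma jcont_prod (M : R) (kk : R -> R) d : (forall s, continuous kk s) -> jcont (fun t => M * rprod (fun i => kk (t i)) d).
Proof.
  intros Hc t eps He.
  assert (Hloc : forall d eps, 0 < eps -> exists del, 0 < del /\ forall t', (forall i, Rabs (t' i - t i) < del) ->
    Rabs (rprod (fun i => kk (t' i)) d - rprod (fun i => kk (t i)) d) < eps).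
  { clear eps He d. induction d; intros eps He.
    - exists 1. split; [lra|]. intros. simpl. rewrite Rminus_diag, Rabs_R0. exact He.
    - set (p := rprod (fun i => kk (t i)) d). set (q := kk (t d)).
      set (D := Rabs p + Rabs q + 1). assert (HD : 0 < D) by (unfold D; assert (A := Rabs_pos p); assert (B := Rabs_pos q); lra).
      set (e := Rmin 1 (eps / (2 * D))). assert (He0 : 0 < eps / (2 * D)) by (apply Rdiv_lt_0_compat; lra).
      assert (He1 : 0 < e) by (apply Rmin_pos; lra).
      destruct (IHd e He1) as [d1 [Hd1 H1]].
      destruct (proj1 (filterlim_locally _ _) (Hc (t d)) (mkposreal e He1)) as [d2 H2].
      exists (Rmin d1 d2). split; [apply Rmin_pos; [lra|apply cond_pos]|]. intros t' Ht'.
      assert (B1 : Rabs (rprod (fun i => kk (t' i)) d - p) < e).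
      { apply H1. intros i. eapply Rlt_le_trans; [apply Ht'|apply Rmin_l]. }
      assert (B2 : Rabs (kk (t' d) - q) < e).
      { apply (H2 (t' d)). change (Rabs (t' d - t d) < d2). eapply Rlt_le_trans; [apply Ht'|apply Rmin_r]. }
      simpl. fold p. fold q. set (p' := rprod (fun i => kk (t' i)) d) in *. set (q' := kk (t' d)) in *.
      replace (q' * p' - q * p) with ((q' - q) * (p' - p) + ((q' - q) * p + q * (p' - p))) by ring.
      assert (e <= 1) by apply Rmin_l.
      assert (He2 : e * (2 * D) <= eps).
      { apply Rle_trans with (eps / (2 * D) * (2 * D)).
        - apply Rmult_le_compat_r; [lra|apply Rmin_r].
        - right; field; lra. }
      eapply Rle_lt_trans; [apply Rabs_triang|].
      assert (T := Rabs_triang ((q' - q) * p) (q * (p' - p))).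
      rewrite !Rabs_mult in *.
      assert (Rabs (q' - q) * Rabs (p' - p) <= e * 1) by (apply Rmult_le_compat; try apply Rabs_pos; lra).
      assert (Rabs (q' - q) * Rabs p <= e * Rabs p) by (apply Rmult_le_compat_r; [apply Rabs_pos|lra]).
      assert (Rabs q * Rabs (p' - p) <= Rabs q * e) by (apply Rmult_le_compat_l; [apply Rabs_pos|lra]).
      unfold D in *. nra. }
  assert (HM := Rabs_pos M).
  destruct (Hloc d (eps / (Rabs M + 1))) as [del [Hd H]]; [apply Rdiv_lt_0_compat; lra|].
  exists del. split; [exact Hd|]. intros t' Ht'. specialize (H t' Ht').
  rewrite <- Rmult_minus_distr_l, Rabs_mult.
  set (x := Rabs (rprod (fun i => kk (t' i)) d - rprod (fun i => kk (t i)) d)) in *.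
  assert (0 <= x) by apply Rabs_pos.
  apply Rmult_lt_compat_r with (r := Rabs M + 1) in H; [|lra].
  unfold Rdiv in H. rewrite Rmult_assoc, Rinv_l in H by lra. nra.
Qed.

(** A majorant that factors over the coordinates integrates to [M * c ^ d]; this is the way from
    pointwise estimates to norms in H^2. *)
Lemma holo_mean_le d h M c (kk : R -> R) r : 0 < r < 1 -> holomorphic_polydisk d h ->
  (forall s, continuous kk s) -> RInt kk 0 1 = c ->
  (forall t, Cmod (h (torus_pt d r t)) ^ 2 <= M * rprod (fun i => kk (t i)) d) ->
  torus_mean2 d h r <= M * c ^ d.
Proof.
  intros Hr Hh Hc HI Hb. unfold torus_mean2.
  eapply Rle_trans; [apply cube_int_le; [now apply holo_torus_jcont|now apply (jcont_prod M kk d)|exact Hb]|].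
  rewrite (cube_int_prod M c kk d Hc HI d) by lia.
  rewrite (rprod_ext _ (fun _ => c)).
  - right. f_equal. clear. induction d; simpl; [reflexivity|]. now rewrite IHd.
  - intros i Hi. apply Nat.ltb_lt in Hi. now rewrite Hi.
Qed.

(** * Exponential, logarithm and the lens map *)

Lemma Cexp_plus a b : Cexp (a + b) = (Cexp a * Cexp b)%C.
Proof.
  unfold Cexp, Cplus, Cmult, Re, Im; cbn [fst snd]. rewrite exp_plus, cos_plus, sin_plus.
  f_equal; ring.
Qed.

Lemma Cexp_0 : Cexp 0 = 1%C.
Proof. unfold Cexp, Re, Im; simpl. rewrite exp_0, cos_0, sin_0. unfold RtoC. f_equal; ring. Qed.

Lemma Cmod_Cexp z : Cmod (Cexp z) = exp (fst z).
Proof.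
  unfold Cexp, Cmod, Re, Im; cbn [fst snd].
  replace ((exp (fst z) * cos (snd z)) ^ 2 + (exp (fst z) * sin (snd z)) ^ 2)
    with (Rsqr (exp (fst z)) * (Rsqr (sin (snd z)) + Rsqr (cos (snd z)))) by (unfold Rsqr; ring).
  rewrite sin2_cos2, Rmult_1_r. apply sqrt_Rsqr. left; apply exp_pos.
Qed.

Lemma Cexp_neq_0 z : Cexp z <> 0%C.
Proof. apply Cmod_gt_0. rewrite Cmod_Cexp. apply exp_pos. Qed.

Lemma sin_abs_le y : Rabs (sin y) <= Rabs y.
Proof.
  assert (H := Rlipschitz sin cos 1). specialize (H ltac:(intros; auto_derive; [trivial|ring])).
  specialize (H ltac:(intros; apply Rabs_le_between, COS_bound) y 0).
  rewrite sin_0, !Rminus_0_r in H. lra.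
Qed.

Lemma one_minus_cos_le y : Rabs (cos y - 1) <= y ^ 2 / 2.
Proof.
  replace y with (2 * (y / 2)) at 1 by field. rewrite cos_2a_sin.
  assert (H := sin_abs_le (y / 2)).
  replace (1 - 2 * sin (y / 2) * sin (y / 2) - 1) with (- (2 * (sin (y / 2) * sin (y / 2)))) by ring.
  rewrite Rabs_Ropp, Rabs_mult, (Rabs_pos_eq 2), Rabs_mult by lra.
  assert (Rabs (sin (y / 2)) * Rabs (sin (y / 2)) <= Rabs (y / 2) * Rabs (y / 2)) by (apply Rmult_le_compat; auto using Rabs_pos).
  rewrite <- (Rabs_mult (y / 2)), (Rabs_pos_eq (y / 2 * (y / 2))) in H0 by nra. lra.
Qed.

Lemma sin_minus_id_le y : Rabs y <= 1 -> Rabs (sin y - y) <= y ^ 2.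
Proof.
  intros Hy. destruct (MVT_gen (fun y => sin y - y) 0 y (fun y => cos y - 1)) as [c [Hc He]].
  - intros x _. auto_derive; [trivial|ring].
  - intros x _. apply continuity_pt_filterlim. change (continuous (fun y => sin y - y) x). apply (ex_derive_continuous (V := R_NormedModule)). auto_derive. trivial.
  - rewrite sin_0, !Rminus_0_r in He. rewrite He, Rabs_mult.
    assert (Hc2 : Rabs c <= Rabs y).
    { unfold Rmin, Rmax in Hc. destruct (Rle_dec 0 y).
      - rewrite !Rabs_pos_eq; lra.
      - rewrite (Rabs_left1 c), (Rabs_left1 y); lra. }
    assert (H := one_minus_cos_le c).
    assert (Hcy : c ^ 2 <= y ^ 2) by (rewrite <- (pow2_abs c), <- (pow2_abs y); apply pow_incr; split; [apply Rabs_pos|exact Hc2]).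
    rewrite <- (pow2_abs y) in *. assert (A := Rabs_pos y). assert (B := Rabs_pos (cos c - 1)). nra.
Qed.

Lemma exp_minus_affine_le x : Rabs x <= 1 / 2 -> 0 <= exp x - 1 - x <= 2 * x ^ 2.
Proof.
  intros Hx. apply Rabs_le_between in Hx. split; [assert (H := exp_ineq1_le x); lra|].
  assert (H := exp_ineq1_le (- x)). rewrite exp_Ropp in H. assert (Hp := exp_pos x).
  apply Rmult_le_compat_r with (r := exp x) in H; [|lra]. rewrite Rinv_l in H by lra.
  assert ((1 - x) * (1 + x + 2 * x ^ 2) >= 1).
  { replace ((1 - x) * (1 + x + 2 * x ^ 2)) with (1 + x ^ 2 * (1 - 2 * x)) by ring.
    assert (0 <= x ^ 2) by apply pow2_ge_0. nra. }
  nra.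
Qed.

Lemma Cexp_remainder h : Cmod h <= 1 / 2 -> Cmod (Cexp h - 1 - h) <= 4 * Cmod h ^ 2.
Proof.
  intros Hh. assert (H1 := Cmod_fst h). assert (H2 := Cmod_snd h).
  rewrite Cmod2_alt. unfold Re, Im. set (x := fst h) in *. set (y := snd h) in *.
  assert (E1 := exp_minus_affine_le x ltac:(lra)).
  assert (E2 := one_minus_cos_le y). assert (E3 := sin_minus_id_le y ltac:(lra)).
  assert (E4 := sin_abs_le y).
  eapply Rle_trans; [apply Cmod_le_sum|].
  replace (fst (Cexp h - 1 - h)%C) with ((exp x - 1 - x) * cos y + (1 + x) * (cos y - 1))
    by (unfold Cexp, x, y, Re, Im; simpl; ring).
  replace (snd (Cexp h - 1 - h)%C) with ((exp x - 1) * sin y + (sin y - y))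
    by (unfold Cexp, x, y, Re, Im; simpl; ring).
  assert (T1 := Rabs_triang ((exp x - 1 - x) * cos y) ((1 + x) * (cos y - 1))).
  assert (T2 := Rabs_triang ((exp x - 1) * sin y) (sin y - y)). rewrite (Rabs_mult (exp x - 1 - x)), (Rabs_mult (1 + x)) in T1. rewrite Rabs_mult in T2.
  assert (Hx2 : x ^ 2 = Rabs x ^ 2) by (now rewrite pow2_abs).
  assert (Hy2 : y ^ 2 = Rabs y ^ 2) by (now rewrite pow2_abs).
  assert (A := Rabs_pos x). assert (B := Rabs_pos y).
  assert (C1 : Rabs (exp x - 1 - x) <= 2 * x ^ 2) by (rewrite Rabs_pos_eq; lra).
  assert (C2 : Rabs (cos y) <= 1) by (apply Rabs_le_between, COS_bound).
  assert (C3 : Rabs (1 + x) <= 2) by (eapply Rle_trans; [apply Rabs_triang|]; rewrite Rabs_R1; lra).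
  assert (C4 : Rabs (exp x - 1) <= 2 * Rabs x).
  { replace (exp x - 1) with ((exp x - 1 - x) + x) by ring.
    eapply Rle_trans; [apply Rabs_triang|]. rewrite Hx2 in C1. nra. }
  assert (D1 : Rabs (exp x - 1 - x) * Rabs (cos y) <= 2 * x ^ 2 * 1) by (apply Rmult_le_compat; auto using Rabs_pos).
  assert (D2 : Rabs (1 + x) * Rabs (cos y - 1) <= 2 * (y ^ 2 / 2)) by (apply Rmult_le_compat; auto using Rabs_pos).
  assert (D3 : Rabs (exp x - 1) * Rabs (sin y) <= 2 * Rabs x * Rabs y) by (apply Rmult_le_compat; auto using Rabs_pos).
  assert (D4 : 2 * Rabs x * Rabs y <= x ^ 2 + y ^ 2).
  { rewrite Hx2, Hy2. assert (S := pow2_ge_0 (Rabs x - Rabs y)). nra. }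
  assert (0 <= x ^ 2) by apply pow2_ge_0. assert (0 <= y ^ 2) by apply pow2_ge_0. lra.
Qed.

(** The value [p a = Cexp a] is part of the conclusion because it is nonzero: the derivative of the
    logarithm is obtained by inverting this slope. *)
Lemma Cexp_caratheodory (a : C) : exists p : C -> C, ccont p a /\ p a = Cexp a /\
  forall w, (Cexp w = Cexp a + p w * (w - a))%C.
Proof.
  set (p0 := fun h : C => if Ceq_dec h 0 then RtoC 1 else ((Cexp h - 1) / h)%C).
  assert (Hp0 : forall h, (Cexp h = 1 + p0 h * h)%C).
  { intros h. unfold p0. destruct (Ceq_dec h 0) as [->|n]; [rewrite Cexp_0; ring|field; exact n]. }
  exists (fun w => Cexp a * p0 (w - a))%C. split; [|split].
  - apply ccont_mult; [apply ccont_const|]. apply ccont_eps. intros eps He. apply locally_Cmod.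
    assert (Hm : 0 < Rmin (1 / 2) (eps / 4)) by (apply Rmin_pos; lra).
    assert (M1 := Rmin_l (1 / 2) (eps / 4)). assert (M2 := Rmin_r (1 / 2) (eps / 4)).
    exists (Rmin (1 / 2) (eps / 4)). split; [exact Hm|]. intros w Hw.
    replace (a - a)%C with (RtoC 0) by ring. unfold p0 at 2. destruct (Ceq_dec 0 0) as [_|n]; [|contradiction].
    unfold p0. destruct (Ceq_dec (w - a) 0) as [E|n].
    + replace (1 - 1)%C with (RtoC 0) by ring. now rewrite Cmod_0.
    + set (h := (w - a)%C) in *. assert (Hh : 0 < Cmod h) by now apply Cmod_gt_0.
      replace ((Cexp h - 1) / h - 1)%C with ((Cexp h - 1 - h) / h)%C by (field; exact n).
      rewrite Cmod_div by exact n. assert (R := Cexp_remainder h ltac:(lra)).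
      apply Rmult_lt_reg_r with (Cmod h); [exact Hh|]. unfold Rdiv at 1. rewrite Rmult_assoc, Rinv_l by lra. nra.
  - replace (a - a)%C with (RtoC 0) by ring. unfold p0. destruct (Ceq_dec 0 0); [ring|contradiction].
  - intros w. replace w with (a + (w - a))%C at 1 by ring. rewrite Cexp_plus, (Hp0 (w - a)%C). ring.
Qed.

Lemma Cdiff_Cexp z : Cdiff Cexp z.
Proof. destruct (Cexp_caratheodory z) as [p (H1 & _ & H2)]. now exists p. Qed.

Lemma Clog_right u : 0 < fst u -> Clog u = (ln (Cmod u), atan (snd u / fst u)).
Proof.
  intros Hu. unfold Clog, Carg, Re, Im. destruct (Rlt_dec 0 (fst u)); [reflexivity|lra].
Qed.

Lemma Cexp_Clog u : 0 < fst u -> Cexp (Clog u) = u.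
Proof.
  intros Hu. rewrite Clog_right by exact Hu. unfold Cexp, Re, Im; cbn [fst snd].
  assert (Hm : 0 < Cmod u) by (apply Cmod_gt_0; intros ->; simpl in Hu; lra).
  rewrite exp_ln, cos_atan, sin_atan by exact Hm.
  assert (Hs : sqrt (1 + Rsqr (snd u / fst u)) = Cmod u / fst u).
  { unfold Cmod. rewrite <- (sqrt_Rsqr (fst u)) at 3 by lra.
    rewrite <- sqrt_div_alt by (apply Rlt_0_sqr; lra). f_equal. unfold Rsqr. field. lra. }
  rewrite Hs. destruct u as [x y]. cbn [fst snd] in *. f_equal; field; lra.
Qed.

Lemma ccont_Clog u : 0 < fst u -> ccont Clog u.
Proof.
  intros Hu.
  apply (continuous_ext_loc _ (fun v : C_UniformSpace => (ln (Cmod v), atan (snd v / fst v)) : C_UniformSpace)).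
  - apply locally_Cmod. exists (fst u). split; [exact Hu|]. intros w Hw.
    rewrite Clog_right; [reflexivity|]. assert (A := Cmod_fst (w - u)). simpl in A.
    assert (A2 := Rle_abs (- (fst w + - fst u))). rewrite Rabs_Ropp in A2. lra.
  - apply ccont_pair.
    + apply (continuous_comp (fun v : C_UniformSpace => Cmod v) ln).
      * apply continuous_Cmod, ccont_id.
      * apply (ex_derive_continuous (V := R_NormedModule)). exists (/ Cmod u). apply is_derive_ln.
        apply Cmod_gt_0. intros ->. simpl in Hu. lra.
    + apply (continuous_comp (fun v : C_UniformSpace => snd v / fst v) atan).
      * apply (continuous_mult (K := R_AbsRing) (fun v : C_UniformSpace => snd v) (fun v : C_UniformSpace => / fst v)).
        -- apply (ccont_snd (U := C_UniformSpace) (fun v => v)), ccont_id.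
        -- apply (continuous_comp (fun v : C_UniformSpace => fst v) Rinv).
           ++ apply (ccont_fst (U := C_UniformSpace) (fun v => v)), ccont_id.
           ++ apply (ex_derive_continuous (V := R_NormedModule)). auto_derive. lra.
      * apply (ex_derive_continuous (V := R_NormedModule)). auto_derive. trivial.
Qed.

(** Since [w - u = p (Clog w) (Clog w - Clog u)] with [p] the slope of the exponential, the slope of
    the logarithm is [1 / p (Clog w)], continuous because [Clog] is. *)
Lemma Cdiff_Clog u : 0 < fst u -> Cdiff Clog u.
Proof.
  intros Hu. destruct (Cexp_caratheodory (Clog u)) as [p (Hp & Hpa & He)].
  exists (fun v => if Ceq_dec v u then / p (Clog u) else (Clog v - Clog u) / (v - u))%C. split.
  - apply (continuous_ext_loc _ (fun v : C_UniformSpace => / p (Clog v))%C).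
    + apply locally_Cmod. exists (fst u). split; [exact Hu|]. intros w Hw.
      destruct (Ceq_dec w u) as [->|n]; [reflexivity|].
      assert (Hw0 : 0 < fst w).
      { assert (A := Cmod_fst (w - u)). simpl in A.
        assert (A2 := Rle_abs (- (fst w + - fst u))). rewrite Rabs_Ropp in A2. lra. }
      specialize (He (Clog w)). rewrite !Cexp_Clog in He by assumption.
      assert (Hd : (w - u)%C = (p (Clog w) * (Clog w - Clog u))%C) by (rewrite He at 1; ring).
      assert (n' : (w - u)%C <> 0%C) by now apply Cminus_eq_contra.
      rewrite Hd in n' |- *. match goal with |- ?x = ?y => change (@eq C x y) end. field. split; intros X; apply n'; rewrite X; ring.
    + apply ccont_inv; [|rewrite Hpa; apply Cexp_neq_0].
      apply (continuous_comp (V := C_UniformSpace) Clog p); [now apply ccont_Clog|exact Hp].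
  - intros w. destruct (Ceq_dec w u) as [->|n]; [ring|]. field. now apply Cminus_eq_contra.
Qed.

(** * The lens map in half-plane coordinates *)

Lemma fst_le_Cmod (z : C) : - Cmod z <= fst z <= Cmod z.
Proof. assert (H := Cmod_fst z). apply Rabs_le_between in H. lra. Qed.

(** The logarithm of [(1 - z) / (1 + z)], written as a difference to match the two separate powers
    in [lens]. *)
Definition lg (z : C) : C := (Clog (1 - z) - Clog (1 + z))%C.

Lemma one_plus_right z : Cmod z < 1 -> 0 < fst (1 + z)%C.
Proof. intros H. assert (A := fst_le_Cmod z). simpl. lra. Qed.

Lemma one_minus_right z : Cmod z < 1 -> 0 < fst (1 - z)%C.
Proof. intros H. assert (A := fst_le_Cmod z). simpl. lra. Qed.

Lemma Cdiff_lg z : Cmod z < 1 -> Cdiff lg z.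
Proof.
  intros H. apply Cdiff_minus.
  - apply (Cdiff_comp Clog (fun z => 1 - z)%C); [|apply Cdiff_Clog; now apply one_minus_right].
    apply Cdiff_minus; [apply Cdiff_const|apply Cdiff_id].
  - apply (Cdiff_comp Clog (fun z => 1 + z)%C); [|apply Cdiff_Clog; now apply one_plus_right].
    apply Cdiff_plus; [apply Cdiff_const|apply Cdiff_id].
Qed.

Lemma lg_0 : lg 0 = 0%C.
Proof. unfold lg. replace (1 - 0)%C with (1 + 0)%C by ring. ring. Qed.

Lemma cos_pos_half x : - PI < x < PI -> 0 < cos x -> Rabs x < PI / 2.
Proof.
  intros Hx Hc. assert (G : forall x, - PI < x < PI -> 0 < cos x -> x < PI / 2).
  { intros y Hy Hcy. destruct (Rlt_dec y (PI / 2)); [assumption|].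
    assert (cos y <= 0) by (apply cos_le_0; lra). lra. }
  apply Rabs_def1; [now apply G|]. assert (H := G (- x)). rewrite cos_neg in H.
  assert (- x < PI / 2) by (apply H; [lra|exact Hc]). lra.
Qed.

(** Two arguments in [(- pi / 2, pi / 2)] differ by less than [pi], and the cosine of their
    difference has the sign of [Re ((1 - z) conj (1 + z)) = 1 - |z|^2 > 0]. *)
Lemma lg_Im z : Cmod z < 1 -> Rabs (snd (lg z)) < PI / 2.
Proof.
  intros Hz. assert (HU := one_plus_right z Hz). assert (HV := one_minus_right z Hz).
  assert (EU := Cexp_Clog _ HU). assert (EV := Cexp_Clog _ HV).
  unfold lg. set (U := (1 + z)%C) in *. set (V := (1 - z)%C) in *.
  assert (aU : - (PI / 2) < snd (Clog U) < PI / 2) by (rewrite Clog_right by exact HU; assert (A := atan_bound); cbn [snd]; split; [eapply Rle_lt_trans; [|apply A]; lra|apply A]).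
  assert (aV : - (PI / 2) < snd (Clog V) < PI / 2) by (rewrite Clog_right by exact HV; assert (A := atan_bound); cbn [snd]; split; [eapply Rle_lt_trans; [|apply A]; lra|apply A]).
  change (snd (Clog V - Clog U)%C) with (snd (Clog V) - snd (Clog U)).
  apply cos_pos_half; [lra|].
  rewrite cos_minus.
  assert (P1 := exp_pos (fst (Clog U))). assert (P2 := exp_pos (fst (Clog V))).
  assert (F : exp (fst (Clog U)) * exp (fst (Clog V)) *
     (cos (snd (Clog V)) * cos (snd (Clog U)) + sin (snd (Clog V)) * sin (snd (Clog U))) = fst U * fst V + snd U * snd V).
  { assert (X1 := f_equal fst EU). assert (X2 := f_equal snd EU).
    assert (X3 := f_equal fst EV). assert (X4 := f_equal snd EV).
    unfold Cexp, Re, Im in X1, X2, X3, X4; cbn [fst snd] in X1, X2, X3, X4.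
    rewrite <- X1, <- X2, <- X3, <- X4. ring. }
  assert (Q : 0 < fst U * fst V + snd U * snd V).
  { unfold U, V; simpl. assert (A := Cmod2_alt z). unfold Re, Im in A. assert (B := Cmod_ge_0 z). nra. }
  rewrite <- F in Q. assert (0 < exp (fst (Clog U)) * exp (fst (Clog V))) by (apply Rmult_lt_0_compat; lra).
  apply Rmult_lt_reg_l with (exp (fst (Clog U)) * exp (fst (Clog V))); [assumption|]. lra.
Qed.

Definition W (theta : R) (z : C) : C := Cexp (theta * lg z).

Lemma fst_pos_neq_0 (z : C) : 0 < fst z -> z <> 0%C.
Proof. intros H ->. simpl in H. lra. Qed.

Definition cay (u : C) : C := ((1 - u) / (1 + u))%C.

Lemma snd_scal_lg theta z : Cmod z < 1 -> 0 < theta < 1 ->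
  Rabs (snd (RtoC theta * lg z)%C) <= theta * (PI / 2) /\ fst (RtoC theta * lg z)%C = theta * fst (lg z).
Proof.
  intros Hz Ht. assert (H := lg_Im z Hz). split; unfold Cmult, RtoC; cbn [fst snd].
  - replace (theta * snd (lg z) + 0 * fst (lg z)) with (theta * snd (lg z)) by ring.
    rewrite Rabs_mult, (Rabs_pos_eq theta) by lra. apply Rmult_le_compat_l; lra.
  - ring.
Qed.

Lemma cos_theta_pos theta : 0 < theta < 1 -> 0 < cos (theta * (PI / 2)).
Proof. intros H. assert (P := PI_RGT_0). apply cos_gt_0; nra. Qed.

Lemma cos_ge_cos_abs x a : Rabs x <= a -> a <= PI / 2 -> cos a <= cos x.
Proof.
  intros H Ha. assert (P := PI_RGT_0). assert (A := Rabs_pos x).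
  replace (cos x) with (cos (Rabs x)).
  - apply cos_decr_1; lra.
  - unfold Rabs. destruct (Rcase_abs x); [apply cos_neg|reflexivity].
Qed.

(** The argument of [W theta z] is at most [theta pi / 2], so [W] stays in a sector strictly inside
    the right half-plane: the Stolz domain, seen before the Cayley transform. *)
Lemma W_sector theta z : Cmod z < 1 -> 0 < theta < 1 ->
  cos (theta * (PI / 2)) * Cmod (W theta z) <= fst (W theta z).
Proof.
  intros Hz Ht. destruct (snd_scal_lg theta z Hz Ht) as [H _]. unfold W. rewrite Cmod_Cexp.
  unfold Cexp, Re, Im. cbn [fst]. rewrite Rmult_comm. apply Rmult_le_compat_l; [left; apply exp_pos|].
  assert (P := PI_RGT_0). apply cos_ge_cos_abs; [exact H|nra].
Qed.

Lemma Cmod_W theta z : Cmod (W theta z) = exp (theta * fst (lg z)).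
Proof. unfold W. rewrite Cmod_Cexp. f_equal. unfold Cmult, RtoC; cbn [fst snd]. ring. Qed.

Lemma W_right theta z : Cmod z < 1 -> 0 < theta < 1 -> 0 < fst (W theta z).
Proof.
  intros Hz Ht. assert (H := W_sector theta z Hz Ht). assert (C := cos_theta_pos theta Ht).
  rewrite Cmod_W in H. assert (P := exp_pos (theta * fst (lg z))). nra.
Qed.

Lemma one_plus_neq_0 u : 0 < fst u -> (1 + u)%C <> 0%C.
Proof. intros H. apply fst_pos_neq_0. simpl. lra. Qed.

(** Numerator and denominator of [lens] are divided by [(1 + z)^theta]. *)
Lemma lens_cay theta z : Cmod z < 1 -> 0 < theta < 1 -> lens theta z = cay (W theta z).
Proof.
  intros Hz Ht. unfold lens, Cpow_real.
  assert (HU := one_plus_right z Hz). assert (HV := one_minus_right z Hz).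
  assert (WR := W_right theta z Hz Ht).
  destruct (Ceq_dec (1 + z) 0) as [X|_]; [now apply fst_pos_neq_0 in X|].
  destruct (Ceq_dec (1 - z) 0) as [X|_]; [now apply fst_pos_neq_0 in X|].
  set (A := Cexp (theta * Clog (1 + z))).
  assert (HB : Cexp (theta * Clog (1 - z)) = (W theta z * A)%C).
  { unfold W, A. rewrite <- Cexp_plus. f_equal. unfold lg. ring. }
  assert (A0 : A <> 0%C) by apply Cexp_neq_0. assert (W1 := one_plus_neq_0 _ WR).
  rewrite HB. unfold cay. field. split; [exact W1|].
  replace (A + W theta z * A)%C with ((1 + W theta z) * A)%C by ring. now apply Cmult_neq_0.
Qed.

Lemma Cmod2_fst_snd (z : C) : Cmod z ^ 2 = fst z ^ 2 + snd z ^ 2.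
Proof. apply Cmod2_alt. Qed.

Lemma cay_mod u : 0 < fst u -> 1 - Cmod (cay u) ^ 2 = 4 * fst u / Cmod (1 + u) ^ 2.
Proof.
  intros Hu. assert (H1 := one_plus_neq_0 u Hu). unfold cay. rewrite Cmod_div by exact H1.
  assert (H2 : Cmod (1 + u) <> 0) by (intros X; now apply Cmod_eq_0 in X).
  replace (1 - (Cmod (1 - u) / Cmod (1 + u)) ^ 2) with ((Cmod (1 + u) ^ 2 - Cmod (1 - u) ^ 2) / Cmod (1 + u) ^ 2)
    by (field; exact H2).
  f_equal. rewrite !Cmod2_fst_snd. simpl. ring.
Qed.

Lemma cay_disk u : 0 < fst u -> Cmod (cay u) < 1.
Proof.
  intros Hu. assert (H := cay_mod u Hu). assert (H1 := one_plus_neq_0 u Hu). apply Cmod_gt_0 in H1.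
  assert (0 < 4 * fst u / Cmod (1 + u) ^ 2) by (apply Rdiv_lt_0_compat; [lra|now apply pow_lt]).
  assert (B := Cmod_ge_0 (cay u)). nra.
Qed.

Lemma lens_disk theta z : Cmod z < 1 -> 0 < theta < 1 -> Cmod (lens theta z) < 1.
Proof. intros Hz Ht. rewrite lens_cay by assumption. apply cay_disk. now apply W_right. Qed.

Lemma Cdiff_W theta z : Cmod z < 1 -> Cdiff (W theta) z.
Proof.
  intros Hz. apply (Cdiff_comp Cexp (fun z => theta * lg z)%C); [|apply Cdiff_Cexp].
  apply Cdiff_mult; [apply Cdiff_const|now apply Cdiff_lg].
Qed.

Lemma Cdiff_lens theta z : Cmod z < 1 -> 0 < theta < 1 -> Cdiff (lens theta) z.
Proof.
  intros Hz Ht. apply (Cdiff_loc (fun z => cay (W theta z))).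
  - apply locally_Cmod. exists (1 - Cmod z). split; [lra|]. intros w Hw.
    rewrite lens_cay; [reflexivity| |exact Ht]. assert (T := Cmod_triangle_inv w z). lra.
  - apply Cdiff_div.
    + apply Cdiff_minus; [apply Cdiff_const|now apply Cdiff_W].
    + apply Cdiff_plus; [apply Cdiff_const|now apply Cdiff_W].
    + apply one_plus_neq_0. now apply W_right.
Qed.

(* The harmonic majorant of [1 / (1 - |lens theta z|^2)], up to a constant. *)
Definition KK (theta' : R) (z : C) : R := fst (Cexp (theta' * lg z) + Cexp (- theta' * lg z))%C.

Lemma KK_ge theta' z : 0 < theta' < 1 -> Cmod z < 1 ->
  cos (theta' * (PI / 2)) * (exp (theta' * fst (lg z)) + exp (- (theta' * fst (lg z)))) <= KK theta' z.
Proof.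
  intros Ht Hz. unfold KK, Cexp, Re, Im; cbn [fst snd Cplus].
  destruct (snd_scal_lg theta' z Hz Ht) as [H1 H2].
  replace (fst (- theta' * lg z)%C) with (- fst (theta' * lg z)%C) by (unfold Cmult, RtoC; cbn [fst snd Copp]; ring).
  replace (snd (- theta' * lg z)%C) with (- snd (theta' * lg z)%C) by (unfold Cmult, RtoC; cbn [fst snd Copp]; ring).
  rewrite cos_neg, H2. assert (P := PI_RGT_0).
  assert (C : cos (theta' * (PI / 2)) <= cos (snd (theta' * lg z)%C)) by (apply cos_ge_cos_abs; [exact H1|nra]).
  assert (E1 := exp_pos (theta' * fst (lg z))). assert (E2 := exp_pos (- (theta' * fst (lg z)))). nra.
Qed.

Lemma KK_pos theta' z : 0 < theta' < 1 -> Cmod z < 1 -> 0 < KK theta' z.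
Proof.
  intros Ht Hz. eapply Rlt_le_trans; [|now apply KK_ge].
  apply Rmult_lt_0_compat; [now apply cos_theta_pos|].
  assert (E1 := exp_pos (theta' * fst (lg z))). assert (E2 := exp_pos (- (theta' * fst (lg z)))). lra.
Qed.

(** The mean of a harmonic function is its value at the centre; there [lg 0 = 0] and both
    exponentials equal 1, whatever the radius. *)
Lemma KK_mean theta' r : 0 < r < 1 ->
  (forall s, continuous (fun t => KK theta' (r * E t)) s) /\ RInt (fun t => KK theta' (r * E t)) 0 1 = 2.
Proof.
  intros Hr. set (g := fun z => (Cexp (theta' * lg (r * z)) + Cexp (- theta' * lg (r * z)))%C).
  assert (Hg : forall z, Cmod z <= 1 -> Cdiff g z).
  { intros z Hz.
    assert (D : Cdiff (fun z => lg (r * z)%C) z).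
    { apply (Cdiff_comp lg (fun z => r * z)%C); [apply Cdiff_mult; [apply Cdiff_const|apply Cdiff_id]|].
      apply Cdiff_lg. rewrite Cmod_mult, Cmod_R, Rabs_pos_eq by lra. assert (A := Cmod_ge_0 z). nra. }
    apply Cdiff_plus; apply (Cdiff_comp Cexp); try apply Cdiff_Cexp; (apply Cdiff_mult; [apply Cdiff_const|exact D]). }
  split.
  - intros s. exact (ccont_fst _ _ (circle_cont g s Hg)).
  - assert (M := mean_value g Hg). apply (f_equal fst) in M. unfold Cint in M; cbn [fst] in M.
    change (RInt (fun t => KK theta' (r * E t)) 0 1 = fst (g 0%C)) in M. rewrite M. unfold g.
    rewrite Cmult_0_r, lg_0, !Cmult_0_r, Cexp_0. simpl. ring.
Qed.

Definition xcosh (x : R) : R := exp x + exp (- x).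

Lemma xcosh_ge2 x : 2 <= xcosh x.
Proof.
  unfold xcosh. rewrite exp_Ropp. assert (P := exp_pos x). set (e := exp x) in *.
  apply Rmult_le_reg_r with e; [exact P|]. rewrite Rmult_plus_distr_r, Rinv_l by lra.
  assert (S := pow2_ge_0 (e - 1)). nra.
Qed.

(** With [rho = |u|] the left side is at most [(1 + rho)^2 / (4 c rho)], and
    [(1 + rho)^2 / rho = 2 + rho + 1 / rho] is at most twice [xcosh (ln rho)]. *)
Lemma cay_kappa u c : 0 < c -> c * Cmod u <= fst u -> 0 < Cmod u ->
  / (1 - Cmod (cay u) ^ 2) <= / (2 * c) * xcosh (ln (Cmod u)).
Proof.
  intros Hc Hs Hu. assert (Hf : 0 < fst u) by nra. rewrite cay_mod by exact Hf.
  set (rho := Cmod u) in *.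
  assert (H1 : Cmod (1 + u) <= 1 + rho).
  { eapply Rle_trans; [apply Cmod_triangle|]. rewrite Cmod_1. fold rho. lra. }
  assert (H0 := one_plus_neq_0 u Hf). apply Cmod_gt_0 in H0.
  assert (Hx : xcosh (ln rho) = rho + / rho) by (unfold xcosh; now rewrite exp_Ropp, exp_ln).
  assert (H2 := xcosh_ge2 (ln rho)). rewrite Hx in *.
  apply Rle_trans with ((1 + rho) ^ 2 / (4 * (c * rho))).
  - replace (/ (4 * fst u / Cmod (1 + u) ^ 2)) with (Cmod (1 + u) ^ 2 / (4 * fst u)) by (field; lra).
    apply Rmult_le_compat.
    + apply pow2_ge_0.
    + left. apply Rinv_0_lt_compat. lra.
    + apply pow_incr. lra.
    + apply Rinv_le_contravar; nra.
  - replace ((1 + rho) ^ 2 / (4 * (c * rho))) with (/ (4 * c) * (2 + (rho + / rho))) by (field; lra).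
    replace (/ (2 * c)) with (/ (4 * c) * 2) by (field; lra). rewrite Rmult_assoc.
    apply Rmult_le_compat_l; [left; apply Rinv_0_lt_compat; lra|]. lra.
Qed.

Lemma xcosh_even x : xcosh (- x) = xcosh x.
Proof. unfold xcosh. rewrite Ropp_involutive. ring. Qed.

Lemma xcosh_abs x : xcosh x = xcosh (Rabs x).
Proof. unfold Rabs. destruct (Rcase_abs x); [now rewrite xcosh_even|reflexivity]. Qed.

(** The gain from enlarging the exponent from [a] to [b], later [theta] and [upper_exponent theta];
    it pays for the points beyond the last node. *)
Lemma xcosh_ratio a b L : 0 <= a <= b -> xcosh (a * L) <= 2 * exp (- ((b - a) * Rabs L)) * xcosh (b * L).
Proof.
  intros Hab. rewrite (xcosh_abs (a * L)), (xcosh_abs (b * L)), !Rabs_mult, (Rabs_pos_eq a), (Rabs_pos_eq b) by lra.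
  set (l := Rabs L). assert (Hl : 0 <= l) by apply Rabs_pos.
  assert (H1 : xcosh (a * l) <= 2 * exp (a * l)).
  { unfold xcosh. assert (exp (- (a * l)) <= exp (a * l)); [|lra].
    destruct (Req_dec (a * l) 0) as [->|n]; [rewrite Ropp_0; lra|left; apply exp_increasing; nra]. }
  assert (H2 : exp (b * l) <= xcosh (b * l)) by (unfold xcosh; assert (P := exp_pos (- (b * l))); lra).
  eapply Rle_trans; [exact H1|]. replace (a * l) with (- ((b - a) * l) + b * l) by ring. rewrite exp_plus.
  assert (P := exp_pos (- ((b - a) * l))). nra.
Qed.

(* [b] is the squared pseudo-hyperbolic distance between [cay u] and [cay V]. *)
Lemma beta_cay (u : C) (V c : R) : 0 < V -> 0 < c -> c * Cmod u <= fst u -> 0 < Cmod u ->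
  let b := Cmod ((cay u - cay V) / (1 - cay V * cay u))%C ^ 2 in
  b <= 1 /\ (Rabs (ln V - ln (Cmod u)) <= 1 -> b <= 1 - c / 4).
Proof.
  intros HV Hc Hs Hu b. assert (Hf : 0 < fst u) by nra. set (rho := Cmod u) in *.
  assert (HVu : (V + u)%C <> 0%C) by (apply fst_pos_neq_0; simpl; lra).
  assert (Hb : b = 1 - 4 * V * fst u / Cmod (V + u) ^ 2).
  { assert (H1 := one_plus_neq_0 u Hf). assert (H2 := one_plus_neq_0 (RtoC V) HV).
    assert (H3 : Cmod (V + u) <> 0) by (intros X; now apply Cmod_eq_0 in X).
    unfold b. replace ((cay u - cay V) / (1 - cay V * cay u))%C with ((V - u) / (V + u))%C.
    - rewrite Cmod_div by exact HVu.
      replace ((Cmod (V - u) / Cmod (V + u)) ^ 2) with (Cmod (V - u) ^ 2 / Cmod (V + u) ^ 2) by (field; exact H3).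
      replace (Cmod (V - u) ^ 2) with (Cmod (V + u) ^ 2 - 4 * V * fst u) by (rewrite !Cmod2_fst_snd; simpl; ring).
      field. exact H3.
    - unfold cay. assert (H4 : (2 * (V + u))%C <> 0%C).
      { apply Cmult_neq_0; [intros X; apply RtoC_inj in X; lra|exact HVu]. }
      field. repeat split; auto. intros X. apply H4. rewrite <- X. ring. }
  assert (HVp : 0 < Cmod (V + u)) by now apply Cmod_gt_0.
  assert (Hq : 0 < Cmod (V + u) ^ 2) by now apply pow_lt.
  split.
  - rewrite Hb. assert (0 <= 4 * V * fst u / Cmod (V + u) ^ 2); [|lra].
    apply Rdiv_le_0_compat; [nra|exact Hq].
  - intros Hd. rewrite Hb.
    assert (H1 : Cmod (V + u) <= V + rho).
    { eapply Rle_trans; [apply Cmod_triangle|]. rewrite Cmod_R, Rabs_pos_eq by lra. fold rho. lra. }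
    (* At logarithmic distance at most 1 the moduli differ by a factor at most 3, so
       [(V + rho)^2 <= 16 V rho]; this is the source of [c / 4]. *)
    assert (E3 : exp 1 <= 3) by apply exp_le_3.
    apply Rabs_le_between in Hd.
    assert (Hr1 : V <= 3 * rho).
    { rewrite <- (exp_ln V), <- (exp_ln rho) by lra. apply Rle_trans with (exp (ln rho + 1)).
      - destruct (Req_dec (ln V) (ln rho + 1)) as [->|]; [lra|left; apply exp_increasing; lra].
      - rewrite exp_plus. assert (P := exp_pos (ln rho)). nra. }
    assert (Hr2 : rho <= 3 * V).
    { rewrite <- (exp_ln V), <- (exp_ln rho) by lra. apply Rle_trans with (exp (ln V + 1)).
      - destruct (Req_dec (ln rho) (ln V + 1)) as [->|]; [lra|left; apply exp_increasing; lra].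
      - rewrite exp_plus. assert (P := exp_pos (ln V)). nra. }
    assert (H2 : Cmod (V + u) ^ 2 <= (V + rho) ^ 2) by (apply pow_incr; lra).
    assert (H3 : (V + rho) ^ 2 <= 16 * (V * rho)).
    { assert (0 <= (3 * rho - V) * (3 * V - rho)) by (apply Rmult_le_pos; lra). nra. }
    assert (c / 4 <= 4 * V * fst u / Cmod (V + u) ^ 2); [|lra].
    apply Rmult_le_reg_r with (Cmod (V + u) ^ 2); [exact Hq|].
    unfold Rdiv at 2. rewrite Rmult_assoc, Rinv_l by lra.
    assert (V * (c * rho) <= V * fst u) by (apply Rmult_le_compat_l; lra). nra.
Qed.

(** * Blaschke interpolation *)

Definition beta (v : R) (w : C) : C := ((w - v) / (1 - v * w))%C.

Fixpoint blaschke (v : nat -> R) (N : nat) (w : C) : C :=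
  match N with O => 1%C | S N => (beta (v N) w * blaschke v N w)%C end.

Lemma real_disk (v : R) : -1 < v < 1 -> Cmod v < 1.
Proof. intros H. rewrite Cmod_R. apply Rabs_def1; lra. Qed.

Lemma beta_le_1 v w : -1 < v < 1 -> Cmod w <= 1 -> Cmod (beta v w) <= 1.
Proof.
  intros Hv Hw. assert (H := kernel_denom_neq_0 v w (real_disk v Hv) Hw).
  unfold beta. rewrite Cmod_div by exact H. apply Cmod_gt_0 in H.
  apply Rmult_le_reg_r with (Cmod (1 - v * w)); [exact H|].
  unfold Rdiv. rewrite Rmult_assoc, Rinv_l by lra. rewrite Rmult_1_r, Rmult_1_l.
  apply Rsqr_incr_0_var; [|lra].
  unfold Rsqr.
  assert (A1 := Cmod2_fst_snd (w - v)). assert (A2 := Cmod2_fst_snd (1 - v * w)).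
  assert (A3 := Cmod2_fst_snd w). simpl in A1, A2, A3.
  assert (A4 := Cmod_ge_0 w).
  assert (A5 : 0 <= (1 - v * v) * (1 - (fst w ^ 2 + snd w ^ 2))).
  { apply Rmult_le_pos; [nra|]. simpl. nra. }
  nra.
Qed.

Lemma blaschke_le_1 v N w : (forall j, (j < N)%nat -> -1 < v j < 1) -> Cmod w <= 1 -> Cmod (blaschke v N w) <= 1.
Proof.
  intros Hv Hw. induction N; simpl; [rewrite Cmod_1; lra|]. rewrite Cmod_mult.
  rewrite <- (Rmult_1_r 1). apply Rmult_le_compat; auto using Cmod_ge_0.
  apply beta_le_1; auto.
Qed.

Lemma blaschke_neq_0 v N w : (forall j, (j < N)%nat -> -1 < v j < 1) -> Cmod w < 1 ->
  (forall j, (j < N)%nat -> w <> RtoC (v j)) -> blaschke v N w <> 0%C.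
Proof.
  intros Hv Hw Hd. induction N; simpl; [intros X; apply RtoC_inj in X; lra|].
  apply Cmult_neq_0; [|apply IHN; intros; auto].
  unfold beta. apply Cmult_neq_0; [apply Cminus_eq_contra; auto|].
  assert (H := kernel_denom_neq_0 (v N) w (real_disk _ (Hv N ltac:(lia))) ltac:(lra)).
  intros X. apply (f_equal (fun z => (1 - v N * w) * z)%C) in X. cbv beta in X.
  rewrite Cinv_r in X by exact H. rewrite Cmult_0_r in X. apply RtoC_inj in X. lra.
Qed.

Lemma Cdiff_beta v w : -1 < v < 1 -> Cmod w <= 1 -> Cdiff (beta v) w.
Proof.
  intros Hv Hw. apply Cdiff_div.
  - apply Cdiff_minus; [apply Cdiff_id|apply Cdiff_const].
  - apply Cdiff_minus; [apply Cdiff_const|]. apply Cdiff_mult; [apply Cdiff_const|apply Cdiff_id].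
  - apply kernel_denom_neq_0; [now apply real_disk|exact Hw].
Qed.

Lemma Cdiff_blaschke v N w : (forall j, (j < N)%nat -> -1 < v j < 1) -> Cmod w <= 1 -> Cdiff (blaschke v N) w.
Proof.
  intros Hv Hw. induction N; simpl; [apply Cdiff_const|].
  apply Cdiff_mult; [apply Cdiff_beta; auto|]. apply IHN. intros; auto.
Qed.

Lemma fapp_cat L1 L2 g : fapp (L1 ++ L2) g = (fapp L1 g + fapp L2 g)%C.
Proof. induction L1 as [|cp L1 IH]; simpl; [ring|]. rewrite IH. ring. Qed.

Lemma fapp_map_lin (N : list nat) (a b : nat -> C) (k : C) (p : nat -> C) g :
  fapp (map (fun j => (a j + k * b j, p j))%C N) g
  = (fapp (map (fun j => (a j, p j)) N) g + k * fapp (map (fun j => (b j, p j)) N) g)%C.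
Proof. induction N as [|j N IH]; simpl; [ring|]. rewrite IH. ring. Qed.

Definition nodes_list (c : nat -> C -> C) (v : nat -> R) (N : nat) (w : C) : list (C * C) :=
  map (fun j => (c j w, RtoC (v j))) (seq 0 N).

(** Differentiability and a uniform bound of the coefficients are included so that products of the
    [c j], composed with the lens map, lie in H^2. As the nodes are real, the error is symmetric in
    [w] and [s] without conjugates. *)
Definition interpolates (v : nat -> R) (N : nat) (c : nat -> C -> C) : Prop :=
  (forall j w, Cmod w < 1 -> Cdiff (c j) w) /\
  (exists M, forall j w, Cmod w < 1 -> Cmod (c j w) <= M) /\
  forall w s, Cmod w < 1 -> Cmod s <= 1 ->
    (/ (1 - w * s) - ker (nodes_list c v N w) s = blaschke v N w * blaschke v N s / (1 - w * s))%C.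

(** Newton's scheme: the new error is the old error at [w] minus [gam w] times the old error at the
    new node [u]. It closes up by the identity [1 / (1 - w s) - (1 - u^2) / ((1 - u w) (1 - u s)) =
    (w - u) (s - u) / ((1 - w s) (1 - u w) (1 - u s))]. *)
Lemma interpolation (v : nat -> R) (N : nat) :
  (forall j, (j < N)%nat -> -1 < v j < 1) ->
  (forall i j, (i < j < N)%nat -> v i <> v j) -> exists c, interpolates v N c.
Proof.
  intros Hv Hd. induction N.
  - exists (fun _ _ => 0%C). split; [|split].
    + intros; apply Cdiff_const.
    + exists 0. intros. rewrite Cmod_0. lra.
    + intros w s Hw Hs. unfold ker, nodes_list; simpl. unfold Cdiv. ring.
  - destruct IHN as [c (HC & [M HM] & HI)]; [intros; apply Hv; lia|intros; apply Hd; lia|].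
    assert (Hv' : forall j, (j < N)%nat -> -1 < v j < 1) by (intros; apply Hv; lia).
    assert (HvN := Hv N ltac:(lia)). assert (HmN := real_disk _ HvN).
    set (u := RtoC (v N)) in *. set (Bv := blaschke v N u).
    assert (HB : Bv <> 0%C).
    { apply blaschke_neq_0; auto. intros j Hj X. apply RtoC_inj in X. now apply (Hd j N); [lia|]. }
    (* The multiple for which the new error vanishes at [s = u]. *)
    set (gam := fun w => (blaschke v N w * ((1 - u * u) / ((1 - u * w) * Bv)))%C).
    assert (Hden : forall w, Cmod w <= 1 -> (1 - u * w)%C <> 0%C) by (intros; now apply kernel_denom_neq_0).
    exists (fun j w => if Nat.eqb j N then gam w else c j w + (- gam w) * c j u)%C.
    assert (HG : exists G, 0 <= G /\ forall w, Cmod w < 1 -> Cmod (gam w) <= G).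
    { exists (Cmod (1 - u * u) / ((1 - Cmod u) * Cmod Bv)). apply Cmod_gt_0 in HB.
      assert (Hp : 0 < (1 - Cmod u) * Cmod Bv) by (apply Rmult_lt_0_compat; lra).
      split; [apply Rdiv_le_0_compat; [apply Cmod_ge_0|exact Hp]|]. intros w Hw.
      assert (D := Hden w ltac:(lra)). apply Cmod_gt_0 in HB.
      unfold gam. rewrite Cmod_mult, Cmod_div, Cmod_mult by now apply Cmult_neq_0.
      rewrite <- (Rmult_1_l (Cmod (1 - u * u) / ((1 - Cmod u) * Cmod Bv))).
      apply Rmult_le_compat; [apply Cmod_ge_0| |apply blaschke_le_1; auto; lra|].
      - apply Cmod_gt_0 in D. apply Cmod_gt_0 in HB. apply Rdiv_le_0_compat; [apply Cmod_ge_0|now apply Rmult_lt_0_compat].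
      - apply Rmult_le_compat_l; [apply Cmod_ge_0|]. apply Rinv_le_contravar; [exact Hp|].
        apply Rmult_le_compat_r; [apply Cmod_ge_0|].
        eapply Rle_trans; [|apply Cmod_triangle_inv]. rewrite Cmod_1, Cmod_mult.
        assert (A := Cmod_ge_0 u). assert (B := Cmod_ge_0 w). nra. }
    destruct HG as [G [HG0 HG]].
    split; [|split].
    + intros j w Hw.
      assert (Dg : Cdiff gam w).
      { apply Cdiff_mult; [apply Cdiff_blaschke; auto; lra|].
        apply Cdiff_div; [apply Cdiff_const| |apply Cmult_neq_0; [apply Hden; lra|exact HB]].
        apply Cdiff_mult; [|apply Cdiff_const]. apply Cdiff_minus; [apply Cdiff_const|].
        apply Cdiff_mult; [apply Cdiff_const|apply Cdiff_id]. }
      destruct (Nat.eqb j N); [exact Dg|]. apply Cdiff_plus; [now apply HC|].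
      apply Cdiff_mult; [now apply Cdiff_opp|apply Cdiff_const].
    + exists (M + G * M + G). intros j w Hw.
      assert (M0 : 0 <= M) by (eapply Rle_trans; [apply Cmod_ge_0|apply (HM 0%nat w Hw)]).
      assert (H1 := HG w Hw). destruct (Nat.eqb j N); [nra|].
      eapply Rle_trans; [apply Cmod_triangle|]. rewrite Cmod_mult, Cmod_opp.
      assert (H2 := HM j w Hw). assert (H3 := HM j u HmN).
      assert (Cmod (gam w) * Cmod (c j u) <= G * M) by (apply Rmult_le_compat; auto using Cmod_ge_0). lra.
    + intros w s Hw Hs. unfold nodes_list. rewrite seq_S, map_app. unfold ker. rewrite fapp_cat.
      simpl (0 + N)%nat.
      rewrite (map_ext_in _ (fun j => (c j w + (- gam w) * c j u, RtoC (v j)))%C).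
      2:{ intros j Hj. apply in_seq in Hj. destruct (Nat.eqb_spec j N); [lia|reflexivity]. }
      rewrite (fapp_map_lin _ (fun j => c j w) (fun j => c j u) (- gam w)%C (fun j => RtoC (v j))).
      cbn [map fapp fold_right fst snd]. rewrite Nat.eqb_refl.
      assert (I1 := HI w s Hw Hs). assert (I2 := HI u s HmN Hs). unfold ker, nodes_list in I1, I2.
      fold u. set (a1 := fapp (map (fun j => (c j w, RtoC (v j))) (seq 0 N)) (fun p => / (1 - p * s))%C) in *.
      set (a2 := fapp (map (fun j => (c j u, RtoC (v j))) (seq 0 N)) (fun p => / (1 - p * s))%C) in *.
      assert (D1 := kernel_denom_neq_0 w s Hw Hs). assert (D2 := kernel_denom_neq_0 u s HmN Hs).
      assert (D3 := Hden w ltac:(lra)).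
      replace a1 with (/ (1 - w * s) - blaschke v N w * blaschke v N s / (1 - w * s))%C by (rewrite <- I1; ring).
      fold Bv in I2. replace a2 with (/ (1 - u * s) - Bv * blaschke v N s / (1 - u * s))%C by (rewrite <- I2; ring).
      cbn [blaschke]. unfold beta, gam. fold u. field. auto.
Qed.

Lemma ker_bounded_intro L w m kappa : Cmod w < 1 ->
  (forall cp, In cp L -> Cmod (snd cp) < 1) -> 0 < kappa -> m * / (1 - Cmod w ^ 2) <= kappa ->
  (forall t, Cmod (ker L (E (- t))) ^ 2 <= m * Cmod (/ (1 - w * E (- t)))%C ^ 2) -> ker_bounded L kappa.
Proof.
  intros Hw HL Hk Hm Hb. split; [exact HL|split; [exact Hk|]].
  assert (c2 : ex_RInt (fun t => Cmod (/ (1 - w * E (- t)))%C ^ 2) 0 1).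
  { apply ex_RInt_cont01. intros t _. apply continuous_sqr, continuous_Cmod, ccont_inv.
    - apply ccont_minus; [apply ccont_const|]. apply ccont_mult; [apply ccont_const|apply ccont_E_opp].
    - apply kernel_denom_neq_0; [exact Hw|rewrite Cmod_E; lra]. }
  eapply Rle_trans; [|exact Hm]. rewrite <- poisson_int by exact Hw.
  assert (Es : m * RInt (fun t => Cmod (/ (1 - w * E (- t)))%C ^ 2) 0 1 =
    RInt (fun t => m * Cmod (/ (1 - w * E (- t)))%C ^ 2) 0 1).
  { symmetry. now apply (RInt_scal (V := R_CompleteNormedModule)). }
  rewrite Es. apply RInt_le; [lra| | |].
  - apply ex_RInt_cont01. intros t _. apply continuous_sqr, continuous_Cmod. now apply ker_cont.
  - now apply (ex_RInt_scal (V := R_CompleteNormedModule)).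
  - intros t _. apply Hb.
Qed.

Definition delta_list (w : C) : list (C * C) := (RtoC 1, w) :: nil.

Definition diff_list (c : nat -> C -> C) (v : nat -> R) (N : nat) (w : C) : list (C * C) :=
  (RtoC 1, w) :: map (fun j => (- c j w, RtoC (v j)))%C (seq 0 N).

Lemma fapp_diff_list c v N w g : fapp (diff_list c v N w) g = (fapp (delta_list w) g - fapp (nodes_list c v N w) g)%C.
Proof.
  unfold diff_list, delta_list, nodes_list. cbn [fapp fold_right fst snd].
  assert (H : fapp (map (fun j => (- c j w, RtoC (v j)))%C (seq 0 N)) g = (- fapp (map (fun j => (c j w, RtoC (v j))) (seq 0 N)) g)%C).
  { generalize (seq 0 N). intros L. induction L as [|j L IH]; simpl; [ring|]. rewrite IH. ring. }
  change (1 * g w + fapp (map (fun j => (- c j w, RtoC (v j)))%C (seq 0 N)) g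
    = 1 * g w + 0 - fapp (map (fun j => (c j w, RtoC (v j))) (seq 0 N)) g)%C.
  rewrite H. ring.
Qed.

Lemma delta_bounded w kappa : Cmod w < 1 -> / (1 - Cmod w ^ 2) <= kappa -> ker_bounded (delta_list w) kappa.
Proof.
  intros Hw Hk. assert (A := Cmod_ge_0 w).
  assert (P : 0 < / (1 - Cmod w ^ 2)) by (apply Rinv_0_lt_compat; nra).
  apply (ker_bounded_intro _ w 1); try lra.
  - intros cp [<-|[]]. exact Hw.
  - intros t. unfold ker, delta_list; simpl fapp. cbn [fst snd].
    right. replace (1 * / (1 - w * E (- t)) + 0)%C with (/ (1 - w * E (- t)))%C by ring. ring.
Qed.

Lemma nodes_in c v N w : (forall j, (j < N)%nat -> -1 < v j < 1) ->
  forall cp, In cp (nodes_list c v N w) -> Cmod (snd cp) < 1.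
Proof.
  intros Hv cp H. apply in_map_iff in H. destruct H as [j [<- Hj]]. apply in_seq in Hj.
  apply real_disk, Hv. lia.
Qed.

(** By the interpolation identity the kernel of the node functional is
    [(1 - B(w) B(s)) / (1 - w s)], and [|1 - B(w) B(s)|^2 <= 4]. *)
Lemma nodes_bounded c v N w kappa : (forall j, (j < N)%nat -> -1 < v j < 1) -> interpolates v N c -> Cmod w < 1 ->
  4 * / (1 - Cmod w ^ 2) <= kappa -> ker_bounded (nodes_list c v N w) kappa.
Proof.
  intros Hv (_ & _ & HI) Hw Hk. assert (A := Cmod_ge_0 w).
  assert (P : 0 < / (1 - Cmod w ^ 2)) by (apply Rinv_0_lt_compat; nra).
  apply (ker_bounded_intro _ w 4); try lra; [now apply nodes_in|].
  intros t. set (s := E (- t)). assert (Hs : Cmod s <= 1) by (unfold s; rewrite Cmod_E; lra).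
  specialize (HI w s Hw Hs). assert (D := kernel_denom_neq_0 w s Hw Hs).
  replace (ker (nodes_list c v N w) s) with ((1 - blaschke v N w * blaschke v N s) * / (1 - w * s))%C.
  2:{ replace (ker (nodes_list c v N w) s) with (/ (1 - w * s) - (/ (1 - w * s) - ker (nodes_list c v N w) s))%C by ring.
      rewrite HI. field. exact D. }
  rewrite Cmod_mult, Rpow_mult_distr. apply Rmult_le_compat_r; [apply pow2_ge_0|].
  assert (B1 := blaschke_le_1 v N w Hv ltac:(lra)). assert (B2 := blaschke_le_1 v N s Hv Hs).
  assert (T := Cmod_triangle 1 (- (blaschke v N w * blaschke v N s))).
  rewrite Cmod_1, Cmod_opp, Cmod_mult in T. fold (1 - blaschke v N w * blaschke v N s)%C in T.
  assert (G1 := Cmod_ge_0 (blaschke v N w)). assert (G2 := Cmod_ge_0 (blaschke v N s)).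
  assert (G3 := Cmod_ge_0 (1 - blaschke v N w * blaschke v N s)).
  assert (Cmod (1 - blaschke v N w * blaschke v N s) <= 2) by nra. nra.
Qed.

(** Here the kernel is [B(w) B(s) / (1 - w s)]. On the circle [|B(s)| <= 1] is enough, whereas
    [B(w)] is kept: it carries the whole gain. *)
Lemma diff_bounded c v N w kappa : (forall j, (j < N)%nat -> -1 < v j < 1) -> interpolates v N c -> Cmod w < 1 ->
  0 < kappa -> Cmod (blaschke v N w) ^ 2 * / (1 - Cmod w ^ 2) <= kappa -> ker_bounded (diff_list c v N w) kappa.
Proof.
  intros Hv (_ & _ & HI) Hw Hk0 Hk.
  apply (ker_bounded_intro _ w (Cmod (blaschke v N w) ^ 2)); try assumption.
  - intros cp [<-|H]; [exact Hw|]. apply in_map_iff in H. destruct H as [j [<- Hj]]. apply in_seq in Hj.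
    apply real_disk, Hv. lia.
  - intros t. set (s := E (- t)). assert (Hs : Cmod s <= 1) by (unfold s; rewrite Cmod_E; lra).
    specialize (HI w s Hw Hs). assert (D := kernel_denom_neq_0 w s Hw Hs).
    unfold ker. rewrite fapp_diff_list. fold (ker (nodes_list c v N w) s).
    unfold delta_list; simpl fapp at 1. cbn [fst snd].
    replace (1 * / (1 - w * s) + 0 - ker (nodes_list c v N w) s)%C with (/ (1 - w * s) - ker (nodes_list c v N w) s)%C by ring.
    rewrite HI. unfold Cdiv. rewrite !Cmod_mult, !Rpow_mult_distr.
    apply Rmult_le_compat_r; [apply pow2_ge_0|].
    assert (B2 := blaschke_le_1 v N s Hv Hs). assert (G2 := Cmod_ge_0 (blaschke v N s)).
    assert (Cmod (blaschke v N s) ^ 2 <= 1) by nra.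
    assert (0 <= Cmod (blaschke v N w) ^ 2) by apply pow2_ge_0. nra.
Qed.

(** * Multilinearity of tensor functionals *)

Lemma fapp_linear L g h a b : fapp L (fun v => a * g v + b * h v)%C = (a * fapp L g + b * fapp L h)%C.
Proof. induction L as [|cp L IH]; simpl; [ring|]. rewrite IH. ring. Qed.

Lemma tapp_lists_ext k Ls Ls' f z : (forall i, (i < k)%nat -> Ls i = Ls' i) -> tapp k Ls f z = tapp k Ls' f z.
Proof.
  revert z. induction k; intros z H; simpl; [reflexivity|]. rewrite (H k) by lia.
  apply fapp_ext. intros cp _. apply IHk. intros; apply H; lia.
Qed.

Lemma tapp_linear k Ls f g a b z :
  tapp k Ls (fun w => a * f w + b * g w)%C z = (a * tapp k Ls f z + b * tapp k Ls g z)%C.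
Proof.
  revert z. induction k; intros z; simpl; [reflexivity|]. rewrite <- fapp_linear.
  apply fapp_ext. intros cp _. apply IHk.
Qed.

(** Linearity of the tensor product in the functional of a single coordinate, which is one step of
    the telescoping sum. *)
Lemma tapp_slot k Ls i LD L1 L2 f z : (i < k)%nat ->
  (forall g, fapp LD g = (fapp L1 g - fapp L2 g)%C) ->
  let slot L := fun j => if Nat.eqb j i then L else Ls j in
  tapp k (slot LD) f z = (tapp k (slot L1) f z - tapp k (slot L2) f z)%C.
Proof.
  intros Hi HD slot. revert z Hi. induction k; intros z Hi; [lia|]. simpl. unfold slot at 1 3 5.
  destruct (Nat.eqb_spec k i) as [->|n].
  - assert (EQ : forall L L' M, fapp M (fun v => tapp i (slot L) f (upd z i v)) = fapp M (fun v => tapp i (slot L') f (upd z i v))).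
    { intros L L' M. apply fapp_ext. intros cp _. apply tapp_lists_ext. intros j Hj. unfold slot.
      destruct (Nat.eqb_spec j i); [lia|reflexivity]. }
    rewrite HD, (EQ LD L1 L1), (EQ LD L2 L2). reflexivity.
  - rewrite <- (Cmult_1_l (fapp (Ls k) (fun v => tapp k (slot L1) f (upd z k v)))).
    unfold Cminus. replace (- fapp (Ls k) (fun v => tapp k (slot L2) f (upd z k v)))%C
      with ((-1) * fapp (Ls k) (fun v => tapp k (slot L2) f (upd z k v)))%C by ring.
    rewrite <- fapp_linear. apply fapp_ext. intros cp _. rewrite IHk by lia. ring.
Qed.

Lemma tapp_delta k (w : nat -> C) f z :
  tapp k (fun i => delta_list (w i)) f z = f (fun i => if Nat.ltb i k then w i else z i).
Proof.
  revert z. induction k; intros z; simpl; [f_equal|].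
  rewrite Cplus_0_r, Cmult_1_l, IHk. f_equal. apply functional_extensionality. intros i.
  unfold upd. destruct (Nat.ltb_spec i k), (Nat.eqb_spec i k), (Nat.ltb_spec i (S k)); subst; try reflexivity; lia.
Qed.

(* Telescoping over the coordinate in which the node functional replaces evaluation. *)
Lemma tapp_telescope d (LP LD Le : nat -> list (C * C)) f z X :
  (forall i g, (i < d)%nat -> fapp (LD i) g = (fapp (Le i) g - fapp (LP i) g)%C) ->
  (forall i, (i < d)%nat ->
     Cmod (tapp d (fun j => if Nat.ltb j i then LP j else if Nat.eqb j i then LD j else Le j) f z) <= X) ->
  Cmod (tapp d Le f z - tapp d LP f z) <= INR d * X.
Proof.
  intros HD HX.
  set (hyb := fun i => tapp d (fun j => if Nat.ltb j i then LP j else Le j) f z).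
  assert (H : forall i, (i <= d)%nat -> Cmod (tapp d Le f z - hyb i) <= INR i * X).
  { induction i; intros Hi.
    - unfold hyb. simpl. rewrite Rmult_0_l.
      replace (tapp d Le f z - tapp d (fun j => Le j) f z)%C with (RtoC 0); [rewrite Cmod_0; lra|].
      change (fun j : nat => Le j) with Le. ring.
    - rewrite S_INR, Rmult_plus_distr_r, Rmult_1_l.
      replace (tapp d Le f z - hyb (S i))%C with ((tapp d Le f z - hyb i) + (hyb i - hyb (S i)))%C by ring.
      eapply Rle_trans; [apply Cmod_triangle|]. apply Rplus_le_compat; [apply IHi; lia|].
      replace (hyb i - hyb (S i))%C with (tapp d (fun j => if Nat.ltb j i then LP j else if Nat.eqb j i then LD j else Le j) f z);
      [apply HX; lia|].
      assert (SL := tapp_slot d (fun j => if Nat.ltb j i then LP j else Le j) i (LD i) (Le i) (LP i) f z ltac:(lia)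
         (fun g => HD i g ltac:(lia))). cbv zeta in SL.
      unfold hyb. etransitivity; [|etransitivity; [exact SL|]].
      + apply tapp_lists_ext. intros j _. destruct (Nat.ltb_spec j i), (Nat.eqb_spec j i); subst; try reflexivity; lia.
      + apply (f_equal2 Cminus); apply tapp_lists_ext; intros j _;
        destruct (Nat.eqb_spec j i), (Nat.ltb_spec j i), (Nat.ltb_spec j (S i)); subst; try reflexivity; lia. }
  assert (H1 := H d (le_n d)). unfold hyb in H1.
  rewrite (tapp_lists_ext d (fun j => if Nat.ltb j d then LP j else Le j) LP) in H1; [exact H1|].
  intros j Hj. apply Nat.ltb_lt in Hj. now rewrite Hj.
Qed.

(** * Estimates at the nodes *)

(** This is [- tanh (x / 2)], a real point at hyperbolic distance [|x|] from 0; equally spaced [x]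
    give hyperbolically equidistant nodes. *)
Definition real_node (x : R) : R := (1 - exp x) / (1 + exp x).

Lemma real_node_cay x : RtoC (real_node x) = cay (RtoC (exp x)).
Proof.
  unfold real_node, cay. assert (P := exp_pos x).
  rewrite RtoC_div by lra. now rewrite RtoC_minus, RtoC_plus.
Qed.

Lemma real_node_bounds x : -1 < real_node x < 1.
Proof.
  unfold real_node. assert (P := exp_pos x). split.
  - apply Rmult_lt_reg_r with (1 + exp x); [lra|]. unfold Rdiv. rewrite Rmult_assoc, Rinv_l by lra. lra.
  - apply Rmult_lt_reg_r with (1 + exp x); [lra|]. unfold Rdiv. rewrite Rmult_assoc, Rinv_l by lra. lra.
Qed.

Lemma real_node_inj x y : real_node x = real_node y -> x = y.
Proof.
  unfold real_node. intros H. assert (P := exp_pos x). assert (Q := exp_pos y).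
  apply exp_inv. apply (f_equal (fun t => t * ((1 + exp x) * (1 + exp y)))) in H.
  replace ((1 - exp x) / (1 + exp x) * ((1 + exp x) * (1 + exp y))) with ((1 - exp x) * (1 + exp y)) in H by (field; lra).
  replace ((1 - exp y) / (1 + exp y) * ((1 + exp x) * (1 + exp y))) with ((1 - exp y) * (1 + exp x)) in H by (field; lra).
  lra.
Qed.

(** Mesh [1 / m], starting at [- m]. The number [(2 m)^2] of nodes used later brings the grid up to
    [3 m] and makes the rank [(2 m)^(2 d)]. *)
Definition grid (m j : nat) : R := real_node (INR j / INR m - INR m).

Lemma grid_inj m i j : (1 <= m)%nat -> grid m i = grid m j -> i = j.
Proof.
  intros Hm H. apply real_node_inj in H. apply lt_INR in Hm. simpl in Hm.
  apply INR_eq. apply (f_equal (fun t => (t + INR m) * INR m)) in H. cbv beta in H.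
  unfold Rminus in H. rewrite !Rplus_assoc, !Rplus_opp_l, !Rplus_0_r in H.
  unfold Rdiv in H. rewrite !Rmult_assoc, Rinv_l in H by lra. lra.
Qed.

Lemma rprod_nonneg_le_1 b k : (forall j, (j < k)%nat -> 0 <= b j <= 1) -> 0 <= rprod b k <= 1.
Proof.
  induction k; intros H; simpl; [lra|]. assert (A := H k ltac:(lia)).
  assert (B := IHk ltac:(intros; apply H; lia)). nra.
Qed.

Lemma rprod_window b rho j0 m N : 0 <= rho -> (forall j, (j < N)%nat -> 0 <= b j <= 1) -> (j0 + m <= N)%nat ->
  (forall j, (j0 <= j < j0 + m)%nat -> b j <= rho) -> rprod b N <= rho ^ m.
Proof.
  intros Hr H01. revert m. induction N; intros m HN Hw.
  - assert (m = 0)%nat as -> by lia. simpl. lra.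
  - assert (A := H01 N ltac:(lia)).
    assert (B := rprod_nonneg_le_1 b N ltac:(intros; apply H01; lia)).
    destruct (Nat.eq_dec (j0 + m) (S N)) as [Heq|n].
    + destruct m as [|m].
      * simpl. nra.
      * simpl. assert (Hb : b N <= rho) by (apply Hw; lia).
        assert (rprod b N <= rho ^ m) by (apply IHN; [intros; apply H01; lia|lia|intros; apply Hw; lia]).
        apply Rmult_le_compat; lra.
    + assert (rprod b N <= rho ^ m) by (apply IHN; [intros; apply H01; lia|lia|intros; apply Hw; lia]).
      simpl. assert (0 <= rho ^ m) by now apply pow_le. nra.
Qed.

Lemma blaschke_sqr v N w : Cmod (blaschke v N w) ^ 2 = rprod (fun j => Cmod (beta (v j) w) ^ 2) N.
Proof.
  induction N; simpl blaschke; simpl rprod; [rewrite Cmod_1; ring|].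
  now rewrite Cmod_mult, Rpow_mult_distr, IHN.
Qed.

Lemma grid_window m x : (1 <= m)%nat -> Rabs x <= INR m -> exists j0, (j0 + m <= 4 * (m * m))%nat /\
  forall j, (j0 <= j < j0 + m)%nat -> Rabs (INR j / INR m - INR m - x) <= 1.
Proof.
  intros Hm Hx. assert (HM : 1 <= INR m) by (apply le_INR in Hm; simpl in Hm; lra).
  set (M := INR m) in *. apply Rabs_le_between in Hx.
  (* The window of [m] nodes lies on the side of [x] towards 0, so it stays inside the grid also
     when [x] is near [- m] or [m]. *)
  set (y := if Rle_dec x 0 then M * (x + M) else M * (x + M) - M).
  assert (Hy : M * (x + M) - M <= y <= M * (x + M)) by (unfold y; destruct (Rle_dec x 0); lra).
  assert (Hyb : 0 <= y <= 2 * (M * M)).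
  { assert (M * x <= M * M) by (apply Rmult_le_compat_l; lra). unfold y. destruct (Rle_dec x 0) as [r|r]; [|apply Rnot_le_lt in r].
    - assert (0 <= M * (x + M)) by (apply Rmult_le_pos; lra). lra.
    - assert (0 <= M * (x + M - 1)) by (apply Rmult_le_pos; lra). lra. }
  destruct (nfloor_ex y ltac:(lra)) as [k [Hk1 Hk2]].
  exists (S k). split.
  - apply INR_le. rewrite plus_INR, S_INR, !mult_INR. fold M. simpl (INR 4). nra.
  - intros j [Hj1 Hj2]. assert (J1 : INR k + 1 <= INR j) by (rewrite <- S_INR; now apply le_INR).
    assert (J2 : INR j + 1 <= INR k + 1 + M).
    { rewrite <- !S_INR. unfold M. rewrite <- plus_INR. apply le_INR. lia. }
    assert (E : INR j / M - M - x = (INR j - M * (x + M)) / M) by (field; lra). rewrite E.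
    unfold Rdiv. rewrite Rabs_mult, (Rabs_pos_eq (/ M)) by (left; apply Rinv_0_lt_compat; lra).
    apply Rmult_le_reg_r with M; [lra|]. rewrite Rmult_assoc, Rinv_l by lra.
    rewrite Rmult_1_r. apply Rabs_le_between; lra.
Qed.

Definition upper_exponent (theta : R) : R := (1 + theta) / 2.

(** Two regimes. If [|theta Re l| <= m], some [m] nodes lie within distance 1 in the logarithmic
    modulus, and each gives a factor [1 - c / 4]. Otherwise [|Re l| > m]; the Blaschke product is
    bounded by 1 and the decay comes from the larger exponent in [KK]. The rate [q] is the worse of
    the two. *)
Lemma lens_blaschke_estimate theta : 0 < theta < 1 -> exists A q, 0 < A /\ 0 < q < 1 /\
  forall z, Cmod z < 1 ->
    / (1 - Cmod (lens theta z) ^ 2) <= A * KK (upper_exponent theta) z /\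
    forall m, Cmod (blaschke (grid m) (4 * (m * m)) (lens theta z)) ^ 2 * / (1 - Cmod (lens theta z) ^ 2)
              <= A * q ^ m * KK (upper_exponent theta) z.
Proof.
  intros Ht. set (th := upper_exponent theta). assert (Hth : theta < th < 1) by (unfold th, upper_exponent; lra).
  set (c := cos (theta * (PI / 2))). set (c' := cos (th * (PI / 2))).
  assert (Hc : 0 < c) by now apply cos_theta_pos. assert (Hc' : 0 < c') by (apply cos_theta_pos; lra).
  assert (Hc1 : c <= 1) by apply COS_bound.
  set (e := exp (- (th - theta))).
  assert (He : 0 < e < 1).
  { split; [apply exp_pos|]. unfold e. rewrite <- exp_0. apply exp_increasing. lra. }
  assert (HA : 0 < / (c * c')) by (apply Rinv_0_lt_compat; nra).
  exists (/ (c * c')), (Rmax (1 - c / 4) e).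
  assert (Q1 := Rmax_l (1 - c / 4) e). assert (Q2 := Rmax_r (1 - c / 4) e).
  assert (Q3 : Rmax (1 - c / 4) e < 1) by (apply Rmax_lub_lt; lra).
  set (q := Rmax (1 - c / 4) e) in *.
  split; [exact HA|]. split; [lra|]. intros z Hz.
  rewrite lens_cay by assumption. set (u := W theta z). set (L := fst (lg z)).
  assert (Hu : Cmod u = exp (theta * L)) by apply Cmod_W.
  assert (Hlu : ln (Cmod u) = theta * L) by (rewrite Hu; apply ln_exp).
  assert (Hu0 : 0 < Cmod u) by (rewrite Hu; apply exp_pos).
  assert (Hs : c * Cmod u <= fst u) by now apply W_sector.
  assert (K1 := cay_kappa u c Hc Hs Hu0). rewrite Hlu in K1.
  assert (K2 := xcosh_ratio theta th L ltac:(lra)).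
  assert (K3 := KK_ge th z ltac:(lra) Hz). fold c' L in K3. fold (xcosh (th * L)) in K3.
  assert (KP := KK_pos th z ltac:(lra) Hz).
  set (K := KK th z) in *. set (kap := / (1 - Cmod (cay u) ^ 2)) in *.
  assert (Main : kap <= / (c * c') * exp (- ((th - theta) * Rabs L)) * K).
  { eapply Rle_trans; [exact K1|].
    apply Rle_trans with (/ (2 * c) * (2 * exp (- ((th - theta) * Rabs L)) * (K / c'))).
    - apply Rmult_le_compat_l; [left; apply Rinv_0_lt_compat; lra|]. eapply Rle_trans; [exact K2|].
      apply Rmult_le_compat_l; [assert (P := exp_pos (- ((th - theta) * Rabs L))); lra|].
      apply Rmult_le_reg_r with c'; [lra|]. unfold Rdiv. rewrite Rmult_assoc, Rinv_l by lra. lra.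
    - right. field. split; lra. }
  assert (HeL : exp (- ((th - theta) * Rabs L)) <= 1).
  { rewrite <- exp_0. assert (P := Rabs_pos L). destruct (Req_dec (Rabs L) 0) as [->|n].
    - rewrite Rmult_0_r, Ropp_0. lra.
    - left. apply exp_increasing. nra. }
  assert (First : kap <= / (c * c') * K).
  { eapply Rle_trans; [exact Main|]. apply Rmult_le_compat_r; [lra|].
    rewrite <- (Rmult_1_r (/ (c * c'))) at 2. apply Rmult_le_compat_l; lra. }
  split; [exact First|]. intros m.
  assert (Hk0 : 0 < kap).
  { apply Rinv_0_lt_compat. assert (D := cay_disk u (W_right theta z Hz Ht)). assert (D0 := Cmod_ge_0 (cay u)). nra. }
  rewrite blaschke_sqr. set (b := fun j => Cmod (beta (grid m j) (cay u)) ^ 2).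
  assert (Hb : forall j, b j <= 1 /\ (Rabs (INR j / INR m - INR m - theta * L) <= 1 -> b j <= 1 - c / 4)).
  { intros j. assert (B := beta_cay u (exp (INR j / INR m - INR m)) c (exp_pos _) Hc Hs Hu0). cbv zeta in B.
    rewrite ln_exp, Hlu, <- real_node_cay in B. exact B. }
  assert (Hb01 : forall j, 0 <= b j <= 1) by (intros j; split; [apply pow2_ge_0|apply Hb]).
  assert (HB := rprod_nonneg_le_1 b (4 * (m * m)) (fun j _ => Hb01 j)).
  set (B := rprod b (4 * (m * m))) in *.
  (* For [m = 0] the grid is empty and the claim is the first estimate; [grid_window] needs [m]
     positive. *)
  destruct m as [|m'].
  - rewrite pow_O, Rmult_1_r. unfold B. simpl. lra.
  - set (m := S m') in *.
    assert (HM : 1 <= INR m) by (unfold m; rewrite S_INR; assert (P := pos_INR m'); lra).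
    assert (Hqm : 0 < q ^ m) by (apply pow_lt; lra).
    assert (Hgoal : B * kap <= q ^ m * (/ (c * c') * K)); [|lra].
    destruct (Rle_dec (Rabs (theta * L)) (INR m)) as [Hle|Hgt].
    + destruct (grid_window m (theta * L) ltac:(unfold m; lia) Hle) as [j0 [Hj0 Hj]].
      assert (HBq : B <= q ^ m).
      { eapply Rle_trans; [apply (rprod_window b (1 - c / 4) j0 m); auto; try lra|].
        - intros j Hjj. apply Hb, Hj, Hjj.
        - apply pow_incr. lra. }
      apply Rmult_le_compat; lra.
    + apply Rnot_le_lt in Hgt.
      assert (HL : INR m < Rabs L).
      { rewrite Rabs_mult, Rabs_pos_eq in Hgt by lra. assert (P := Rabs_pos L). nra. }
      assert (HE : exp (- ((th - theta) * Rabs L)) <= q ^ m).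
      { apply Rle_trans with (e ^ m); [|apply pow_incr; lra].
        unfold e. rewrite <- Rpower_pow by apply exp_pos. unfold Rpower. rewrite ln_exp.
        left. apply exp_increasing. nra. }
      apply Rle_trans with (1 * kap); [apply Rmult_le_compat_r; lra|]. rewrite Rmult_1_l.
      eapply Rle_trans; [exact Main|].
      replace (q ^ m * (/ (c * c') * K)) with (/ (c * c') * q ^ m * K) by ring.
      apply Rmult_le_compat_r; [lra|]. apply Rmult_le_compat_l; lra.
Qed.

(** * Holomorphic functions on the polydisk *)

Definition pcont (d : nat) (f : (nat -> C) -> C) (z : nat -> C) : Prop :=
  forall eps, 0 < eps -> exists del, 0 < del /\ forall w, in_polydisk d w ->
    (forall i, (i < d)%nat -> Cmod (w i - z i) < del) -> Cmod (f w - f z) < eps.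

Lemma holo_intro d f : (forall z, in_polydisk d z -> pcont d f z) ->
  (forall z i, in_polydisk d z -> (i < d)%nat -> Cdiff (fun v => f (upd z i v)) (z i)) ->
  holomorphic_polydisk d f.
Proof.
  intros Hc Hd z Hz. split; [exact (Hc z Hz)|]. intros i Hi.
  destruct (Cdiff_limit_inv _ _ (Hd z i Hz Hi)) as [l Hl]. exists l. rewrite upd_id in Hl. exact Hl.
Qed.

Lemma holo_pcont d f z : holomorphic_polydisk d f -> in_polydisk d z -> pcont d f z.
Proof. intros H Hz. destruct (H z Hz) as [A _]; exact A. Qed.

Lemma pcont_op2 d (op : C -> C -> C) f g z :
  ccont (fun p : prod_UniformSpace C_UniformSpace C_UniformSpace => op (fst p) (snd p)) (f z, g z) ->
  pcont d f z -> pcont d g z -> pcont d (fun w => op (f w) (g w)) z.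
Proof.
  intros Ho Hf Hg eps He. rewrite ccont_eps in Ho. destruct (Ho eps He) as [e Hoe].
  destruct (Hf e (cond_pos e)) as [d1 [Hd1 H1]]. destruct (Hg e (cond_pos e)) as [d2 [Hd2 H2]].
  exists (Rmin d1 d2). split; [now apply Rmin_pos|]. intros w Hw Hwz.
  apply (Hoe (f w, g w)). split; apply C_NormedModule_mixin_compat1.
  - apply H1; [exact Hw|]. intros i Hi. eapply Rlt_le_trans; [now apply Hwz|apply Rmin_l].
  - apply H2; [exact Hw|]. intros i Hi. eapply Rlt_le_trans; [now apply Hwz|apply Rmin_r].
Qed.

Lemma holo_const d c : holomorphic_polydisk d (fun _ => c).
Proof.
  apply holo_intro.
  - intros z _ eps He. exists 1. split; [lra|]. intros. replace (c - c)%C with (RtoC 0) by ring. now rewrite Cmod_0.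
  - intros. apply Cdiff_const.
Qed.

Lemma holo_plus d f g : holomorphic_polydisk d f -> holomorphic_polydisk d g ->
  holomorphic_polydisk d (fun z => f z + g z)%C.
Proof.
  intros Hf Hg. apply holo_intro.
  - intros z Hz. apply (pcont_op2 d Cplus); try now apply holo_pcont.
    apply ccont_plus; [apply continuous_fst|apply continuous_snd].
  - intros z i Hz Hi. apply Cdiff_plus; now apply (holo_sep d).
Qed.

Lemma holo_mult d f g : holomorphic_polydisk d f -> holomorphic_polydisk d g ->
  holomorphic_polydisk d (fun z => f z * g z)%C.
Proof.
  intros Hf Hg. apply holo_intro.
  - intros z Hz. apply (pcont_op2 d Cmult); try now apply holo_pcont.
    apply ccont_mult; [apply continuous_fst|apply continuous_snd].
  - intros z i Hz Hi. apply Cdiff_mult; now apply (holo_sep d).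
Qed.

Lemma holo_lin d f g a b : holomorphic_polydisk d f -> holomorphic_polydisk d g ->
  holomorphic_polydisk d (fun z => a * f z + b * g z)%C.
Proof. intros Hf Hg. apply holo_plus; apply holo_mult; auto using holo_const. Qed.

Lemma holo_coord d i (g : C -> C) : (i < d)%nat -> (forall w, Cmod w < 1 -> Cdiff g w) ->
  holomorphic_polydisk d (fun z => g (z i)).
Proof.
  intros Hi Hg. apply holo_intro.
  - intros z Hz eps He. assert (D := Cdiff_cont _ _ (Hg (z i) (proj1 Hz i Hi))).
    rewrite ccont_eps in D. specialize (D eps He). apply locally_Cmod in D. destruct D as [del [Hd H]].
    exists del. split; [exact Hd|]. intros w _ Hw. apply H. now apply Hw.
  - intros z j Hz Hj. unfold upd. destruct (Nat.eqb_spec i j) as [->|n].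
    + apply Hg. now apply Hz.
    + apply Cdiff_const.
Qed.

Lemma multi_lens_polydisk d theta z : 0 < theta < 1 -> in_polydisk d z -> in_polydisk d (multi_lens d theta z).
Proof.
  intros Ht [H1 H2]. split; intros i Hi; unfold multi_lens; destruct (Nat.ltb_spec i d); try lia; auto.
  now apply lens_disk; [apply H1|].
Qed.

Lemma finite_delta (d : nat) (P : nat -> R -> Prop) :
  (forall i x y, P i x -> 0 < y <= x -> P i y) ->
  (forall i, (i < d)%nat -> exists x, 0 < x /\ P i x) -> exists x, 0 < x /\ forall i, (i < d)%nat -> P i x.
Proof.
  intros Hm. induction d; intros H.
  - exists 1. split; [lra|]. intros; lia.
  - destruct IHd as [x [Hx Hx2]]; [intros; apply H; lia|]. destruct (H d ltac:(lia)) as [y [Hy Hy2]].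
    exists (Rmin x y). assert (0 < Rmin x y) by now apply Rmin_pos. split; [assumption|]. intros i Hi.
    destruct (Nat.eq_dec i d) as [->|n].
    + apply (Hm d y); [assumption|]. split; [assumption|apply Rmin_r].
    + apply (Hm i x); [apply Hx2; lia|]. split; [assumption|apply Rmin_l].
Qed.

Lemma holo_comp_lens d theta f : 0 < theta < 1 -> holomorphic_polydisk d f ->
  holomorphic_polydisk d (fun z => f (multi_lens d theta z)).
Proof.
  intros Ht Hf. apply holo_intro.
  - intros z Hz eps He.
    destruct (holo_pcont d f _ Hf (multi_lens_polydisk d theta z Ht Hz) eps He) as [e [He' H]].
    destruct (finite_delta d (fun i x => forall w, Cmod (w - z i) < x -> Cmod (lens theta w - lens theta (z i)) < e)) as [del [Hd H2]].
    + intros i x y Hx Hy w Hw. apply Hx. lra.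
    + intros i Hi. assert (D := Cdiff_cont _ _ (Cdiff_lens theta (z i) (proj1 Hz i Hi) Ht)).
      rewrite ccont_eps in D. specialize (D e He'). now apply locally_Cmod in D.
    + exists del. split; [exact Hd|]. intros w Hw Hwz. apply H; [now apply multi_lens_polydisk|].
      intros i Hi. unfold multi_lens. assert (Hi' := Hi). apply Nat.ltb_lt in Hi'. rewrite Hi'. apply H2; auto.
  - intros z i Hz Hi.
    replace (fun v => f (multi_lens d theta (upd z i v))) with (fun v => f (upd (multi_lens d theta z) i (lens theta v))).
    + apply (Cdiff_comp (fun v => f (upd (multi_lens d theta z) i v)) (lens theta)).
      * apply Cdiff_lens; [now apply Hz|exact Ht].
      * assert (D := holo_sep d f (multi_lens d theta z) i Hf (multi_lens_polydisk d theta z Ht Hz) Hi).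
        unfold multi_lens in D at 2. assert (Hi' := Hi). apply Nat.ltb_lt in Hi'. rewrite Hi' in D. exact D.
    + apply functional_extensionality. intros v. f_equal. apply functional_extensionality. intros j.
      unfold upd, multi_lens. destruct (Nat.eqb_spec j i) as [->|n]; [|reflexivity].
      apply Nat.ltb_lt in Hi. now rewrite Hi.
Qed.

Lemma Lub_finite (P : R -> Prop) M : (exists x, P x) -> (forall x, P x -> x <= M) ->
  is_finite (Lub_Rbar P) /\ real (Lub_Rbar P) <= M.
Proof.
  intros [x Hx] HM. destruct (Lub_Rbar_correct P) as [H1 H2].
  specialize (H2 (Finite M)). assert (B : Rbar_le (Lub_Rbar P) M) by (apply H2; intros y Hy; now apply HM).
  assert (A := H1 x Hx). destruct (Lub_Rbar P); simpl in *; try contradiction. split; [reflexivity|exact B].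
Qed.

Lemma norm2_finite_le d h M : (forall r, 0 < r < 1 -> torus_mean2 d h r <= M) ->
  is_finite (H2_norm2 d h) /\ real (H2_norm2 d h) <= M.
Proof.
  intros H. apply Lub_finite.
  - exists (torus_mean2 d h (1 / 2)), (1 / 2). split; [lra|reflexivity].
  - intros x [r [Hr ->]]. now apply H.
Qed.

Lemma bounded_H2 d h B : holomorphic_polydisk d h -> (forall z, in_polydisk d z -> Cmod (h z) <= B) ->
  H2 d h /\ real (H2_norm2 d h) <= B ^ 2.
Proof.
  intros Hh HB. destruct (norm2_finite_le d h (B ^ 2)) as [H1 H2'].
  - intros r Hr. rewrite <- (Rmult_1_r (B ^ 2)). rewrite <- (pow1 d).
    apply (holo_mean_le d h (B ^ 2) 1 (fun _ => 1)); auto.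
    + intros; apply continuous_const.
    + rewrite (RInt_const (V := R_CompleteNormedModule)). unfold scal; simpl; unfold mult; simpl. ring.
    + intros t. replace (rprod (fun _ => 1) d) with 1.
      * rewrite Rmult_1_r. apply pow_incr. split; [apply Cmod_ge_0|]. apply HB. now apply torus_pt_polydisk.
      * clear. induction d; simpl; [reflexivity|]. rewrite <- IHd. ring.
  - split; [split; assumption|assumption].
Qed.

(** Evaluation at the origin has norm at most 1, so [|f(0)|^2] is a lower bound for the squared
    norm. *)
Lemma norm2_nonneg d f : H2 d f -> 0 <= real (H2_norm2 d f).
Proof.
  intros Hf. assert (H := tapp_H2_bound d (fun _ => delta_list 0) (fun _ => 1) f Hf).
  assert (HL : forall i, (i < d)%nat -> ker_bounded (delta_list 0) 1).
  { intros _ _. apply delta_bounded; rewrite Cmod_0; [lra|]. right. field. }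
  specialize (H HL). replace (rprod (fun _ => 1) d) with 1 in H by (clear; induction d; simpl; [reflexivity|rewrite <- IHd; ring]).
  assert (A := pow2_ge_0 (Cmod (tapp d (fun _ => delta_list 0) f (fun _ => 0%C)))). lra.
Qed.

(** * The upper bound *)

(** The product of the [KK th (z i)] has torus mean [2^d] at every radius. A bound of this form
    therefore puts a holomorphic [T f] in H^2 and bounds the operator norm by [sqrt (M 2^d)]. *)
Definition pointwise_bounded (d : nat) (th : R) (T : op) (M : R) : Prop :=
  forall f, H2 d f -> forall z, in_polydisk d z ->
    Cmod (T f z) ^ 2 <= M * rprod (fun i => KK th (z i)) d * real (H2_norm2 d f).

Lemma pointwise_norm2 d th T M f : 0 < th < 1 -> pointwise_bounded d th T M -> H2 d f ->
  holomorphic_polydisk d (T f) -> H2 d (T f) /\ real (H2_norm2 d (T f)) <= M * 2 ^ d * real (H2_norm2 d f).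
Proof.
  intros Hth HT Hf Hh.
  destruct (norm2_finite_le d (T f) (M * 2 ^ d * real (H2_norm2 d f))) as [H1 H2'].
  - intros r Hr. destruct (KK_mean th r Hr) as [Kc KI].
    replace (M * 2 ^ d * real (H2_norm2 d f)) with (M * real (H2_norm2 d f) * 2 ^ d) by ring.
    apply (holo_mean_le d (T f) _ 2 (fun t => KK th (r * E t))); auto.
    intros t. eapply Rle_trans; [apply HT; [exact Hf|now apply torus_pt_polydisk]|].
    right. rewrite (rprod_ext (fun i => KK th (torus_pt d r t i)) (fun i => KK th (r * E (t i)))); [ring|].
    intros i Hi. unfold torus_pt. apply Nat.ltb_lt in Hi. now rewrite Hi.
  - split; [split; assumption|assumption].
Qed.

Lemma H2_zero d : H2 d (fun _ => 0%C) /\ H2_norm d (fun _ => 0%C) = 0.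
Proof.
  destruct (bounded_H2 d (fun _ => 0%C) 0) as [H1 H2'].
  - apply holo_const.
  - intros. rewrite Cmod_0. lra.
  - split; [exact H1|]. unfold H2_norm. replace (real (H2_norm2 d (fun _ => 0%C))) with 0; [apply sqrt_0|].
    assert (A := norm2_nonneg d _ H1). lra.
Qed.

Lemma pointwise_op_norm d th T M : 0 < th < 1 -> 0 <= M -> pointwise_bounded d th T M ->
  (forall f, H2 d f -> holomorphic_polydisk d (T f)) ->
  is_finite (op_norm d T) /\ real (op_norm d T) <= sqrt (M * 2 ^ d).
Proof.
  intros Hth HM HT Hh. apply Lub_finite.
  - exists (H2_norm d (T (fun _ => 0%C))), (fun _ => 0%C). destruct (H2_zero d) as [H1 H2'].
    split; [exact H1|]. split; [lra|reflexivity].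
  - intros x [f (Hf & Hn & ->)].
    destruct (pointwise_norm2 d th T M f Hth HT Hf (Hh f Hf)) as [_ H].
    assert (N0 := norm2_nonneg d f Hf).
    assert (N1 : real (H2_norm2 d f) <= 1).
    { unfold H2_norm in Hn. rewrite <- sqrt_1 in Hn. apply sqrt_le_0 in Hn; lra. }
    unfold H2_norm. apply sqrt_le_1_alt. eapply Rle_trans; [exact H|].
    assert (P : 0 < 2 ^ d) by (apply pow_lt; lra). assert (0 <= M * 2 ^ d) by nra. nra.
Qed.

(** These functions span the range of the interpolation operator; [tensor_vals] lists the samples of
    [f] in the same nested order, so that [lin_comb] pairs them correctly. *)
Fixpoint tensor_funs (theta : R) (c : nat -> C -> C) (N k : nat) : list ((nat -> C) -> C) :=
  match k with
  | O => (fun _ => RtoC 1) :: nil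
  | S k => flat_map (fun j => map (fun g z => (c j (lens theta (z k)) * g z)%C) (tensor_funs theta c N k)) (seq 0 N)
  end.

Fixpoint tensor_vals (v : nat -> R) (N k : nat) (f : (nat -> C) -> C) (y : nat -> C) : list C :=
  match k with
  | O => f y :: nil
  | S k => flat_map (fun j => tensor_vals v N k f (upd y k (v j))) (seq 0 N)
  end.

Lemma flat_map_const_length {A B} (F : A -> list B) (l : list A) n :
  (forall a, length (F a) = n) -> length (flat_map F l) = (length l * n)%nat.
Proof. intros H. induction l as [|a l IH]; simpl; [reflexivity|]. now rewrite length_app, H, IH. Qed.

Lemma tensor_funs_length theta c N k : length (tensor_funs theta c N k) = (N ^ k)%nat.
Proof.
  induction k; simpl; [reflexivity|]. rewrite (flat_map_const_length _ _ (N ^ k)).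
  - now rewrite length_seq.
  - intros j. now rewrite length_map.
Qed.

Lemma tensor_vals_length v N k f y : length (tensor_vals v N k f y) = (N ^ k)%nat.
Proof.
  revert y. induction k; intros y; simpl; [reflexivity|]. rewrite (flat_map_const_length _ _ (N ^ k)).
  - now rewrite length_seq.
  - intros j. apply IHk.
Qed.

Lemma lin_comb_app cs1 gs1 cs2 gs2 z : length cs1 = length gs1 ->
  lin_comb (cs1 ++ cs2) (gs1 ++ gs2) z = (lin_comb cs1 gs1 z + lin_comb cs2 gs2 z)%C.
Proof.
  revert gs1. induction cs1 as [|c cs IH]; intros [|g gs] H; try discriminate; simpl.
  - ring.
  - rewrite IH by (now injection H). ring.
Qed.

Lemma lin_comb_map_mult cs gs (a : (nat -> C) -> C) z :
  lin_comb cs (map (fun g z => (a z * g z)%C) gs) z = (a z * lin_comb cs gs z)%C.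
Proof.
  revert gs. induction cs as [|c cs IH]; intros gs; simpl; [ring|].
  destruct gs as [|g gs]; simpl; [ring|]. rewrite IH. ring.
Qed.

Lemma tapp_lin_comb theta c v N k f z y :
  tapp k (fun i => nodes_list c v N (lens theta (z i))) f y
  = lin_comb (tensor_vals v N k f y) (tensor_funs theta c N k) z.
Proof.
  revert y. induction k; intros y; simpl; [ring|]. unfold nodes_list at 1.
  generalize (seq 0 N). intros l. induction l as [|j l IH]; simpl; [reflexivity|].
  rewrite lin_comb_app by (rewrite length_map, tensor_vals_length, tensor_funs_length; reflexivity).
  rewrite (lin_comb_map_mult _ _ (fun z => c j (lens theta (z k)))), <- IHk, <- IH. reflexivity.
Qed.

Lemma tensor_funs_bounded d theta c v N k : 0 < theta < 1 -> interpolates v N c -> (k <= d)%nat ->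
  forall g, In g (tensor_funs theta c N k) -> holomorphic_polydisk d g /\
    exists B, forall z, in_polydisk d z -> Cmod (g z) <= B.
Proof.
  intros Ht (Hc & [M HM] & _). induction k; intros Hk g Hg; simpl in Hg.
  - destruct Hg as [<-|[]]. split; [apply holo_const|]. exists 1. intros. rewrite Cmod_1. lra.
  - apply in_flat_map in Hg. destruct Hg as [j [_ Hg]]. apply in_map_iff in Hg. destruct Hg as [h [<- Hh]].
    destruct (IHk ltac:(lia) h Hh) as [H1 [B HB]]. split.
    + apply (holo_mult d (fun z => c j (lens theta (z k))) h); [|exact H1].
      apply (holo_coord d k (fun w => c j (lens theta w))); [lia|]. intros w Hw.
      apply (Cdiff_comp (c j) (lens theta)); [now apply Cdiff_lens|]. apply Hc. now apply lens_disk.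
    + exists (M * B). intros z Hz. rewrite Cmod_mult.
      apply Rmult_le_compat; auto using Cmod_ge_0. apply HM, lens_disk; [|exact Ht]. apply (proj1 Hz). lia.
Qed.

Lemma tensor_funs_H2 d theta c v N : 0 < theta < 1 -> interpolates v N c ->
  forall g, In g (tensor_funs theta c N d) -> H2 d g.
Proof.
  intros Ht Hc g Hg. destruct (tensor_funs_bounded d theta c v N d Ht Hc (le_n d) g Hg) as [H1 [B HB]].
  exact (proj1 (bounded_H2 d g B H1 HB)).
Qed.

Lemma holo_lin_comb d cs gs : (forall g, In g gs -> holomorphic_polydisk d g) ->
  holomorphic_polydisk d (fun z => lin_comb cs gs z).
Proof.
  revert gs. induction cs as [|c cs IH]; intros gs H; simpl; [apply holo_const|].
  destruct gs as [|g gs]; [apply holo_const|].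
  apply holo_plus; [apply holo_mult; [apply holo_const|apply H; now left]|].
  apply IH. intros; apply H; now right.
Qed.

Lemma holo_ext d f g : (forall z, f z = g z) -> holomorphic_polydisk d f -> holomorphic_polydisk d g.
Proof. intros H. replace g with f; [auto|]. apply functional_extensionality. exact H. Qed.

Definition interp_op (d : nat) (theta : R) (c : nat -> C -> C) (v : nat -> R) (N : nat) : op :=
  fun f z => tapp d (fun i => nodes_list c v N (lens theta (z i))) f (fun _ => 0%C).

Lemma interp_op_holo d theta c v N f : 0 < theta < 1 -> interpolates v N c ->
  holomorphic_polydisk d (interp_op d theta c v N f).
Proof.
  intros Ht Hc. apply (holo_ext d (fun z => lin_comb (tensor_vals v N d f (fun _ => 0%C)) (tensor_funs theta c N d) z)).
  - intros z. unfold interp_op. now rewrite tapp_lin_comb.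
  - apply holo_lin_comb. intros g Hg. now apply (tensor_funs_bounded d theta c v N d Ht Hc (le_n d)).
Qed.

Lemma tapp_congr d Ls f g : (forall i, (i < d)%nat -> forall cp, In cp (Ls i) -> Cmod (snd cp) < 1) ->
  (forall z, in_polydisk d z -> f z = g z) ->
  forall k z, (k <= d)%nat -> in_polydisk d z -> tapp k Ls f z = tapp k Ls g z.
Proof.
  intros HL H. induction k; intros z Hk Hz; simpl; [now apply H|].
  apply fapp_ext. intros cp Hcp. apply IHk; [lia|]. apply polydisk_upd; [exact Hz|lia|]. now apply (HL k).
Qed.

Lemma zero_polydisk d : in_polydisk d (fun _ => 0%C).
Proof. split; intros; [rewrite Cmod_0; lra|reflexivity]. Qed.

Section UpperBound.

Context (d : nat) (theta A : R) (Ht : 0 < theta < 1) (HA : 0 < A).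
Let th := upper_exponent theta.

Context (HK : forall z, Cmod z < 1 -> / (1 - Cmod (lens theta z) ^ 2) <= A * KK th z).

Lemma th_range : 0 < th < 1.
Proof. unfold th, upper_exponent. lra. Qed.

Lemma rprod_scal (a : nat -> R) x k : rprod (fun i => x * a i) k = x ^ k * rprod a k.
Proof. induction k; simpl; [ring|]. rewrite IHk. ring. Qed.

Lemma polydisk_rprod_pos z : in_polydisk d z -> 0 < rprod (fun i => KK th (z i)) d.
Proof. intros Hz. apply rprod_pos. intros i Hi. apply KK_pos; [apply th_range|now apply Hz]. Qed.

(** Composition is the tensor product of plain evaluations at the image point, so its boundedness
    comes from the same functional estimate as the approximation error. *)
Lemma comp_pointwise : pointwise_bounded d th (comp_op (multi_lens d theta)) (A ^ d).
Proof.
  intros f Hf z Hz. unfold comp_op.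
  replace (f (multi_lens d theta z)) with (tapp d (fun i => delta_list (lens theta (z i))) f (fun _ => 0%C)).
  2:{ rewrite (tapp_delta d (fun i => lens theta (z i)) f). reflexivity. }
  rewrite <- rprod_scal. apply tapp_H2_bound; [exact Hf|]. intros i Hi.
  apply delta_bounded; [apply lens_disk; [now apply Hz|exact Ht]|]. apply HK. now apply Hz.
Qed.

Lemma comp_op_H2 f : H2 d f -> H2 d (comp_op (multi_lens d theta) f).
Proof.
  intros Hf. apply (pointwise_norm2 d th (comp_op (multi_lens d theta)) (A ^ d) f); auto.
  - apply th_range.
  - apply comp_pointwise.
  - apply (holo_comp_lens d theta f Ht), Hf.
Qed.

Lemma comp_op_linear : H2_linear_op d (comp_op (multi_lens d theta)).
Proof.
  split; [exact comp_op_H2|split].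
  - intros f g _ _ H z Hz. apply H. now apply multi_lens_polydisk.
  - reflexivity.
Qed.

Lemma comp_op_bounded : is_finite (op_norm d (comp_op (multi_lens d theta))).
Proof.
  apply (pointwise_op_norm d th _ (A ^ d)).
  - apply th_range.
  - left. now apply pow_lt.
  - apply comp_pointwise.
  - intros f Hf. apply (holo_comp_lens d theta f Ht), Hf.
Qed.

Context (v : nat -> R) (N : nat) (c : nat -> C -> C) (Hv : forall j, (j < N)%nat -> -1 < v j < 1)
  (Hc : interpolates v N c).

Lemma interp_pointwise : pointwise_bounded d th (interp_op d theta c v N) ((4 * A) ^ d).
Proof.
  intros f Hf z Hz. unfold interp_op. rewrite <- rprod_scal. apply tapp_H2_bound; [exact Hf|]. intros i Hi.
  assert (Hzi := proj1 Hz i Hi). assert (B := HK (z i) Hzi).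
  apply nodes_bounded; auto; [now apply lens_disk|]. lra.
Qed.

Lemma interp_op_linear : H2_linear_op d (interp_op d theta c v N).
Proof.
  split; [|split].
  - intros f Hf. apply (pointwise_norm2 d th (interp_op d theta c v N) ((4 * A) ^ d) f); auto.
    + apply th_range.
    + apply interp_pointwise.
    + now apply interp_op_holo.
  - intros f g _ _ H z Hz. apply (tapp_congr d); auto.
    + intros i Hi cp. now apply nodes_in.
    + apply zero_polydisk.
  - intros f g a b _ _ z _. apply tapp_linear.
Qed.

Lemma interp_op_bounded : is_finite (op_norm d (interp_op d theta c v N)).
Proof.
  apply (pointwise_op_norm d th _ ((4 * A) ^ d)).
  - apply th_range.
  - left. apply pow_lt. lra.
  - apply interp_pointwise.
  - intros f _. now apply interp_op_holo.
Qed.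

Lemma interp_op_rank n : (N ^ d < n)%nat -> rank_lt d (interp_op d theta c v N) n.
Proof.
  intros Hn. exists (tensor_funs theta c N d). split; [now rewrite tensor_funs_length|]. split.
  - now apply (tensor_funs_H2 d theta c v N).
  - intros f _. exists (tensor_vals v N d f (fun _ => 0%C)). intros z _. apply tapp_lin_comb.
Qed.

(** In each telescoping term one slot holds the error functional, with constant [A Q KK], and every
    other slot an evaluation or a node functional, with constant at most [4 A KK]. There are [d]
    terms, hence [d^2] after squaring. *)
Lemma difference_pointwise Q : 0 < Q <= 1 ->
  (forall z, Cmod z < 1 -> Cmod (blaschke v N (lens theta z)) ^ 2 * / (1 - Cmod (lens theta z) ^ 2) <= A * Q * KK th z) ->
  pointwise_bounded d th (op_sub (comp_op (multi_lens d theta)) (interp_op d theta c v N)) (INR d ^ 2 * (4 * A) ^ d * Q).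
Proof.
  intros HQ HB f Hf z Hz. unfold op_sub, comp_op.
  replace (f (multi_lens d theta z)) with (tapp d (fun i => delta_list (lens theta (z i))) f (fun _ => 0%C)).
  2:{ rewrite (tapp_delta d (fun i => lens theta (z i)) f). reflexivity. }
  unfold interp_op.
  assert (N0 := norm2_nonneg d f Hf). assert (P0 := polydisk_rprod_pos z Hz).
  set (Y := Q * (4 * A) ^ d * rprod (fun i => KK th (z i)) d * real (H2_norm2 d f)).
  assert (P4 : 0 < (4 * A) ^ d) by (apply pow_lt; lra).
  assert (HY : 0 <= Y).
  { unfold Y. apply Rmult_le_pos; [|exact N0]. apply Rmult_le_pos; [|lra]. nra. }
  assert (T := tapp_telescope d (fun i => nodes_list c v N (lens theta (z i))) (fun i => diff_list c v N (lens theta (z i)))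
     (fun i => delta_list (lens theta (z i))) f (fun _ => 0%C) (sqrt Y)).
  assert (T' := T (fun i g _ => fapp_diff_list c v N (lens theta (z i)) g)). clear T.
  assert (HX : forall i, (i < d)%nat -> Cmod (tapp d
     (fun j => if (j <? i)%nat then nodes_list c v N (lens theta (z j)) else
       if (j =? i)%nat then diff_list c v N (lens theta (z j)) else delta_list (lens theta (z j))) f (fun _ => 0%C)) <= sqrt Y).
  { intros i Hi. rewrite <- (sqrt_pow2 (Cmod _)) by apply Cmod_ge_0. apply sqrt_le_1_alt.
    eapply Rle_trans; [apply (tapp_H2_bound d _ (fun j => (if Nat.eqb j i then Q else 1) * ((4 * A) * KK th (z j)))); [exact Hf|]|].
    - intros j Hj. assert (Hzj := proj1 Hz j Hj). assert (B := HK (z j) Hzj).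
      assert (Kp := KK_pos th (z j) th_range Hzj). assert (L := lens_disk theta (z j) Hzj Ht).
      assert (AK : 0 < A * KK th (z j)) by nra.
      destruct (Nat.ltb_spec j i), (Nat.eqb_spec j i); try lia.
      + apply nodes_bounded; auto. lra.
      + apply diff_bounded; auto.
        * apply Rmult_lt_0_compat; lra.
        * eapply Rle_trans; [now apply HB|]. nra.
      + apply delta_bounded; [exact L|]. lra.
    - right. unfold Y.
      assert (Er : rprod (fun j => (if (j =? i)%nat then Q else 1) * (4 * A * KK th (z j))) d
        = Q * ((4 * A) ^ d * rprod (fun j => KK th (z j)) d)).
      { rewrite <- rprod_scal.
        rewrite (rprod_ext _ (fun j => if Nat.eqb j i then Q * (4 * A * KK th (z i)) else 4 * A * KK th (z j))).
        - rewrite (rprod_single (fun j => 4 * A * KK th (z j))) by exact Hi.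
          rewrite (rprod_ext (fun i0 => 4 * A * KK th (z i0)) (fun j => if Nat.eqb j i then 4 * A * KK th (z i) else 4 * A * KK th (z j))).
          + rewrite (rprod_single (fun j => 4 * A * KK th (z j)) d i (4 * A * KK th (z i))) by exact Hi. ring.
          + intros j _. destruct (Nat.eqb_spec j i); now subst.
        - intros j _. destruct (Nat.eqb_spec j i); subst; ring. }
      rewrite Er. ring. }
  specialize (T' HX).
  apply Rle_trans with ((INR d * sqrt Y) ^ 2).
  - apply pow_incr. split; [apply Cmod_ge_0|exact T'].
  - right. rewrite Rpow_mult_distr, pow2_sqrt by exact HY. unfold Y. ring.
Qed.

Lemma upper_bound Q n : 0 < Q <= 1 -> (N ^ d < n)%nat ->
  (forall z, Cmod z < 1 -> Cmod (blaschke v N (lens theta z)) ^ 2 * / (1 - Cmod (lens theta z) ^ 2) <= A * Q * KK th z) ->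
  Rbar_le (approx_num d (comp_op (multi_lens d theta)) n) (Finite (sqrt (INR d ^ 2 * (4 * A) ^ d * 2 ^ d) * sqrt Q)).
Proof.
  intros HQ Hn HB.
  assert (P4 : 0 < (4 * A) ^ d) by (apply pow_lt; lra).
  assert (Pd : 0 <= INR d ^ 2) by apply pow2_ge_0. assert (P2 : 0 < 2 ^ d) by (apply pow_lt; lra).
  assert (P5 : 0 <= INR d ^ 2 * (4 * A) ^ d) by nra.
  destruct (pointwise_op_norm d th (op_sub (comp_op (multi_lens d theta)) (interp_op d theta c v N))
    (INR d ^ 2 * (4 * A) ^ d * Q)) as [F1 F2].
  - apply th_range.
  - nra.
  - now apply difference_pointwise.
  - intros f Hf. unfold op_sub.
    apply (holo_ext d (fun z => 1 * comp_op (multi_lens d theta) f z + (-1) * interp_op d theta c v N f z)%C).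
    + intros z. ring.
    + apply holo_lin; [apply (holo_comp_lens d theta f Ht), Hf|now apply interp_op_holo].
  - rewrite <- sqrt_mult; [|nra|lra].
    replace (INR d ^ 2 * (4 * A) ^ d * 2 ^ d * Q) with (INR d ^ 2 * (4 * A) ^ d * Q * 2 ^ d) by ring.
    apply Rbar_le_trans with (Finite (real (op_norm d (op_sub (comp_op (multi_lens d theta)) (interp_op d theta c v N))))).
    + unfold approx_num. apply (Glb_Rbar_correct _). exists (interp_op d theta c v N).
      split; [apply interp_op_linear|]. split; [apply interp_op_bounded|]. split; [now apply interp_op_rank|].
      symmetry. exact F1.
    + exact F2.
Qed.

End UpperBound.

Theorem approx_num_upper d theta : (1 <= d)%nat -> 0 < theta < 1 -> exists Cst r, 0 < Cst /\ 0 < r < 1 /\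
  forall m n, ((4 * (m * m)) ^ d < n)%nat ->
    Rbar_le (approx_num d (comp_op (multi_lens d theta)) n) (Finite (Cst * r ^ m)).
Proof.
  intros Hd Ht. destruct (lens_blaschke_estimate theta Ht) as (A & q & HA & Hq & H).
  (* The estimates concern squared norms, so the rate is [sqrt q]. *)
  exists (sqrt (INR d ^ 2 * (4 * A) ^ d * 2 ^ d)), (sqrt q). split; [|split].
  - apply sqrt_lt_R0. repeat apply Rmult_lt_0_compat; try (apply pow_lt; lra); try lra.
    + apply lt_0_INR. lia.
    + apply lt_0_INR. lia.
  - split; [now apply sqrt_lt_R0|]. rewrite <- sqrt_1. apply sqrt_lt_1_alt. lra.
  - intros m n Hn.
    assert (Hv : forall j, (j < 4 * (m * m))%nat -> -1 < grid m j < 1) by (intros; apply real_node_bounds).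
    destruct (interpolation (grid m) (4 * (m * m)) Hv) as [c Hc].
    { intros i j Hij X. apply grid_inj in X; lia. }
    assert (Hqm : 0 < q ^ m <= 1).
    { split; [apply pow_lt; lra|]. rewrite <- (pow1 m). apply pow_incr. lra. }
    assert (U := upper_bound d theta A Ht HA (fun z Hz => proj1 (H z Hz)) (grid m) (4 * (m * m)) c Hv Hc (q ^ m) n Hqm Hn
      (fun z Hz => proj2 (H z Hz) m)).
    replace (sqrt (q ^ m)) with (sqrt q ^ m) in U; [exact U|].
    clear - Hq. induction m; simpl; [now rewrite sqrt_1|]. rewrite IHm, sqrt_mult; [reflexivity|lra|]. apply pow_le; lra.
Qed.

(** * The lower bound *)

Definition lsum (l : list nat) (F : nat -> C) : C := fold_right (fun j acc => F j + acc)%C 0%C l.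

Lemma lsum_app l1 l2 F : lsum (l1 ++ l2) F = (lsum l1 F + lsum l2 F)%C.
Proof. induction l1 as [|j l IH]; simpl; [ring|]. rewrite IH. ring. Qed.

Lemma lsum_ext l F G : (forall j, In j l -> F j = G j) -> lsum l F = lsum l G.
Proof.
  intros H. induction l as [|j l IH]; simpl; [reflexivity|].
  rewrite IH by (intros; apply H; now right). now rewrite H by now left.
Qed.

Lemma lsum_lin l F G k : lsum l (fun j => F j + k * G j)%C = (lsum l F + k * lsum l G)%C.
Proof. induction l as [|j l IH]; simpl; [ring|]. rewrite IH. ring. Qed.

Lemma lsum_single l (F : nat -> C) j0 : NoDup l -> In j0 l -> (forall j, In j l -> j <> j0 -> F j = 0%C) -> lsum l F = F j0.
Proof.
  induction l as [|j l IH]; intros Hn Hi HF; [destruct Hi|]. simpl. inversion_clear Hn as [|? ? Hj Hl].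
  destruct (Nat.eq_dec j j0) as [->|n].
  - rewrite (lsum_ext l F (fun _ => 0%C)).
    + replace (lsum l (fun _ => 0%C)) with (RtoC 0); [ring|]. clear. induction l; simpl; [reflexivity|]. rewrite <- IHl. ring.
    + intros i Hil. apply HF; [now right|]. intros ->. contradiction.
  - rewrite HF by (auto; now left). destruct Hi as [->|Hi]; [contradiction|].
    rewrite IH by (auto; intros; apply HF; auto; now right). ring.
Qed.

Lemma lsum_bound l F B : (forall j, In j l -> Cmod (F j) <= B) -> Cmod (lsum l F) <= INR (length l) * B.
Proof.
  induction l as [|j l IH]; intros H; [simpl; rewrite Cmod_0; lra|].
  cbn [lsum fold_right length]. rewrite S_INR. eapply Rle_trans; [apply Cmod_triangle|].
  assert (H1 := H j (or_introl eq_refl)). assert (H2 := IH (fun i Hi => H i (or_intror Hi))). unfold lsum in H2. lra.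
Qed.

Lemma lin_comb_add (l1 l2 : list C) (k : C) (gs : list ((nat -> C) -> C)) :
  exists l, forall z, lin_comb l gs z = (lin_comb l1 gs z + k * lin_comb l2 gs z)%C.
Proof.
  revert l1 l2. induction gs as [|g gs IH]; intros l1 l2.
  - exists nil. intros z. destruct l1, l2; simpl; ring.
  (* [lin_comb] stops at the shorter list, so missing coefficients are read as 0. *)
  - destruct (IH (tl l1) (tl l2)) as [l Hl]. exists ((hd (RtoC 0) l1 + k * hd (RtoC 0) l2)%C :: l). intros z. simpl. rewrite Hl.
    destruct l1 as [|c1 l1], l2 as [|c2 l2]; simpl; ring.
Qed.

Lemma lin_comb_cons (l : list C) g gs z :
  lin_comb l (g :: gs) z = (hd (RtoC 0) l * g z + lin_comb (tl l) gs z)%C.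
Proof. destruct l; simpl; ring. Qed.

(** Gaussian elimination by induction on [gs]: if some [h J0] has a nonzero coefficient on [g], it
    serves as the pivot that clears [g] from the others; otherwise [g] drops out. The predicate [P]
    is there because equalities are only known on the polydisk. *)
Lemma linear_dependence (P : (nat -> C) -> Prop) (gs : list ((nat -> C) -> C)) :
  forall (h : nat -> (nat -> C) -> C) (Js : list nat), NoDup Js -> (length gs < length Js)%nat ->
  (forall J, In J Js -> exists cs, forall z, P z -> h J z = lin_comb cs gs z) ->
  exists a : nat -> C, (exists J, In J Js /\ a J <> 0%C) /\ forall z, P z -> lsum Js (fun J => a J * h J z)%C = 0%C.
Proof.
  induction gs as [|g gs IH]; intros h Js Hn Hl Hs.
  - exists (fun _ => 1%C). split.
    + destruct Js as [|J Js]; [simpl in Hl; lia|]. exists J. split; [now left|]. intros X; apply RtoC_inj in X; lra.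
    + intros z Hz. rewrite (lsum_ext Js _ (fun _ => 0%C)).
      * clear. induction Js as [|J Js IH]; simpl; [reflexivity|]. rewrite IH. ring.
      * intros J HJ. destruct (Hs J HJ) as [cs Hcs]. rewrite Hcs by exact Hz. destruct cs; simpl; ring.
  - set (cs := fun J => epsilon (inhabits (@nil C)) (fun cs => forall z, P z -> h J z = lin_comb cs (g :: gs) z)).
    assert (Hcs : forall J, In J Js -> forall z, P z -> h J z = (hd (RtoC 0) (cs J) * g z + lin_comb (tl (cs J)) gs z)%C).
    { intros J HJ z Hz. rewrite <- lin_comb_cons.
      exact (epsilon_spec (inhabits (@nil C)) (fun cs => forall z, P z -> h J z = lin_comb cs (g :: gs) z) (Hs J HJ) z Hz). }
    set (c := fun J => hd (RtoC 0) (cs J)).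
    destruct (classic (exists J0, In J0 Js /\ c J0 <> 0%C)) as [[J0 [HJ0 Hc0]]|Hall].
    + apply in_split in HJ0. destruct HJ0 as [l1 [l2 ->]].
      assert (Hn' := NoDup_remove_1 _ _ _ Hn). assert (Hnot := NoDup_remove_2 _ _ _ Hn).
      assert (Hin : forall J, In J (l1 ++ l2) -> In J (l1 ++ J0 :: l2)).
      { intros J HJ. apply in_app_or in HJ. apply in_or_app. destruct HJ; [now left|right; now right]. }
      assert (Hin0 : In J0 (l1 ++ J0 :: l2)) by (apply in_or_app; right; now left).
      destruct (IH (fun J z => h J z + (- (c J / c J0)) * h J0 z)%C (l1 ++ l2) Hn') as [a [[J1 [HJ1 Ha1]] Ha]].
      * rewrite length_app in *. simpl in Hl. lia.
      * intros J HJ. destruct (lin_comb_add (tl (cs J)) (tl (cs J0)) (- (c J / c J0)) gs) as [l Hlc].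
        exists l. intros z Hz. rewrite Hlc, (Hcs J (Hin J HJ) z Hz), (Hcs J0 Hin0 z Hz). fold (c J) (c J0). field. exact Hc0.
      (* The relation among the reduced functions becomes one among the [h J] once the pivot
         receives the coefficient [- s]. *)
      * set (s := lsum (l1 ++ l2) (fun J => a J * (c J / c J0))%C).
        exists (fun J => if Nat.eqb J J0 then (- s)%C else a J). split.
        -- exists J1. split; [now apply Hin|]. destruct (Nat.eqb_spec J1 J0) as [->|]; [contradiction|exact Ha1].
        -- intros z Hz. specialize (Ha z Hz).
           assert (E : lsum (l1 ++ l2) (fun J => (if Nat.eqb J J0 then (- s)%C else a J) * h J z)%C
                     = lsum (l1 ++ l2) (fun J => a J * h J z)%C).
           { apply lsum_ext. intros J HJ. destruct (Nat.eqb_spec J J0) as [->|]; [contradiction|reflexivity]. }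
           rewrite lsum_app in E |- *. cbn [lsum fold_right]. rewrite Nat.eqb_refl.
           change (fold_right (fun j acc => (if Nat.eqb j J0 then (- s)%C else a j) * h j z + acc)%C 0%C l2)
             with (lsum l2 (fun J => (if Nat.eqb J J0 then (- s)%C else a J) * h J z)%C).
           rewrite (lsum_ext _ _ (fun J => a J * h J z + (- h J0 z) * (a J * (c J / c J0)))%C) in Ha.
           2:{ intros; unfold Cdiv; ring. }
           rewrite lsum_lin in Ha. fold s in Ha.
           match type of E with (?x + ?y)%C = _ => transitivity ((x + y) + - s * h J0 z)%C; [ring|] end.
           rewrite E. rewrite <- Ha. ring.
    + apply (IH h Js Hn); [simpl in Hl; lia|]. intros J HJ. exists (tl (cs J)). intros z Hz.
      rewrite (Hcs J HJ z Hz). fold (c J). destruct (Ceq_dec (c J) 0) as [E|n]; [rewrite E; ring|].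
      exfalso. apply Hall. now exists J.
Qed.

(* Multi-indices in [{0..N-1}^d] are encoded as the numbers [J < N^d], by their base-[N] digits. *)
Definition digit (N i J : nat) : nat := Nat.modulo (J / N ^ i) N.

Lemma digit_lt N i J : (0 < N)%nat -> (digit N i J < N)%nat.
Proof. intros H. apply Nat.mod_upper_bound. lia. Qed.

Lemma digits_inj N d : (0 < N)%nat -> forall J J', (J < N ^ d)%nat -> (J' < N ^ d)%nat ->
  (forall i, (i < d)%nat -> digit N i J = digit N i J') -> J = J'.
Proof.
  intros HN. induction d; intros J J' HJ HJ' H; [simpl in *; lia|].
  assert (H0 := H 0%nat ltac:(lia)). unfold digit in H0. rewrite Nat.pow_0_r, !Nat.div_1_r in H0.
  assert (Hq : (J / N = J' / N)%nat).
  { apply IHd.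
    - apply Nat.Div0.div_lt_upper_bound. simpl in HJ. exact HJ.
    - apply Nat.Div0.div_lt_upper_bound. simpl in HJ'. exact HJ'.
    - intros i Hi. specialize (H (S i) ltac:(lia)). unfold digit in *. simpl in H.
      now rewrite !Nat.Div0.div_div. }
  rewrite (Nat.div_mod_eq J N), (Nat.div_mod_eq J' N), Hq, H0. reflexivity.
Qed.

(* [sgap y] dominates [- ln (tanh (y / 2))] and has the explicit bounded primitive [Ggap]. *)
Definition sgap (y : R) : R := 2 / sqrt (exp (2 * y) - 1).

Definition Ggap (y : R) : R := 2 * atan (sqrt (exp (2 * y) - 1)).

(** The difference of the two sides vanishes at 1 and has derivative [(1 - 1 / s)^2]. *)
Lemma two_ln_le s : 1 <= s -> 2 * ln s <= s - / s.
Proof.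
  intros Hs. destruct (MVT_gen (fun s => s - / s - 2 * ln s) 1 s (fun s => (1 - / s) ^ 2)) as [c [Hc He]].
  - intros x Hx. rewrite Rmin_left in Hx by lra. auto_derive; [split; [lra|split; [lra|trivial]]|]. field. lra.
  - intros x Hx. rewrite Rmin_left in Hx by lra. apply continuity_pt_filterlim.
    change (continuous (fun s => s - / s - 2 * ln s) x). apply (ex_derive_continuous (V := R_NormedModule)).
    auto_derive. split; [lra|split; [lra|trivial]].
  - rewrite ln_1, Rinv_1 in He. assert (P : 0 <= (1 - / c) ^ 2) by apply pow2_ge_0. nra.
Qed.

(** [two_ln_le] at [s = sqrt ((e^y + 1) / (e^y - 1))], for which [s - 1 / s] is exactly [sgap y]. *)
Lemma inv_tanh_le y : 0 < y -> (exp y + 1) / (exp y - 1) <= exp (sgap y).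
Proof.
  intros Hy. assert (He : 1 < exp y) by (rewrite <- exp_0; now apply exp_increasing).
  set (a := sqrt (exp y + 1)). set (b := sqrt (exp y - 1)).
  assert (Ha : 0 < a) by (apply sqrt_lt_R0; lra). assert (Hb : 0 < b) by (apply sqrt_lt_R0; lra).
  assert (Ha2 : a * a = exp y + 1) by (apply sqrt_sqrt; lra).
  assert (Hb2 : b * b = exp y - 1) by (apply sqrt_sqrt; lra).
  assert (Hg : sgap y = a / b - / (a / b)).
  { unfold sgap. replace (exp (2 * y) - 1) with ((exp y + 1) * (exp y - 1)).
    - rewrite sqrt_mult by lra. fold a b.
      replace (a / b - / (a / b)) with ((a * a - b * b) / (a * b)) by (field; lra). rewrite Ha2, Hb2. field. lra.
    - replace (2 * y) with (y + y) by ring. rewrite exp_plus. ring. }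
  assert (Hs : 1 <= a / b).
  { apply Rmult_le_reg_r with b; [exact Hb|]. unfold Rdiv. rewrite Rmult_assoc, Rinv_l by lra. nra. }
  rewrite <- Ha2, <- Hb2, Hg. replace (a * a / (b * b)) with (exp (2 * ln (a / b))).
  - assert (H := two_ln_le _ Hs). destruct H as [H|H]; [left; now apply exp_increasing|right; now rewrite H].
  - replace (2 * ln (a / b)) with (ln (a / b) + ln (a / b)) by ring. rewrite exp_plus, exp_ln by lra. field. lra.
Qed.

(** [Ggap] has the decreasing derivative [sgap], so its mean slope is at least the slope at the
    right end. *)
Lemma Ggap_increment a b : 0 <= a < b -> sgap b * (b - a) <= Ggap b - Ggap a.
Proof.
  intros Hab.
  assert (Hpos : forall x, 0 < x -> 0 < exp (2 * x) - 1).
  { intros x Hx. assert (H := exp_increasing 0 (2 * x)). rewrite exp_0 in H. lra. }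
  (* At [a = 0] the square root has no derivative, but the mean value point ranges over the closed
     interval; the slope is given there the value that makes the claim trivial. *)
  destruct (MVT_gen Ggap a b (fun x => if Rle_dec x a then sgap b else sgap x)) as [c [Hc He]].
  - intros x Hx. rewrite Rmin_left, Rmax_right in Hx by lra. destruct (Rle_dec x a); [lra|].
    assert (Hx0 := Hpos x ltac:(lra)).
    unfold Ggap, sgap. auto_derive; [repeat split; lra|].
    assert (S0 : 0 < sqrt (exp (2 * x) - 1)) by now apply sqrt_lt_R0.
    assert (S2 : sqrt (exp (2 * x) - 1) * sqrt (exp (2 * x) - 1) = exp (2 * x) - 1) by (apply sqrt_sqrt; lra).
    unfold Rsqr. set (q := sqrt (exp (2 * x) - 1)) in *.
    assert (E1 : exp (2 * x) = q * q + 1) by lra. rewrite E1. unfold Rminus.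
    replace (q * q + 1 + - (1)) with (q * q) by ring. rewrite sqrt_square by lra.
    field. split; nra.
  - intros x Hx. rewrite Rmin_left, Rmax_right in Hx by lra. apply continuity_pt_filterlim.
    change (continuous (fun y => 2 * atan (sqrt (exp (2 * y) - 1))) x).
    apply (continuous_mult (K := R_AbsRing) (fun _ => 2) (fun y => atan (sqrt (exp (2 * y) - 1)))); [apply continuous_const|].
    apply (continuous_comp (fun y => sqrt (exp (2 * y) - 1)) atan).
    + apply (continuous_comp (fun y => exp (2 * y) - 1) sqrt).
      * apply (ex_derive_continuous (V := R_NormedModule)). auto_derive. trivial.
      * apply continuous_sqrt.
    + apply (ex_derive_continuous (V := R_NormedModule)). auto_derive. trivial.
  - rewrite Rmin_left, Rmax_right in Hc by lra. rewrite He. apply Rmult_le_compat_r; [lra|].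
    destruct (Rle_dec c a) as [|n]; [lra|]. apply Rnot_le_lt in n. unfold sgap.
    apply Rmult_le_compat_l; [lra|]. assert (P := Hpos c ltac:(lra)).
    apply Rinv_le_contravar; [now apply sqrt_lt_R0|]. apply sqrt_le_1_alt.
    destruct Hc as [_ [H|H]]; [|now rewrite H]. assert (H' := exp_increasing (2 * c) (2 * b)). lra.
Qed.

Lemma Ggap_0 : Ggap 0 = 0.
Proof. unfold Ggap. rewrite Rmult_0_r, exp_0, Rminus_diag, sqrt_0, atan_0. ring. Qed.

Lemma Ggap_le y : Ggap y <= PI.
Proof. unfold Ggap. assert (A := atan_bound (sqrt (exp (2 * y) - 1))). lra. Qed.

(** This is [1 / tanh (y / 2)], the reciprocal of the pseudo-hyperbolic distance between two points
    at hyperbolic distance [y]. *)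
Definition invtanh (y : R) : R := (exp y + 1) / (exp y - 1).

Lemma invtanh_step sigma k : 0 < sigma ->
  0 < invtanh (INR (S k) * sigma) <= exp ((Ggap (INR (S k) * sigma) - Ggap (INR k * sigma)) / sigma).
Proof.
  intros Hs. assert (Hk := pos_INR k). rewrite S_INR.
  assert (Hp : 0 < (INR k + 1) * sigma) by nra.
  split.
  - unfold invtanh. assert (H := exp_increasing 0 _ Hp). rewrite exp_0 in H. apply Rdiv_lt_0_compat; lra.
  - eapply Rle_trans; [now apply inv_tanh_le|].
    assert (H : sgap ((INR k + 1) * sigma) <= (Ggap ((INR k + 1) * sigma) - Ggap (INR k * sigma)) / sigma).
    { apply Rmult_le_reg_r with sigma; [exact Hs|]. unfold Rdiv. rewrite Rmult_assoc, Rinv_l by lra. rewrite Rmult_1_r.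
      eapply Rle_trans; [|apply (Ggap_increment (INR k * sigma) ((INR k + 1) * sigma)); split; nra]. right. ring. }
    destruct H as [H|H]; [left; now apply exp_increasing|right; now rewrite H].
Qed.

(** The increments of [Ggap] telescope on either side of [j], and each side adds at most
    [pi / sigma] to the logarithm because [Ggap <= pi]. The bound is independent of [N], so [p^2]
    nodes of mesh [theta / p] still have an interpolation constant [e^(O(p))]. *)
Lemma invtanh_product sigma j N : 0 < sigma ->
  rprod (fun k => if Nat.eqb k j then 1 else invtanh (INR (if Nat.ltb k j then j - k else k - j) * sigma)) N <= exp (2 * PI / sigma).
Proof.
  intros Hs. assert (Pi := PI_RGT_0).
  set (D := fun k => if Nat.eqb k j then 1 else invtanh (INR (if Nat.ltb k j then j - k else k - j) * sigma)).
  assert (HD : forall k, 0 < D k).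
  { intros k. unfold D. destruct (Nat.eqb_spec k j); [lra|].
    destruct (Nat.ltb_spec k j).
    - replace (j - k)%nat with (S (j - k - 1)) by lia. now apply invtanh_step.
    - replace (k - j)%nat with (S (k - j - 1)) by lia. now apply invtanh_step. }
  (* Up to [j] the distances shrink to 0, so the exponents telescope downwards from
     [Ggap (j sigma)]; beyond [j] they build up again from 0. *)
  assert (H : forall N, rprod D N <= exp ((if Nat.leb N j then Ggap (INR j * sigma) - Ggap (INR (j - N) * sigma)
     else Ggap (INR j * sigma) + Ggap (INR (N - 1 - j) * sigma)) / sigma)).
  { clear N. induction N.
    - simpl. rewrite Nat.sub_0_r, Rminus_diag. unfold Rdiv. rewrite Rmult_0_l, exp_0. lra.
    - assert (HP : 0 < rprod D N) by now apply rprod_pos. simpl rprod.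
      assert (HDN := HD N). unfold D at 1 in HDN. unfold D at 1.
      destruct (Nat.leb_spec (S N) j), (Nat.leb_spec N j); try lia.
      + destruct (Nat.eqb_spec N j); [lia|]. destruct (Nat.ltb_spec N j); [|lia].
        assert (S1 := invtanh_step sigma (j - S N) Hs). replace (S (j - S N)) with (j - N)%nat in S1 by lia.
        eapply Rle_trans; [apply Rmult_le_compat; [lra|lra|apply S1|exact IHN]|].
        rewrite <- exp_plus. right. f_equal. field. lra.
      + assert (N = j) by lia. subst N. rewrite Nat.eqb_refl, Rmult_1_l.
        replace (S j - 1 - j)%nat with 0%nat by lia. replace (j - j)%nat with 0%nat in IHN by lia.
        simpl (INR 0) in *. rewrite Rmult_0_l, Ggap_0 in *. rewrite Rplus_0_r. rewrite Rminus_0_r in IHN. exact IHN.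
      + destruct (Nat.eqb_spec N j); [lia|]. destruct (Nat.ltb_spec N j); [lia|].
        assert (S1 := invtanh_step sigma (N - 1 - j) Hs). replace (S (N - 1 - j)) with (N - j)%nat in S1 by lia.
        eapply Rle_trans; [apply Rmult_le_compat; [lra|lra|apply S1|exact IHN]|].
        replace (S N - 1 - j)%nat with (N - j)%nat by lia.
        rewrite <- exp_plus. right. f_equal. field. lra. }
  eapply Rle_trans; [apply H|].
  assert (G0 : forall k, 0 <= Ggap (INR k * sigma)).
  { intros k. unfold Ggap. assert (A := sqrt_pos (exp (2 * (INR k * sigma)) - 1)).
    assert (B : 0 <= atan (sqrt (exp (2 * (INR k * sigma)) - 1))); [|lra].
    destruct A as [A|A]; [left; rewrite <- atan_0; now apply atan_increasing|rewrite <- A, atan_0; lra]. }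
  assert (Hle : (if Nat.leb N j then Ggap (INR j * sigma) - Ggap (INR (j - N) * sigma)
     else Ggap (INR j * sigma) + Ggap (INR (N - 1 - j) * sigma)) / sigma <= 2 * PI / sigma).
  { apply Rmult_le_compat_r; [left; now apply Rinv_0_lt_compat|].
    assert (A1 := Ggap_le (INR j * sigma)). assert (A2 := Ggap_le (INR (N - 1 - j) * sigma)).
    assert (A3 := G0 (j - N)%nat). destruct (Nat.leb N j); lra. }
  destruct Hle as [Hle|Hle]; [left; now apply exp_increasing|right; now rewrite Hle].
Qed.

Lemma beta_real_nodes a b : a <> b -> / Cmod (beta (real_node a) (RtoC (real_node b))) = invtanh (Rabs (a - b)).
Proof.
  intros Hab. assert (Pa := exp_pos a). assert (Pb := exp_pos b).
  assert (Hne : exp a <> exp b) by (intros X; apply exp_inv in X; contradiction).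
  assert (Hb : beta (real_node a) (RtoC (real_node b)) = RtoC ((exp a - exp b) / (exp a + exp b))).
  { unfold beta. rewrite <- RtoC_mult, <- !RtoC_minus.
    assert (D : 1 - real_node a * real_node b <> 0).
    { assert (B1 := real_node_bounds a). assert (B2 := real_node_bounds b). nra. }
    rewrite <- RtoC_div by exact D. f_equal. unfold real_node in *. field. repeat split; try lra. }
  rewrite Hb, Cmod_R. unfold invtanh.
  unfold Rdiv at 1. rewrite Rabs_mult, (Rabs_pos_eq (/ (exp a + exp b))) by (left; apply Rinv_0_lt_compat; lra).
  destruct (Rtotal_order a b) as [H|[H|H]]; [|contradiction|].
  - assert (Hlt := exp_increasing _ _ H). rewrite (Rabs_left (exp a - exp b)), (Rabs_left (a - b)) by lra.
    replace (- (a - b)) with (b + - a) by ring. rewrite exp_plus, exp_Ropp. field. repeat split; lra.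
  - assert (Hlt := exp_increasing _ _ H). rewrite (Rabs_pos_eq (exp a - exp b)), (Rabs_pos_eq (a - b)) by lra.
    replace (a - b) with (a + - b) by ring. rewrite exp_plus, exp_Ropp. field. repeat split; lra.
Qed.

(* The Blaschke analogue of the Lagrange basis polynomials. *)
Fixpoint lagr (v : nat -> R) (N j : nat) (w : C) : C :=
  match N with
  | O => 1%C
  | S k => ((if Nat.eqb k j then 1%C else beta (v k) w / beta (v k) (v j)) * lagr v k j w)%C
  end.

(** * Test points, dual functions and the dimension count *)

Section LowerBound.

Context (d : nat) (theta : R) (p : nat) (Ht : 0 < theta < 1) (Hp : (1 <= p)%nat).

Let N := (p * p)%nat.
Let sigma := theta / INR p.
Let v (j : nat) := real_node (INR j * sigma).
Let u (j : nat) := real_node (INR j / INR p).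

Lemma p_pos : 1 <= INR p.
Proof. apply le_INR in Hp. exact Hp. Qed.

Lemma sigma_pos : 0 < sigma.
Proof. assert (H := p_pos). apply Rdiv_lt_0_compat; lra. Qed.

(** At [real_node x] the function [lg] takes the value [x], so on the real axis the lens map is
    multiplication by [theta] in the hyperbolic coordinate and the mesh [1 / p] becomes [sigma]. *)
Lemma lens_u j : lens theta (u j) = RtoC (v j).
Proof.
  assert (Hp' := p_pos). assert (B := real_node_bounds (INR j / INR p)).
  assert (Hu : Cmod (u j) < 1) by now apply real_disk.
  rewrite lens_cay by assumption. unfold v. rewrite real_node_cay. f_equal.
  unfold W. assert (Hl : lg (u j) = RtoC (INR j / INR p)).
  { unfold lg. rewrite !Clog_right by (simpl; fold (u j) in B; lra).
    assert (P := exp_pos (INR j / INR p)). set (x := INR j / INR p) in *.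
    replace (1 - u j)%C with (RtoC (1 - u j)) by (now rewrite RtoC_minus).
    replace (1 + u j)%C with (RtoC (1 + u j)) by (now rewrite RtoC_plus).
    rewrite !Cmod_R. unfold RtoC; cbn [fst snd]. unfold Rdiv. rewrite !Rmult_0_l, atan_0.
    unfold Cminus, Cplus, Copp; cbn [fst snd]. f_equal; [|ring].
    unfold u. fold x. rewrite !Rabs_pos_eq by (fold (u j) in B; lra).
    fold (ln (1 - real_node x) - ln (1 + real_node x)). rewrite <- ln_div by lra.
    rewrite <- (ln_exp x) at 3. f_equal. unfold real_node. field. split; lra. }
  rewrite Hl, <- RtoC_mult. unfold Cexp, Re, Im, RtoC; cbn [fst snd]. rewrite cos_0, sin_0. f_equal; [|ring].
  rewrite Rmult_1_r. f_equal. unfold sigma. field. lra.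
Qed.

Lemma v_bounds j : -1 < v j < 1.
Proof. apply real_node_bounds. Qed.

Lemma v_neq i j : i <> j -> INR i * sigma <> INR j * sigma.
Proof. intros H X. apply Rmult_eq_reg_r in X; [|assert (S := sigma_pos); lra]. now apply INR_eq in X. Qed.

Lemma Cmod_beta_pos i j : i <> j -> 0 < Cmod (beta (v i) (v j)).
Proof.
  intros H. apply Cmod_gt_0. unfold beta.
  assert (D := kernel_denom_neq_0 (v i) (v j) (real_disk _ (v_bounds i)) ltac:(left; apply real_disk, v_bounds)).
  intros X. apply (f_equal (fun z => z * (1 - v i * v j))%C) in X. cbv beta in X. unfold Cdiv in X.
  rewrite <- Cmult_assoc, Cinv_l, Cmult_1_r, Cmult_0_l in X by exact D. rewrite <- RtoC_minus in X.
  apply RtoC_inj in X. apply (v_neq i j H). symmetry. apply real_node_inj. fold (v i) (v j). lra.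
Qed.

Lemma lagr_self K j : lagr v K j (v j) = 1%C.
Proof.
  induction K; simpl; [reflexivity|]. rewrite IHK. destruct (Nat.eqb_spec K j); [ring|].
  field. apply Cmod_gt_0. now apply Cmod_beta_pos.
Qed.

Lemma lagr_other K i j : (i < K)%nat -> i <> j -> lagr v K j (v i) = 0%C.
Proof.
  intros Hi Hij. induction K; [lia|]. simpl. destruct (Nat.eq_dec i K) as [->|n].
  - destruct (Nat.eqb_spec K j); [contradiction|]. unfold beta at 1.
    replace (v K - v K)%C with (RtoC 0) by ring. unfold Cdiv. ring.
  - rewrite IHK by lia. ring.
Qed.

Lemma lagr_diff K j w : Cmod w < 1 -> Cdiff (lagr v K j) w.
Proof.
  intros Hw. induction K; simpl; [apply Cdiff_const|]. apply Cdiff_mult; [|exact IHK].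
  destruct (Nat.eqb_spec K j); [apply Cdiff_const|]. apply Cdiff_div.
  - apply Cdiff_beta; [apply v_bounds|lra].
  - apply Cdiff_const.
  - apply Cmod_gt_0. now apply Cmod_beta_pos.
Qed.

(** The numerators are at most 1 in modulus on the disk, so only the denominators count; their
    reciprocals are the factors in [invtanh_product]. *)
Lemma lagr_bound K j w : Cmod w < 1 -> Cmod (lagr v K j w) <= exp (2 * PI / sigma).
Proof.
  intros Hw. eapply Rle_trans; [|apply (invtanh_product sigma j K sigma_pos)].
  induction K; simpl; [rewrite Cmod_1; lra|]. rewrite Cmod_mult.
  apply Rmult_le_compat; auto using Cmod_ge_0.
  destruct (Nat.eqb_spec K j) as [|n]; [rewrite Cmod_1; lra|].
  assert (B := Cmod_beta_pos K j n). rewrite Cmod_div by now apply Cmod_gt_0.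
  replace (invtanh (INR (if Nat.ltb K j then j - K else K - j) * sigma)) with (/ Cmod (beta (v K) (v j))).
  - rewrite <- (Rmult_1_l (/ Cmod (beta (v K) (v j)))). apply Rmult_le_compat_r; [left; now apply Rinv_0_lt_compat|].
    apply beta_le_1; [apply v_bounds|lra].
  - unfold v. rewrite beta_real_nodes by now apply v_neq. f_equal.
    replace (INR K * sigma - INR j * sigma) with ((INR K - INR j) * sigma) by ring.
    assert (S := sigma_pos). rewrite Rabs_mult, (Rabs_pos_eq sigma) by lra. f_equal.
    destruct (Nat.ltb_spec K j) as [H|H].
    + rewrite minus_INR by lia. apply lt_INR in H. rewrite Rabs_left by lra. ring.
    + rewrite minus_INR by lia. apply le_INR in H. rewrite Rabs_pos_eq by lra. ring.
Qed.

Fixpoint cprod (a : nat -> C) (k : nat) : C := match k with O => 1%C | S k => (a k * cprod a k)%C end.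

Definition Ffun (J : nat) (z : nat -> C) : C := cprod (fun i => lagr v N (digit N i J) (z i)) d.

Definition upt (J : nat) : nat -> C := fun i => if Nat.ltb i d then RtoC (u (digit N i J)) else 0%C.

Lemma N_pos : (0 < N)%nat.
Proof. unfold N. nia. Qed.

Lemma cprod_1 (a : nat -> C) k : (forall i, (i < k)%nat -> a i = 1%C) -> cprod a k = 1%C.
Proof. induction k; intros H; simpl; [reflexivity|]. rewrite H, IHk by auto with arith. ring. Qed.

Lemma cprod_0 (a : nat -> C) k i : (i < k)%nat -> a i = 0%C -> cprod a k = 0%C.
Proof.
  induction k; intros Hi H; [lia|]. simpl. destruct (Nat.eq_dec i k) as [->|n]; [rewrite H; ring|].
  rewrite IHk by (auto; lia). ring.
Qed.

(** Distinct multi-indices differ in some digit, and the Lagrange factor of that coordinate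
    vanishes. *)
Lemma Ffun_upt J J' : (J < N ^ d)%nat -> (J' < N ^ d)%nat ->
  Ffun J (multi_lens d theta (upt J')) = if Nat.eqb J J' then 1%C else 0%C.
Proof.
  intros HJ HJ'. unfold Ffun.
  assert (Hz : forall i, (i < d)%nat -> multi_lens d theta (upt J') i = RtoC (v (digit N i J'))).
  { intros i Hi. unfold multi_lens, upt. apply Nat.ltb_lt in Hi. rewrite Hi. apply lens_u. }
  destruct (Nat.eqb_spec J J') as [->|n].
  - apply cprod_1. intros i Hi. rewrite Hz by exact Hi. apply lagr_self.
  - destruct (classic (exists i, (i < d)%nat /\ digit N i J <> digit N i J')) as [[i [Hi Hd]]|H].
    + apply (cprod_0 _ d i Hi). rewrite Hz by exact Hi. apply lagr_other; [apply digit_lt, N_pos|auto].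
    + exfalso. apply n. apply (digits_inj N d N_pos J J' HJ HJ'). intros i Hi.
      destruct (Nat.eq_dec (digit N i J) (digit N i J')); [assumption|]. exfalso. apply H. now exists i.
Qed.

Let B := exp (2 * PI / sigma).

Lemma Ffun_holo J : holomorphic_polydisk d (Ffun J).
Proof.
  unfold Ffun. assert (H : forall k, (k <= d)%nat -> holomorphic_polydisk d (fun z => cprod (fun i => lagr v N (digit N i J) (z i)) k)).
  { induction k; intros Hk; simpl; [apply holo_const|]. apply holo_mult; [|apply IHk; lia].
    apply (holo_coord d k (lagr v N (digit N k J))); [lia|]. intros w Hw. now apply lagr_diff. }
  now apply H.
Qed.

Lemma Ffun_bound J z : in_polydisk d z -> Cmod (Ffun J z) <= B ^ d.
Proof.
  intros Hz. unfold Ffun. assert (H : forall k, (k <= d)%nat -> Cmod (cprod (fun i => lagr v N (digit N i J) (z i)) k) <= B ^ k).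
  { induction k; intros Hk; simpl; [rewrite Cmod_1; lra|]. rewrite Cmod_mult.
    apply Rmult_le_compat; auto using Cmod_ge_0; [|apply IHk; lia]. apply lagr_bound. apply (proj1 Hz). lia. }
  now apply H.
Qed.

Lemma Ffun_H2 J : H2 d (Ffun J).
Proof. exact (proj1 (bounded_H2 d _ _ (Ffun_holo J) (Ffun_bound J))). Qed.

(** A crude bound by the supremum. It loses the number of terms, which for the full grid is [p^(2d)]
    and negligible against [e^(O(p))]. *)
Lemma comb_H2 (a : nat -> C) l M : 0 <= M -> (forall J, In J l -> Cmod (a J) <= M) ->
  H2 d (fun z => lsum l (fun J => a J * Ffun J z)%C) /\
  real (H2_norm2 d (fun z => lsum l (fun J => a J * Ffun J z)%C)) <= (INR (length l) * (M * B ^ d)) ^ 2.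
Proof.
  intros HM Ha. apply bounded_H2.
  - clear Ha. induction l as [|J l IH]; simpl; [apply holo_const|].
    apply holo_plus; [|exact IH]. apply holo_mult; [apply holo_const|apply Ffun_holo].
  - intros z Hz. apply lsum_bound. intros J HJ. rewrite Cmod_mult.
    apply Rmult_le_compat; auto using Cmod_ge_0. now apply Ffun_bound.
Qed.

Lemma finite_max (a : nat -> C) (l : list nat) : exists M, 0 <= M /\ forall J, In J l -> Cmod (a J) <= M.
Proof.
  induction l as [|J l [M [HM H]]]; [exists 0; split; [lra|intros J []]|].
  exists (Rmax (Cmod (a J)) M). split; [eapply Rle_trans; [exact HM|apply Rmax_r]|].
  intros J' [<-|HJ]; [apply Rmax_l|]. eapply Rle_trans; [now apply H|apply Rmax_r].
Qed.

Lemma argmax (a : nat -> C) (l : list nat) : l <> nil -> exists J0, In J0 l /\ forall J, In J l -> Cmod (a J) <= Cmod (a J0).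
Proof.
  induction l as [|J l IH]; intros H; [contradiction|]. destruct l as [|J1 l].
  - exists J. split; [now left|]. intros J' [<-|[]]. lra.
  - destruct IH as [J0 [HJ0 HM]]; [discriminate|].
    destruct (Rle_dec (Cmod (a J)) (Cmod (a J0))) as [Hle|Hgt].
    + exists J0. split; [now right|]. intros J' [<-|HJ]; auto.
    + apply Rnot_le_lt in Hgt. exists J. split; [now left|]. intros J' [<-|HJ]; [lra|]. specialize (HM J' HJ). lra.
Qed.

Lemma linear_op_comb (T : op) (a : nat -> C) l z : H2_linear_op d T -> in_polydisk d z ->
  T (fun w => lsum l (fun J => a J * Ffun J w)%C) z = lsum l (fun J => a J * T (Ffun J) z)%C.
Proof.
  intros (_ & _ & HT) Hz. induction l as [|J l IH].
  (* The empty sum: [T 0 = 0] is read off from linearity with both coefficients 0. *)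
  - assert (H := HT (fun _ => 0%C) (fun _ => 0%C) 0%C 0%C (proj1 (H2_zero d)) (proj1 (H2_zero d)) z Hz).
    cbn [lsum fold_right].
    replace (fun _ : nat -> C => RtoC 0) with (fun _ : nat -> C => (0 * 0 + 0 * 0)%C).
    + rewrite H. ring.
    + apply functional_extensionality. intros w. ring.
  - destruct (finite_max a l) as [M [HM HMb]].
    assert (H := HT (Ffun J) (fun w => lsum l (fun J => a J * Ffun J w)%C) (a J) 1%C (Ffun_H2 J)
      (proj1 (comb_H2 a l M HM HMb)) z Hz).
    cbn [lsum fold_right].
    replace (fun w : nat -> C => (a J * Ffun J w + fold_right (fun j acc => a j * Ffun j w + acc) 0 l)%C)
      with (fun w => (a J * Ffun J w + 1 * lsum l (fun J => a J * Ffun J w))%C).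
    + rewrite H, IH. unfold lsum. ring.
    + apply functional_extensionality. intros w. unfold lsum. ring.
Qed.

Lemma H2_norm2_congr f g : (forall z, in_polydisk d z -> f z = g z) -> H2_norm2 d f = H2_norm2 d g.
Proof.
  intros H. apply Lub_Rbar_eqset. intros x.
  assert (Hm : forall r, 0 < r < 1 -> torus_mean2 d f r = torus_mean2 d g r).
  { intros r Hr. unfold torus_mean2. f_equal. apply functional_extensionality. intros t.
    rewrite H; [reflexivity|]. now apply torus_pt_polydisk. }
  split; intros [r [Hr ->]]; exists r; (split; [exact Hr|]); [|symmetry]; now apply Hm.
Qed.

(** The left side is [cosh (x / 2)^2], which is at most [e^x] for [x >= 0], and the grid ends before
    [x = p]. *)
Lemma u_kappa j : (j < N)%nat -> / (1 - Cmod (u j) ^ 2) <= exp (INR p).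
Proof.
  intros Hj. unfold u. set (x := INR j / INR p). assert (Hp' := p_pos).
  assert (Hx : 0 <= x <= INR p).
  { assert (H := pos_INR j). split; [apply Rdiv_le_0_compat; lra|].
    apply lt_INR in Hj. unfold N in Hj. rewrite mult_INR in Hj. unfold x.
    apply Rmult_le_reg_r with (INR p); [lra|]. unfold Rdiv. rewrite Rmult_assoc, Rinv_l by lra. lra. }
  assert (P := exp_pos x). assert (P1 : 1 <= exp x) by (assert (A := exp_ineq1_le x); lra).
  assert (Hle : exp x <= exp (INR p)).
  { destruct (Req_dec x (INR p)) as [->|n]; [lra|]. left. apply exp_increasing. lra. }
  rewrite Cmod_R, pow2_abs.
  assert (E : / (1 - real_node x ^ 2) = (1 + exp x) ^ 2 / (4 * exp x)) by (unfold real_node; field; repeat split; lra).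
  rewrite E. apply Rle_trans with (exp x); [|exact Hle].
  apply Rmult_le_reg_r with (4 * exp x); [lra|]. unfold Rdiv. rewrite Rmult_assoc, Rinv_l by lra. nra.
Qed.

Lemma point_eval_bound h J : H2 d h -> Cmod (h (upt J)) ^ 2 <= exp (INR p) ^ d * real (H2_norm2 d h).
Proof.
  intros Hh.
  replace (h (upt J)) with (tapp d (fun i => delta_list (RtoC (u (digit N i J)))) h (fun _ => 0%C)).
  2:{ rewrite (tapp_delta d (fun i => RtoC (u (digit N i J))) h). reflexivity. }
  replace (exp (INR p) ^ d) with (rprod (fun _ => exp (INR p)) d) by (clear; induction d; simpl; congruence).
  apply tapp_H2_bound; [exact Hh|]. intros i _. apply delta_bounded.
  - apply real_disk, real_node_bounds.
  - apply u_kappa. apply digit_lt, N_pos.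
Qed.

Lemma lower_bound n : (n <= N ^ d)%nat ->
  (forall f, H2 d f -> H2 d (comp_op (multi_lens d theta) f)) ->
  Rbar_le (Finite (/ (INR (N ^ d) * B ^ d * sqrt (exp (INR p) ^ d)))) (approx_num d (comp_op (multi_lens d theta)) n).
Proof.
  intros Hn HC. apply (proj2 (Glb_Rbar_correct _)).
  intros x (T & HT & _ & (gs & Hgl & Hg & Hgs) & Hx). simpl.
  set (Js := seq 0 (N ^ d)).
  destruct (linear_dependence (in_polydisk d) gs (fun J => T (Ffun J)) Js) as [a [[J1 [HJ1 Ha1]] Ha]].
  - apply seq_NoDup.
  - unfold Js. rewrite length_seq. lia.
  - intros J _. apply Hgs, Ffun_H2.
  - destruct (argmax a Js) as [J0 [HJ0 HM]]; [intros X; rewrite X in HJ1; destruct HJ1|].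
    assert (Hal : 0 < Cmod (a J0)).
    { eapply Rlt_le_trans; [apply Cmod_gt_0, Ha1|now apply HM]. }
    set (al := Cmod (a J0)) in *.
    assert (HNd : 0 < INR (N ^ d)).
    { apply lt_0_INR. assert (P := N_pos). assert (P2 := Nat.pow_nonzero N d). lia. }
    assert (HB : 0 < B ^ d) by (apply pow_lt, exp_pos).
    (* After scaling by [s] the largest coefficient is [1 / (N^d B^d)], the size for which [comb_H2]
       gives norm at most 1. *)
    set (s := / (INR (N ^ d) * B ^ d * al)).
    assert (HD : 0 < INR (N ^ d) * B ^ d * al) by (repeat apply Rmult_lt_0_compat; assumption).
    assert (Hs : 0 < s) by now apply Rinv_0_lt_compat.
    set (a' := fun J => (RtoC s * a J)%C).
    assert (Hs0 : s * al = / (INR (N ^ d) * B ^ d)) by (unfold s; field; repeat split; lra).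
    assert (HM' : forall J, In J Js -> Cmod (a' J) <= / (INR (N ^ d) * B ^ d)).
    { intros J HJ. unfold a'. rewrite Cmod_mult, Cmod_R, Rabs_pos_eq by lra. rewrite <- Hs0.
      apply Rmult_le_compat_l; [lra|now apply HM]. }
    set (f := fun z => lsum Js (fun J => a' J * Ffun J z)%C).
    destruct (comb_H2 a' Js (/ (INR (N ^ d) * B ^ d))) as [Hf Hfn]; [left; apply Rinv_0_lt_compat; nra|exact HM'|].
    fold f in Hf, Hfn.
    assert (Hf1 : H2_norm d f <= 1).
    { unfold H2_norm. rewrite <- sqrt_1. apply sqrt_le_1_alt. eapply Rle_trans; [exact Hfn|].
      unfold Js. rewrite length_seq.
      replace (INR (N ^ d) * (/ (INR (N ^ d) * B ^ d) * B ^ d)) with 1 by (field; lra). lra. }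
    assert (HTf : forall z, in_polydisk d z -> T f z = 0%C).
    { intros z Hz. unfold f. rewrite linear_op_comb by assumption.
      rewrite (lsum_ext _ _ (fun J => 0 + RtoC s * (a J * T (Ffun J) z))%C) by (intros; unfold a'; ring).
      rewrite (lsum_lin Js (fun _ => 0%C)), Ha by exact Hz.
      replace (lsum Js (fun _ => 0%C)) with (RtoC 0); [ring|].
      generalize Js. clear. induction Js as [|J l IH]; simpl; [reflexivity|]. rewrite <- IH. ring. }
    assert (Hh := HC f Hf). set (h := comp_op (multi_lens d theta) f) in *.
    (* As [T f = 0], subtracting [T] leaves the image of [f] unchanged, whatever the operator [T] of
       this rank. *)
    assert (Hn2 : H2_norm2 d (op_sub (comp_op (multi_lens d theta)) T f) = H2_norm2 d h).
    { apply H2_norm2_congr. intros z Hz. unfold op_sub. rewrite HTf by exact Hz. fold h. ring. }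
    assert (Hxle : H2_norm d h <= x).
    { assert (L := proj1 (Lub_Rbar_correct (fun x => exists f, H2 d f /\ H2_norm d f <= 1 /\ x = H2_norm d (op_sub (comp_op (multi_lens d theta)) T f)))).
      fold (op_norm d (op_sub (comp_op (multi_lens d theta)) T)) in L. rewrite Hx in L.
      apply (L (H2_norm d h)). exists f. split; [exact Hf|]. split; [exact Hf1|].
      unfold H2_norm. now rewrite Hn2. }
    assert (HJ0' : (J0 < N ^ d)%nat) by (apply in_seq in HJ0; lia).
    assert (Hval : h (upt J0) = a' J0).
    { unfold h, comp_op, f. rewrite (lsum_single Js _ J0).
      - rewrite Ffun_upt, Nat.eqb_refl by assumption. ring.
      - apply seq_NoDup.
      - exact HJ0.
      - intros J HJ HJn. apply in_seq in HJ. rewrite Ffun_upt by lia.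
        destruct (Nat.eqb_spec J J0); [contradiction|]. ring. }
    assert (Pe := point_eval_bound h J0 Hh). rewrite Hval in Pe.
    assert (Hv0 : Cmod (a' J0) = / (INR (N ^ d) * B ^ d)).
    { unfold a'. rewrite Cmod_mult, Cmod_R, Rabs_pos_eq by lra. fold al. exact Hs0. }
    rewrite Hv0 in Pe.
    set (Ep := exp (INR p) ^ d) in *. assert (HEp : 0 < Ep) by (apply pow_lt, exp_pos).
    eapply Rle_trans; [|exact Hxle]. unfold H2_norm.
    assert (HNB : 0 < INR (N ^ d) * B ^ d) by nra.
    assert (HsE : 0 < sqrt Ep) by now apply sqrt_lt_R0.
    rewrite Rinv_mult. rewrite <- (sqrt_pow2 (/ (INR (N ^ d) * B ^ d))) by (left; now apply Rinv_0_lt_compat).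
    apply Rmult_le_reg_r with (sqrt Ep); [exact HsE|]. rewrite Rmult_assoc, Rinv_l, Rmult_1_r by lra.
    rewrite <- sqrt_mult; [|now apply norm2_nonneg|lra]. apply sqrt_le_1_alt. lra.
Qed.

(** Per variable, the exponent collects 2 from [p^2 <= e^(2 p)] for the number of terms,
    [2 pi / theta] from the interpolation constant [e^(2 pi / sigma)], and 1 from the point
    evaluation. *)
Lemma lower_bound_exp n : (n <= (p * p) ^ d)%nat ->
  (forall f, H2 d f -> H2 d (comp_op (multi_lens d theta) f)) ->
  Rbar_le (Finite (exp (- (INR d * (3 + 2 * PI / theta)) * INR p))) (approx_num d (comp_op (multi_lens d theta)) n).
Proof.
  intros Hn HC. eapply Rbar_le_trans; [|exact (lower_bound n Hn HC)]. simpl.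
  assert (Hp' := p_pos). assert (Hpi := PI_RGT_0).
  assert (PX : forall x k, exp x ^ k = exp (INR k * x)).
  { intros x k. rewrite <- Rpower_pow by apply exp_pos. unfold Rpower. now rewrite ln_exp. }
  assert (H1 : INR (N ^ d) <= exp (INR d * (2 * INR p))).
  { rewrite pow_INR, <- PX. apply pow_incr. split; [apply pos_INR|]. unfold N. rewrite mult_INR.
    replace (2 * INR p) with (INR p + INR p) by ring. rewrite exp_plus.
    assert (A := exp_ineq1_le (INR p)). apply Rmult_le_compat; lra. }
  assert (H2 : B ^ d = exp (INR d * (2 * PI / theta * INR p))).
  { unfold B. rewrite PX. f_equal. unfold sigma. field. lra. }
  assert (H3 : sqrt (exp (INR p) ^ d) <= exp (INR d * INR p)).
  { rewrite PX. set (e := exp (INR d * INR p)).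
    assert (A : 1 <= e).
    { assert (A := exp_ineq1_le (INR d * INR p)). fold e in A. assert (A2 := pos_INR d).
      assert (0 <= INR d * INR p) by (apply Rmult_le_pos; lra). lra. }
    apply Rle_trans with (sqrt (e ^ 2)); [apply sqrt_le_1_alt; nra|right; apply sqrt_pow2; lra]. }
  assert (HNd : 0 < INR (N ^ d)).
  { apply lt_0_INR. assert (P := N_pos). assert (P2 := Nat.pow_nonzero N d). lia. }
  replace (- (INR d * (3 + 2 * PI / theta)) * INR p)
    with (- (INR d * (2 * INR p) + INR d * (2 * PI / theta * INR p) + INR d * INR p)) by ring.
  rewrite exp_Ropp, !exp_plus, <- H2.
  assert (HB : 0 < B ^ d) by (apply pow_lt, exp_pos).
  assert (HE : 0 < sqrt (exp (INR p) ^ d)) by (apply sqrt_lt_R0, pow_lt, exp_pos).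
  apply Rinv_le_contravar.
  - repeat apply Rmult_lt_0_compat; assumption.
  - apply Rmult_le_compat; [nra|lra| |exact H3]. apply Rmult_le_compat_r; lra.
Qed.

End LowerBound.

(** * Asymptotics *)

Lemma exp_le_compat x y : x <= y -> exp x <= exp y.
Proof. intros [H|H]; [left; now apply exp_increasing|right; now rewrite H]. Qed.

Lemma Rpower_ge_1 x a : 1 <= x -> 0 <= a -> 1 <= Rpower x a.
Proof.
  intros Hx Ha. unfold Rpower. rewrite <- exp_0. apply exp_le_compat.
  assert (0 <= ln x) by (rewrite <- ln_1; apply ln_le; lra). nra.
Qed.

Lemma Rpower_pow_root x k : 0 < x -> (1 <= k)%nat -> Rpower x (1 / INR k) ^ k = x.
Proof.
  intros Hx Hk. apply le_INR in Hk. simpl in Hk.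
  rewrite <- Rpower_pow by (unfold Rpower; apply exp_pos). rewrite Rpower_mult.
  replace (1 / INR k * INR k) with 1 by (field; lra). now apply Rpower_1.
Qed.

Lemma Rpower_unbounded al K : 0 < al -> exists n0, forall n, (n0 <= n)%nat -> K < Rpower (INR (S n)) al.
Proof.
  intros Ha. destruct (nfloor_ex (exp (K / al)) ltac:(left; apply exp_pos)) as [n0 [_ H]].
  exists n0. intros n Hn. apply le_INR in Hn. rewrite S_INR.
  assert (Hlt : exp (K / al) < INR n + 1) by lra.
  assert (P := exp_pos (K / al)).
  assert (L : K / al < ln (INR n + 1)) by (rewrite <- (ln_exp (K / al)); now apply ln_increasing).
  assert (L2 : K < al * ln (INR n + 1)).
  { apply Rmult_lt_compat_l with (r := al) in L; [|exact Ha]. replace (al * (K / al)) with K in L by (field; lra). exact L. }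
  unfold Rpower. assert (E := exp_ineq1_le (al * ln (INR n + 1))). lra.
Qed.

(** Comparison with the telescoping series of [1 / (n (n + 1))]. *)
Lemma ex_series_inv_sqr : ex_series (fun n => / (INR (S n) * INR (S n))).
Proof.
  apply (ex_series_le (V := R_CompleteNormedModule) _ (fun n => 2 * / (INR (S n) * INR (S (S n))))).
  - intros n. change (Rabs (/ (INR (S n) * INR (S n))) <= 2 * / (INR (S n) * INR (S (S n)))).
    assert (H := pos_INR n). rewrite !S_INR. rewrite Rabs_pos_eq by (left; apply Rinv_0_lt_compat; nra).
    apply Rmult_le_reg_r with ((INR n + 1) * (INR n + 1) * (INR n + 1 + 1)); [repeat apply Rmult_lt_0_compat; lra|].
    replace (/ ((INR n + 1) * (INR n + 1)) * ((INR n + 1) * (INR n + 1) * (INR n + 1 + 1))) with (INR n + 1 + 1) by (field; lra).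
    replace (2 * / ((INR n + 1) * (INR n + 1 + 1)) * ((INR n + 1) * (INR n + 1) * (INR n + 1 + 1))) with (2 * (INR n + 1)) by (field; lra).
    lra.
  - apply (ex_series_scal (V := R_NormedModule) 2). exists 1.
    assert (Hs : forall n, sum_n (fun n => / (INR (S n) * INR (S (S n)))) n = 1 - / INR (S (S n))).
    { induction n.
      - rewrite sum_O. simpl. field.
      - rewrite sum_Sn, IHn. unfold plus; simpl plus. rewrite !S_INR. assert (H := pos_INR n).
        change (1 - / (INR n + 1 + 1) + / ((INR n + 1 + 1) * (INR n + 1 + 1 + 1)) = 1 - / (INR n + 1 + 1 + 1)). field. lra. }
    change (is_lim_seq (sum_n (fun n => / (INR (S n) * INR (S (S n))))) 1).
    apply (is_lim_seq_ext (fun n => 1 - / INR (S (S n)))); [intros; now rewrite Hs|].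
    replace (Finite 1) with (Rbar_minus 1 0) by (simpl; f_equal; ring).
    apply is_lim_seq_minus'; [apply is_lim_seq_const|].
    apply (proj1 (is_lim_seq_incr_1 (fun n => / INR (S n)) 0)), (proj1 (is_lim_seq_incr_1 (fun n => / INR n) 0)).
    replace (Finite 0) with (Rbar_inv p_infty) by reflexivity.
    apply is_lim_seq_inv; [apply is_lim_seq_INR|discriminate].
Qed.

(** The inequality [y / K <= e^(y / K)], inverted and raised to the power [K]. *)
Lemma exp_neg_le_pow K y : (1 <= K)%nat -> 0 < y -> exp (- y) <= (INR K / y) ^ K.
Proof.
  intros HK Hy. apply le_INR in HK. simpl in HK.
  assert (H : y / INR K <= exp (y / INR K)) by (assert (A := exp_ineq1_le (y / INR K)); lra).
  assert (Hp : 0 < y / INR K) by (apply Rdiv_lt_0_compat; lra).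
  replace (exp (- y)) with ((/ exp (y / INR K)) ^ K).
  - apply pow_incr. split; [left; apply Rinv_0_lt_compat, exp_pos|].
    replace (INR K / y) with (/ (y / INR K)) by (field; lra). now apply Rinv_le_contravar.
  - rewrite <- exp_Ropp, <- Rpower_pow by apply exp_pos. unfold Rpower. rewrite ln_exp. f_equal. field. lra.
Qed.

Lemma LimInf_squeeze_0 (x t : nat -> R) c al : 0 < al -> 0 <= c ->
  (forall n, t n = Rpower (INR (S n)) al) -> (forall n, Rabs (x n) <= c / t n) -> LimInf_seq x = Finite 0.
Proof.
  intros Ha Hc Ht Hx. apply is_LimInf_seq_unique, is_lim_LimInf_seq. apply is_lim_seq_spec. intros eps.
  destruct (Rpower_unbounded al (c / eps) Ha) as [n0 H]. exists n0. intros n Hn.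
  specialize (H n Hn). rewrite <- Ht in H. rewrite Rminus_0_r. eapply Rle_lt_trans; [apply Hx|].
  assert (He := cond_pos eps). assert (Hp : 0 < t n) by (rewrite Ht; apply exp_pos).
  apply Rmult_lt_reg_r with (t n); [exact Hp|]. unfold Rdiv. rewrite Rmult_assoc, Rinv_l, Rmult_1_r by lra.
  apply Rmult_lt_compat_l with (r := eps) in H; [|exact He]. replace (eps * (c / eps)) with c in H by (field; lra). exact H.
Qed.

Lemma approx_num_lower_root d theta : (1 <= d)%nat -> 0 < theta < 1 ->
  (forall f, H2 d f -> H2 d (comp_op (multi_lens d theta) f)) ->
  exists b', 0 < b' /\ forall n, (1 <= n)%nat ->
    Rbar_le (Finite (exp (- b' * Rpower (INR n) (1 / (2 * INR d))))) (approx_num d (comp_op (multi_lens d theta)) n).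
Proof.
  intros Hd Ht HC. set (b0 := INR d * (3 + 2 * PI / theta)).
  assert (HD : 1 <= INR d) by (apply le_INR in Hd; exact Hd).
  assert (Hpi := PI_RGT_0).
  assert (Hb0 : 0 < b0).
  { apply Rmult_lt_0_compat; [lra|]. assert (0 < 2 * PI / theta) by (apply Rdiv_lt_0_compat; lra). lra. }
  exists (2 * b0). split; [lra|]. intros n Hn.
  assert (HN : 1 <= INR n) by (apply le_INR in Hn; exact Hn).
  set (t := Rpower (INR n) (1 / (2 * INR d))).
  assert (Ht1 : 1 <= t) by (apply Rpower_ge_1; [lra|apply Rdiv_le_0_compat; lra]).
  (* With [p = floor t + 1] one has [n <= p^(2 d)], and [p <= 2 t] since [t >= 1]; hence the factor
     2 in the witness. *)
  destruct (nfloor_ex t ltac:(lra)) as [k [Hk1 Hk2]]. set (p := S k).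
  assert (Hnp : (n <= (p * p) ^ d)%nat).
  { apply INR_le. rewrite pow_INR, mult_INR.
    replace (INR p * INR p) with (INR p ^ 2) by ring. rewrite <- pow_mult.
    rewrite <- (Rpower_pow_root (INR n) (2 * d)) by (lra || lia).
    rewrite mult_INR. replace (INR 2) with 2 by (simpl; ring). fold t. apply pow_incr. unfold p. rewrite S_INR. lra. }
  eapply Rbar_le_trans; [|apply (lower_bound_exp d theta p Ht ltac:(unfold p; lia) n Hnp HC)].
  assert (Hpk : INR p = INR k + 1) by (unfold p; apply S_INR).
  apply exp_le_compat. fold b0. rewrite Hpk. nra.
Qed.

Lemma approx_num_upper_root d theta : (1 <= d)%nat -> 0 < theta < 1 ->
  exists a b, 0 < a /\ 0 < b /\ forall n, (1 <= n)%nat ->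
    Rbar_le (approx_num d (comp_op (multi_lens d theta)) n) (Finite (a * exp (- b * Rpower (INR n) (1 / (2 * INR d))))).
Proof.
  intros Hd Ht. destruct (approx_num_upper d theta Hd Ht) as (Cst & r & HC & Hr & H).
  assert (HD : 1 <= INR d) by (apply le_INR in Hd; exact Hd).
  assert (Hln : ln r < 0) by (rewrite <- ln_1; apply ln_increasing; lra).
  (* With [m = floor (t / 4)] one has [2 m <= t / 2 < t], which gives the strict inequality for the
     rank; [m > t / 4 - 1] accounts for the division by [r] and for the 4. *)
  exists (Cst / r), (- ln r / 4). split; [apply Rdiv_lt_0_compat; lra|]. split; [lra|]. intros n Hn.
  assert (HN : 1 <= INR n) by (apply le_INR in Hn; exact Hn).
  set (t := Rpower (INR n) (1 / (2 * INR d))).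
  assert (Ht1 : 1 <= t) by (apply Rpower_ge_1; [lra|apply Rdiv_le_0_compat; lra]).
  destruct (nfloor_ex (t / 4) ltac:(lra)) as [m [Hm1 Hm2]].
  assert (Hmn : ((4 * (m * m)) ^ d < n)%nat).
  { apply INR_lt. rewrite pow_INR, !mult_INR. simpl (INR 4).
    replace ((1 + 1 + 1 + 1) * (INR m * INR m)) with ((2 * INR m) ^ 2) by ring. rewrite <- pow_mult.
    rewrite <- (Rpower_pow_root (INR n) (2 * d)) by (lra || lia).
    rewrite mult_INR. replace (INR 2) with 2 by (simpl; ring). fold t. assert (Hm0 := pos_INR m).
    assert (Hk : (1 <= 2 * d)%nat) by lia. revert Hk. generalize (2 * d)%nat. intros k Hk.
    destruct k as [|k]; [lia|]. simpl.
    assert ((2 * INR m) ^ k <= t ^ k) by (apply pow_incr; lra).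
    assert (0 < t ^ k) by (apply pow_lt; lra).
    apply Rle_lt_trans with (2 * INR m * t ^ k); [apply Rmult_le_compat_l; lra|apply Rmult_lt_compat_r; lra]. }
  eapply Rbar_le_trans; [exact (H m n Hmn)|]. simpl Rbar_le.
  unfold Rdiv at 1. rewrite Rmult_assoc. apply Rmult_le_compat_l; [lra|].
  rewrite <- Rpower_pow by lra. unfold Rpower.
  replace (/ r) with (exp (- ln r)) by (rewrite exp_Ropp, exp_ln by lra; reflexivity).
  rewrite <- exp_plus. apply exp_le_compat. nra.
Qed.

Theorem theorem6p1 (d : nat) (theta : R) :
  (1 <= d)%nat -> 0 < theta < 1 ->
  let Cphi := comp_op (multi_lens d theta) in
  H2_linear_op d Cphi /\ is_finite (op_norm d Cphi) /\
  (exists a b a' b' : R, 0 < a /\ 0 < b /\ 0 < a' /\ 0 < b' /\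
     forall n : nat, (1 <= n)%nat ->
       Rbar_le (Finite (a' * exp (- b' * Rpower (INR n) (1 / (2 * INR d)))))
               (approx_num d Cphi n) /\
       Rbar_le (approx_num d Cphi n)
               (Finite (a * exp (- b * Rpower (INR n) (1 / (2 * INR d + 1)))))) /\
  gamma_minus d Cphi = Finite 0 /\
  (forall p : R, 0 < p -> schatten d Cphi p).
Proof.
  intros Hd Ht Cphi.
  destruct (lens_blaschke_estimate theta Ht) as (A & q & HA & _ & HAq).
  assert (HK := fun z Hz => proj1 (HAq z Hz)).
  assert (Hlin := comp_op_linear d theta A Ht HK).
  assert (HD : 1 <= INR d) by (apply le_INR in Hd; exact Hd).
  destruct (approx_num_lower_root d theta Hd Ht (proj1 Hlin)) as (b' & Hb' & HL).
  destruct (approx_num_upper_root d theta Hd Ht) as (a & b & Ha & Hb & HU). fold Cphi in HL, HU.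
  set (alpha := fun n => real (approx_num d Cphi (S n))).
  set (t := fun n => Rpower (INR (S n)) (1 / (2 * INR d))).
  assert (HN : forall n, 1 <= INR (S n)) by (intros n; rewrite S_INR; assert (P := pos_INR n); lra).
  (* Squeezed between real numbers, the approximation number is finite, so [real] does not return
     its default value 0. *)
  assert (Hal : forall n, exp (- b' * t n) <= alpha n <= a * exp (- b * t n)).
  { intros n. specialize (HL (S n) ltac:(lia)). specialize (HU (S n) ltac:(lia)).
    unfold alpha. destruct (approx_num d Cphi (S n)); simpl in HL, HU; try contradiction. split; assumption. }
  (* The upper bound is available with the exponent [1 / (2 d)]; for [n >= 1] it implies the one
     stated with [1 / (2 d + 1)]. *)
  assert (Hmono : forall x, 1 <= x -> Rpower x (1 / (2 * INR d + 1)) <= Rpower x (1 / (2 * INR d))).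
  { intros x Hx. unfold Rpower. apply exp_le_compat.
    assert (0 <= ln x) by (rewrite <- ln_1; apply ln_le; lra).
    apply Rmult_le_compat_r; [assumption|]. unfold Rdiv. rewrite !Rmult_1_l. apply Rinv_le_contravar; lra. }
  assert (Ht1 : forall n, 1 <= t n) by (intros n; apply Rpower_ge_1; [apply HN|apply Rdiv_le_0_compat; lra]).
  split; [exact Hlin|]. split; [exact (comp_op_bounded d theta A Ht HA HK)|]. split; [|split].
  - exists a, b, 1, b'. repeat (split; [assumption || lra|]). intros n Hn.
    rewrite Rmult_1_l. split; [now apply HL|]. eapply Rbar_le_trans; [now apply HU|]. simpl.
    apply Rmult_le_compat_l; [lra|]. apply exp_le_compat.
    assert (M := Hmono (INR n) ltac:(apply le_INR in Hn; exact Hn)). nra.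
  - apply (LimInf_squeeze_0 _ t (Rabs (ln a) + b') (1 / (2 * INR d))).
    + apply Rdiv_lt_0_compat; lra.
    + assert (P := Rabs_pos (ln a)). lra.
    + reflexivity.
    + intros n. fold (alpha n). destruct (Hal n) as [A1 A2]. specialize (Ht1 n).
      assert (P0 : 0 < alpha n) by (eapply Rlt_le_trans; [apply exp_pos|exact A1]).
      (* Here [n^(1/d) = t^2], whereas [ln (1 / a_n)] is bounded by a multiple of [t], so the
         quotient is [O(1 / t)]. *)
      assert (HD2 : Rpower (INR (S n)) (1 / INR d) = t n * t n).
      { unfold t. rewrite <- Rpower_plus. f_equal. field. lra. }
      rewrite HD2.
      assert (L1 : - b' * t n <= ln (alpha n)).
      { rewrite <- (ln_exp (- b' * t n)). apply ln_le; [apply exp_pos|exact A1]. }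
      assert (L2 : ln (alpha n) <= ln a - b * t n).
      { replace (ln a - b * t n) with (ln (a * exp (- b * t n))); [now apply ln_le|].
        rewrite ln_mult, ln_exp by (auto; apply exp_pos). ring. }
      replace (ln (1 / alpha n)) with (- ln (alpha n)) by (unfold Rdiv; rewrite Rmult_1_l; symmetry; now apply ln_Rinv).
      assert (B1 := Rle_abs (ln a)). assert (P1 := Rabs_pos (ln a)).
      unfold Rdiv. rewrite Rabs_mult, (Rabs_pos_eq (/ (t n * t n))) by (left; apply Rinv_0_lt_compat; nra).
      apply Rmult_le_reg_r with (t n * t n); [nra|]. rewrite Rmult_assoc, Rinv_l, Rmult_1_r by nra.
      replace ((Rabs (ln a) + b') * / t n * (t n * t n)) with ((Rabs (ln a) + b') * t n) by (field; lra).
      apply Rabs_le_between. split; nra.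
  - intros p Hp. unfold schatten.
    (* Chosen so that [t^K = n^2], which turns the exponential decay into a summable power. *)
    set (K := (2 * (2 * d))%nat). assert (HKn : (1 <= K)%nat) by (unfold K; lia).
    set (c := (INR K / (p * b)) ^ K).
    apply (ex_series_le (V := R_CompleteNormedModule) _ (fun n => exp (p * ln a) * c * / (INR (S n) * INR (S n)))).
    + intros n. fold (alpha n). change (Rabs (Rpower (alpha n) p) <= exp (p * ln a) * c * / (INR (S n) * INR (S n))).
      destruct (Hal n) as [A1 A2]. specialize (Ht1 n). specialize (HN n).
      assert (P0 : 0 < alpha n) by (eapply Rlt_le_trans; [apply exp_pos|exact A1]).
      assert (L2 : ln (alpha n) <= ln a - b * t n).
      { replace (ln a - b * t n) with (ln (a * exp (- b * t n))); [now apply ln_le|].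
        rewrite ln_mult, ln_exp by (auto; apply exp_pos). ring. }
      rewrite Rabs_pos_eq by (left; apply exp_pos). unfold Rpower.
      apply Rle_trans with (exp (p * ln a) * exp (- (p * b * t n))).
      * rewrite <- exp_plus. apply exp_le_compat. nra.
      * rewrite (Rmult_assoc (exp (p * ln a)) c). apply Rmult_le_compat_l; [left; apply exp_pos|].
        assert (Hpb : 0 < p * b) by nra.
        eapply Rle_trans; [apply (exp_neg_le_pow K); [exact HKn|nra]|].
        right. unfold c. replace (INR K / (p * b * t n)) with (INR K / (p * b) * / t n) by (field; repeat split; lra).
        rewrite Rpow_mult_distr. f_equal. rewrite pow_inv. f_equal.
        assert (R := Rpower_pow_root (INR (S n)) (2 * d) ltac:(lra) ltac:(lia)).
        rewrite mult_INR in R. replace (INR 2) with 2 in R by (simpl; ring). fold (t n) in R.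
        unfold K. rewrite (Nat.mul_comm 2), pow_mult, R. ring.
    + apply (ex_series_scal (V := R_NormedModule) (exp (p * ln a) * c)). apply ex_series_inv_sqr.
Qed.
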